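(* For every $\mathbb A\in\mathcal{CDD}_N$, $\mathbb A\ll\mathbb J$.
   Context: $N\ge 1$ is a fixed integer. Hilbert spaces are complex and of arbitrary dimension (possibly $0$, possibly uncountable). $\mathrm{CDD}_N$ is the class of all $N$-tuples $A=(A_1,\dots,A_N)$ of closed densely defined linear operators acting in a common (arbitrary) Hilbert space; $A$ is trivial if this space is zero-dimensional. For a closed subspace $E$ with orthogonal projection $P_E$: $E\in\mathrm{red}(A)$ means $P_EA_j\subset A_jP_E$ for all $j$; then $A|_E$ is the tuple of restrictions of $A_j$ to $D(A_j)\cap E$, regarded as operators in $E$. $A\equiv B$ means $A_j=U^{-1}B_jU$ for all $j$ for some unitary $U$. $\mathcal{CDD}_N$ is the class of unitary equivalence classes $\mathbb A$ of members $A$ of $\mathrm{CDD}_N$; $\mathbb O$ is the class of trivial tuples. Direct sums (coordinatewise, in Hilbert space direct sums) are well defined on $\mathcal{CDD}_N$; for a cardinal $\alpha$, $\alpha\odot\mathbb A$ is the direct sum of $\alpha$ copies of $\mathbb A$ ($0\odot\mathbb A=\mathbb O$). $\mathbb A\le\mathbb B$ iff $A\equiv B|_E$ for some $E\in\mathrm{red}(B)$ (this is a partial order); $\mathbb A\perp_u\mathbb B$ iff no $\mathbb X\neq\mathbb O$ satisfies $\mathbb X\le\mathbb A$ and $\mathbb X\le\mathbb B$; $\mathbb A\ll\mathbb B$ iff $\mathbb A\le\alpha\odot\mathbb B$ for some cardinal $\alpha$. $\boxplus$ denotes a direct sum whose summands are pairwise unitarily disjoint. $\mathbb A$ is minimal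 if, for every $\mathbb B\in\mathcal{CDD}_N$, $\mathbb A\ll\mathbb B$ implies $\mathbb A\le\mathbb B$; multiplicity free if there is no $\mathbb B\ne\mathbb O$ with $2\odot\mathbb B\le\mathbb A$; a hereditary idempotent if $\mathbb B=2\odot\mathbb B$ for every $\mathbb B\le\mathbb A$; semiminimal if $\mathbb A\perp_u\mathbb M$ for every minimal $\mathbb M$ and, whenever $\mathbb A\ll\mathbb B$, $\mathbb A$ may be written as $\mathbb A=\boxplus_{n=1}^\infty\mathbb A_n$ with $\mathbb A_n\le n\odot\mathbb B$ for all $n\ge 1$. $\mathbb J_I$ is the greatest (with respect to $\le$) multiplicity free member of $\mathcal{CDD}_N$; $\mathbb J_{III}$ is the greatest member of $\mathcal{CDD}_N$ that is both minimal and a hereditary idempotent; $\mathbb J_{II}$ is the greatest element of $\{\aleph_0\odot\mathbb A:\ \mathbb A\text{ semiminimal}\}$. These exist, are pairwise unitarily disjoint, and the unity of $\mathcal{CDD}_N$ is $\mathbb J=\mathbb J_I\boxplus\mathbb J_{II}\boxplus\mathbb J_{III}$. *)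

(* Defs.v *)
From HB Require Import structures.
From mathcomp Require Import all_boot all_order all_algebra finmap.
From mathcomp Require Import all_classical all_reals all_analysis.
From mathcomp Require Import complex ring lra.
From mathcomp.analysis Require showcase.summability.

Set Implicit Arguments.
Unset Strict Implicit.
Unset Printing Implicit Defensive.

Import Order.TTheory GRing.Theory Num.Theory.
Import numFieldNormedType.Exports.

Local Open Scope classical_set_scope.
Local Open Scope ring_scope.
Local Open Scope complex_scope.

#[local] Existing Instance summability.totally_filter.

(* The library form [{dot V for Num.conj}] is linear in its first argument. The
   scalar field is R[i], so the norm is the image in R[i] of a real number. *)
Record hilbertSpace (R : realType) := HilbertSpace {
  hcarrier :> completeNormedModType R[i];
  hdot : {dot hcarrier for Num.conj};
  hdot_norm : forall x : hcarrier, `|x| ^+ 2 = hdot x x }.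
Arguments hdot {R H} : rename.
Arguments hdot_norm {R H} : rename.

Notation "''[' u , v ]" := (hdot u%R v%R) : ring_scope.

Section BuildHilbert.
Variables (R : realType) (V : lmodType R[i]) (d : {dot V for Num.conj}).

Definition dotnorm (x : V) : R := Num.sqrt (complex.Re (d x x)).

(* Completeness of V for [dotnorm]: every Cauchy filter converges. *)
Definition dot_complete :=
  forall F : set_system V, ProperFilter F ->
  (forall e : R, 0 < e -> exists x, F [set y | dotnorm (x - y) < e]) ->
  exists l, forall e : R, 0 < e -> F [set y | dotnorm (l - y) < e].

Lemma ReD (a b : R[i]) : complex.Re (a + b) = complex.Re a + complex.Re b.
Proof. by case: a; case: b. Qed.

Lemma ImD (a b : R[i]) : complex.Im (a + b) = complex.Im a + complex.Im b.
Proof. by case: a; case: b. Qed.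

Lemma conjcE (a : R[i]) : Num.conj a = conjc a.
Proof. by []. Qed.

Lemma ReJ (a : R[i]) : complex.Re (Num.conj a) = complex.Re a.
Proof. by rewrite conjcE; case: a. Qed.

Lemma dotE (x : V) : d x x = (complex.Re (d x x))%:C.
Proof. by rewrite RRe_real// ger0_real// dnorm_ge0. Qed.

Lemma Redot_ge0 (x : V) : 0 <= complex.Re (d x x).
Proof. by have := dnorm_ge0 d x; rewrite dotE lecR. Qed.

Lemma dotnorm_ge0 (x : V) : 0 <= dotnorm x.
Proof. exact: sqrtr_ge0. Qed.

Lemma dotnorm_sqr (x : V) : (dotnorm x) ^+ 2 = complex.Re (d x x).
Proof. by rewrite sqr_sqrtr// Redot_ge0. Qed.

Lemma dotnorm_eq0 x : dotnorm x = 0 -> x = 0.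
Proof.
move=> h; apply/eqP; rewrite -(dnorm_eq0 d) dotE -dotnorm_sqr h expr0n/=.
by apply/eqP; rewrite -[_%:C]/((0 : R)%:C).
Qed.

Lemma dotnormZ (a : R[i]) x : (dotnorm (a *: x))%:C = `|a| * (dotnorm x)%:C.
Proof.
have n0 y : 0 <= (dotnorm y)%:C by rewrite ler0c dotnorm_ge0.
apply/eqP; rewrite -(@eqrXn2 _ 2)//; last exact: mulr_ge0.
apply/eqP.
by rewrite exprMn -!rmorphXn/= !dotnorm_sqr -!dotE dnormZ rmorphXn.
Qed.

Lemma Re_dotD x y : complex.Re (d (x + y) (x + y)) =
  complex.Re (d x x) + complex.Re (d y y) + 2 * complex.Re (d x y).
Proof. by rewrite dnormD !ReD ReJ; ring. Qed.

Lemma Re_dot_le x y : complex.Re (d x y) <= dotnorm x * dotnorm y.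
Proof.
have key (t : R) : 0 <= complex.Re (d x x) + t ^+ 2 * complex.Re (d y y)
    - 2 * t * complex.Re (d x y).
  have := Redot_ge0 (x + (- t)%:C *: y).
  rewrite Re_dotD.
  have -> : d x ((- t)%:C *: y) = (- t)%:C * d x y.
    by rewrite linearZr_LR/= conjcE conjc_real.
  rewrite [d (_ *: y) _]linearZl_LR/= linearZr_LR/= conjcE conjc_real.
  case: (d x x) => a a'; case: (d x y) => b b'; case: (d y y) => c c'.
  by rewrite /= !mul0r !subr0 => h; lra.
set a := dotnorm x; set b := dotnorm y; set r := complex.Re _.
have a0 : 0 <= a by exact: dotnorm_ge0.
have b0 : 0 <= b by exact: dotnorm_ge0.
move: key; rewrite -!dotnorm_sqr -/a -/b -/r => key.
have [bz|bn] := eqVneq b 0.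
  rewrite bz mulr0 leNgt; apply/negP => r0.
  have := key ((a ^+ 2 + 1) / (2 * r)).
  rewrite bz expr0n mulr0 addr0 (_ : 2 * _ * r = a ^+ 2 + 1); first by lra.
  by field; rewrite gt_eqF.
have [rn|rp] := leP r 0; first by rewrite (le_trans rn)// mulr_ge0.
have := key (a / b) => h.
have [az|an] := eqVneq a 0.
  have := key (r / b ^+ 2); rewrite az expr0n add0r mul0r => {}h.
  have : 0 <= - (r ^+ 2) / b ^+ 2.
    apply: le_trans h _; rewrite le_eqVlt; apply/orP; left; apply/eqP.
    by field.
  rewrite mulNr oppr_ge0 => h1.
  have : 0 < r ^+ 2 / b ^+ 2 by rewrite divr_gt0// exprn_gt0// lt_neqAle eq_sym bn.
  by rewrite ltNge h1.
have ap : 0 < a by rewrite lt_neqAle eq_sym an.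
have bp : 0 < b by rewrite lt_neqAle eq_sym bn.
have : 0 <= 2 * (a / b) * (a * b - r).
  apply: le_trans h _; rewrite le_eqVlt; apply/orP; left; apply/eqP.
  by field.
by rewrite pmulr_rge0 ?subr_ge0// mulr_gt0// divr_gt0.
Qed.

Lemma ler_dotnormD x y : dotnorm (x + y) <= dotnorm x + dotnorm y.
Proof.
rewrite -(@ler_pXn2r _ 2)// ?nnegrE ?addr_ge0 ?dotnorm_ge0//.
rewrite dotnorm_sqr Re_dotD sqrrD -!dotnorm_sqr.
by have := Re_dot_le x y; lra.
Qed.

Variable hc : dot_complete.

(* Alias of V carrying the norm and topology of d; the completeness proof is a
   parameter so that the instances below can use it. *)
Definition dot_space : Type := let _ := hc in V.
HB.instance Definition _ := GRing.Lmodule.on dot_space.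

Let nrm (x : dot_space) : R[i] := (dotnorm x)%:C.
Let nrmD (x y : dot_space) : nrm (x + y) <= nrm x + nrm y.
Proof. by rewrite -rmorphD/= lecR ler_dotnormD. Qed.
Let nrmZ (l : R[i]) (x : dot_space) : nrm (l *: x) = `|l| * nrm x.
Proof. exact: dotnormZ. Qed.
Let nrm0 (x : dot_space) : nrm x = 0 -> x = 0.
Proof. by move=> /complexI /dotnorm_eq0. Qed.

HB.instance Definition _ :=
  Lmodule_isNormed.Build R[i] dot_space nrmD nrmZ nrm0.

Let dcomplete (F : set_system dot_space) : ProperFilter F -> cauchy F -> cvg F.
Proof.
move=> FF /cauchyP Fc.
have [e e0|l lP] := hc FF.
  have [|x Fx] := Fc e%:C; first by rewrite -[0]/(0%:C) ltcR.
  exists x; apply: filterS Fx => y.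
  by rewrite -ball_normE/= ltcR.
apply/cvg_ex; exists l; apply/fcvgrPdist_lt => -[e e'] e0.
move: (e0); rewrite ltcE/= => /andP[/eqP e'0 {}e0]; rewrite e'0.
by near=> y; rewrite [_ < _]ltcR; near: y; exact: lP.
Unshelve. all: by end_near. Qed.

HB.instance Definition _ := Uniform_isComplete.Build dot_space dcomplete.

Definition dot_form (x y : dot_space) : R[i] := d x y.

Let dot_form_bilinear : bilinear_for *%R (Num.conj \; *%R) dot_form.
Proof.
split=> [z a x y|z a x y]; first exact: (linearPl d z a x y).
exact: (linearPr d z a x y).
Qed.
HB.instance Definition _ := bilinear_isBilinear.Build R[i] dot_space dot_space
  R[i] *%R (Num.conj \; *%R) dot_form dot_form_bilinear.

Let dot_form_hermitian (x y : dot_space) :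
  dot_form x y = (-1) ^+ false * Num.conj (dot_form y x).
Proof. exact: hermC. Qed.
HB.instance Definition _ := isHermitianSesquilinear.Build R[i] dot_space
  false Num.conj dot_form dot_form_hermitian.

Let dot_form_gt0 (x : dot_space) : x != 0 -> 0 < dot_form x x.
Proof. by move=> x0; rewrite dnorm_gt0. Qed.
HB.instance Definition _ := isDotProduct.Build R[i] dot_space dot_form
  dot_form_gt0.

Let dot_form_norm (x : dot_space) : `|x| ^+ 2 = dot_form x x.
Proof.
have -> : `|x| = (dotnorm x)%:C by [].
by rewrite -rmorphXn/= dotnorm_sqr -dotE.
Qed.

Definition dot_hilbert : hilbertSpace R :=
  @HilbertSpace R dot_space dot_form dot_form_norm.

End BuildHilbert.

Section HilbertNorm.
Variables (R : realType) (H : hilbertSpace R).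
Implicit Types x y z : H.

(* The norm of H as a real number, see [nrmE]. *)
Definition nrm x : R := dotnorm hdot x.

Lemma nrmE x : `|x| = (nrm x)%:C.
Proof.
apply/eqP; rewrite -(@eqrXn2 _ 2)//; last by rewrite -[0]/(0%:C) lecR dotnorm_ge0.
by rewrite hdot_norm -rmorphXn/= dotnorm_sqr -dotE.
Qed.

Lemma nrm_ge0 x : 0 <= nrm x. Proof. exact: dotnorm_ge0. Qed.

Lemma nrm_sqr x : nrm x ^+ 2 = complex.Re '[x, x].
Proof. exact: dotnorm_sqr. Qed.

Lemma nrm_eq0 x : nrm x = 0 -> x = 0. Proof. exact: dotnorm_eq0. Qed.

Lemma nrm0 : nrm 0 = 0.
Proof. by apply: complexI; rewrite -nrmE normr0. Qed.

Lemma nrmN x : nrm (- x) = nrm x.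
Proof. by apply: complexI; rewrite -!nrmE normrN. Qed.

Lemma nrmB x y : nrm (x - y) = nrm (y - x).
Proof. by rewrite -nrmN opprB. Qed.

Lemma ler_nrmD x y : nrm (x + y) <= nrm x + nrm y.
Proof. exact: ler_dotnormD. Qed.

Lemma ler_nrmB x y z : nrm (x - z) <= nrm (x - y) + nrm (y - z).
Proof. by rewrite (le_trans _ (ler_nrmD _ _))// addrA subrK. Qed.

Lemma ler_nrm_dist x y : `|nrm x - nrm y| <= nrm (x - y).
Proof.
have h1 := ler_nrmD (x - y) y; have h2 := ler_nrmD (y - x) x.
rewrite !subrK nrmB in h1 h2; rewrite ler_norml; move: h1 h2.
by rewrite (nrmB y x); lra.
Qed.

Lemma nrmZ (a : R[i]) x : (nrm (a *: x))%:C = `|a| * (nrm x)%:C.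
Proof. exact: dotnormZ. Qed.

Lemma nrmDsqr x y : nrm (x + y) ^+ 2 <= 2 * (nrm x ^+ 2 + nrm y ^+ 2).
Proof.
have := ler_nrmD x y; have := nrm_ge0 x; have := nrm_ge0 y.
have := nrm_ge0 (x + y); set a := nrm _; set b := nrm _; set c := nrm _ => *.
have : a ^+ 2 <= (c + b) ^+ 2 by rewrite ler_pXn2r ?nnegrE ?addr_ge0.
by have := sqr_ge0 (c - b); lra.
Qed.

Lemma Re_hdot_le x y : `|complex.Re '[x, y]| <= nrm x * nrm y.
Proof.
rewrite ler_norml Re_dot_le andbT.
have := Re_dot_le hdot (- x) y; rewrite -/(nrm (- x)) nrmN -/(nrm y).
by rewrite linearNl/=; case: '[x, y] => a b /=; lra.
Qed.

Lemma Im_hdot_le x y : `|complex.Im '[x, y]| <= nrm x * nrm y.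
Proof.
have -> : complex.Im '[x, y] = complex.Re '[- 'i *: x, y].
  by rewrite linearZl_LR/=; case: '[x, y] => a b /=; ring.
apply: le_trans (Re_hdot_le _ _) _.
suff -> : nrm (- 'i *: x) = nrm x by [].
by apply: complexI; rewrite nrmZ normrN normCi mul1r.
Qed.

Lemma hcvgP (F : set_system H) : Filter F -> forall l : H,
  F --> l <-> forall e : R, 0 < e -> F [set y | nrm (l - y) < e].
Proof.
move=> FF l; split=> [/fcvgrPdist_lt h e e0|h].
  have := h e%:C; rewrite -[0]/(0%:C) ltcR => /(_ e0).
  by apply: filterS => y; rewrite nrmE ltcR.
apply/fcvgrPdist_lt => -[e e'] e0.
move: (e0); rewrite ltcE/= => /andP[/eqP e'0 {}e0]; rewrite e'0.
by apply: filterS (h e e0) => y /=; rewrite nrmE ltcR.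
Qed.

Lemma hnbhsP (x : H) (A : set H) :
  nbhs x A <-> exists2 e : R, 0 < e & forall y, nrm (x - y) < e -> A y.
Proof.
split=> [/nbhs_ballP[[e e'] /= e0 sub]|[e e0 sub]].
  move: (e0); rewrite ltcE/= => /andP[/eqP e'0 {}e0].
  exists e => // y xy; apply: sub; rewrite -ball_normE/= nrmE e'0.
  by rewrite ltcR.
apply/nbhs_ballP; exists e%:C; first by rewrite /= -[0]/(0%:C) ltcR.
by move=> y; rewrite -ball_normE/= nrmE ltcR => /sub.
Qed.

Lemma hcomplete : dot_complete (@hdot R H).
Proof.
move=> F FF Fc; have /cvg_ex[l] : cvg F.
  apply: cauchy_cvg; apply/cauchyP => -[e e'] e0.
  move: (e0); rewrite ltcE/= => /andP[/eqP e'0 {}e0].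
  have [x Fx] := Fc _ e0; exists x; apply: filterS Fx => y.
  by rewrite -ball_normE/= nrmE e'0 ltcR.
by move=> /hcvgP h; exists l.
Qed.

Lemma hdenseP (D : set H) :
  dense D <-> forall x (e : R), 0 < e -> exists2 y, D y & nrm (x - y) < e.
Proof.
split=> [dD x e e0|h O [x Ox] Oo].
  have [|y [/interior_subset/= xy Dy]] := dD (interior [set y | nrm (x - y) < e])
    _ (@open_interior _ _); last by exists y.
  by exists x; apply/hnbhsP; exists e.
have /hnbhsP[e e0 sub] : nbhs x O by exact: open_nbhs_nbhs.
by have [y Dy xy] := h x e e0; exists y; split=> //; apply: sub.
Qed.

Lemma hclosedP (D : set H) : closed D <->
  forall x, (forall e : R, 0 < e -> exists2 y, D y & nrm (x - y) < e) -> D x.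
Proof.
split=> [cD x h|h x cx].
  apply: cD => B /hnbhsP[e e0 sub].
  by have [y Dy xy] := h e e0; exists y; split=> //; apply: sub.
apply: h => e e0.
have [|y [Dy xy]] := cx [set y | nrm (x - y) < e]; last by exists y.
by apply/hnbhsP; exists e.
Qed.

End HilbertNorm.

Lemma hclosed2P (R : realType) (H K : hilbertSpace R) (G : set (H * K)) :
  closed G <-> forall x y, (forall e : R, 0 < e ->
    exists u v, [/\ G (u, v), nrm (x - u) < e & nrm (y - v) < e]) -> G (x, y).
Proof.
split=> [cG x y h|h [x y] cxy].
  apply: cG => B [[/= P Q] [/hnbhsP[e e0 sub] /hnbhsP[f f0 sub']] PQ].
  have [|u [v [Guv xu yv]]] := h (Num.min e f); first by rewrite lt_min e0.
  exists (u, v); split=> //; apply: PQ; split => /=.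
    by apply: sub; rewrite (lt_le_trans xu)// ge_min lexx.
  by apply: sub'; rewrite (lt_le_trans yv)// ge_min lexx orbT.
apply: h => e e0.
have [|[u v] [Guv [xu yv]]] := cxy [set p | nrm (x - p.1) < e /\ nrm (y - p.2) < e].
  exists ([set u | nrm (x - u) < e], [set v | nrm (y - v) < e]) => //=.
  by split; apply/hnbhsP; exists e.
by exists u, v.
Qed.

Section UnorderedSum.
Variables (R : realType) (I : choiceType).
Implicit Types (f g : I -> R) (A B : {fset I}).

Definition psum f A : R := \sum_(i <- A) f i.

(* Unordered sum: limit of the finite partial sums along the directed set of
   finite subsets of I. *)
Definition usum f : R := lim (psum f @ summability.totally).

Definition bounded_psum f := exists M : R, forall A, psum f A <= M.

Lemma psum_sub f A B : (forall i, 0 <= f i) -> (A `<=` B)%fset ->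
  psum f A <= psum f B.
Proof.
move=> f0 AB; rewrite /psum [leRHS](big_fsetID _ (mem A))/=.
have -> : [fset x in B | x \in A]%fset = A.
  by apply/fsetP => x; rewrite !inE andb_idl//; apply/fsubsetP.
by rewrite lerDl sumr_ge0.
Qed.

Lemma psum_cvg_sup f : (forall i, 0 <= f i) -> bounded_psum f ->
  psum f @ summability.totally --> sup (range (psum f)).
Proof.
move=> f0 [M fM]; have hs : has_sup (range (psum f)).
  split; first by exists (psum f fset0); exists fset0.
  by exists M => _ [A _ <-].
apply/cvgrPdist_lt => e e0.
have [_ [A _ <-] sA] := sup_adherent e0 hs.
exists A => // B AB /=.
have h1 : psum f B <= sup (range (psum f)).
  by apply: sup_upper_bound => //; exists B.
rewrite ger0_norm ?subr_ge0//.
by have := psum_sub f0 AB; lra.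
Qed.

Lemma psum_is_cvg f : bounded_psum (fun i => `|f i|) ->
  cvg (psum f @ summability.totally).
Proof.
move=> [M fM].
pose fp i := Num.max (f i) 0; pose fn i := Num.max (- f i) 0.
have bp : bounded_psum fp.
  exists M => A; apply: le_trans (fM A); apply: ler_sum => i _.
  by rewrite ge_max normr_ge0 andbT ler_norm.
have bn : bounded_psum fn.
  exists M => A; apply: le_trans (fM A); apply: ler_sum => i _.
  by rewrite ge_max normr_ge0 andbT -normrN ler_norm.
have -> : psum f = psum fp \- psum fn.
  apply/funext => A; rewrite /psum /= -sumrB; apply: eq_bigr => i _.
  by rewrite /fp /fn /Num.max; case: ltP => ?; case: ltP => ?; lra.
apply: is_cvgB; apply/cvg_ex.
  by exists (sup (range (psum fp))); apply: psum_cvg_sup => // i; rewrite le_max lexx orbT.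
by exists (sup (range (psum fn))); apply: psum_cvg_sup => // i; rewrite le_max lexx orbT.
Qed.

Lemma usum_cvg f : bounded_psum (fun i => `|f i|) ->
  psum f @ summability.totally --> usum f.
Proof. exact: psum_is_cvg. Qed.

Lemma usumD f g : bounded_psum (fun i => `|f i|) ->
  bounded_psum (fun i => `|g i|) ->
  usum (fun i => f i + g i) = usum f + usum g.
Proof.
move=> bf bg; apply: cvg_lim => //.
have -> : psum (fun i => f i + g i) = psum f \+ psum g.
  by apply/funext => A; rewrite /psum/= big_split.
by apply: cvgD; exact: usum_cvg.
Qed.

Lemma usumZ a f : bounded_psum (fun i => `|f i|) ->
  usum (fun i => a * f i) = a * usum f.
Proof.
move=> bf; apply: cvg_lim => //.
have -> : psum (fun i => a * f i) = (fun A => a * psum f A).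
  by apply/funext => A; rewrite /psum/= mulr_sumr.
by apply: cvgZr; exact: usum_cvg.
Qed.

Lemma usum0 : usum (fun=> 0) = 0.
Proof.
apply: cvg_lim => //; rewrite (_ : psum _ = fun=> 0); first exact: cvg_cst.
by apply/funext => A; rewrite /psum big1.
Qed.

Lemma psum_le_usum f A : (forall i, 0 <= f i) -> bounded_psum f ->
  psum f A <= usum f.
Proof.
move=> f0 bf; have -> : usum f = sup (range (psum f)).
  by apply: cvg_lim => //; exact: psum_cvg_sup.
apply: sup_upper_bound; last by exists A.
split; first by exists (psum f fset0); exists fset0.
by case: bf => M fM; exists M => _ [B _ <-].
Qed.

Lemma usum_le f M : (forall i, 0 <= f i) -> (forall A, psum f A <= M) ->
  usum f <= M.
Proof.
move=> f0 fM; have -> : usum f = sup (range (psum f)).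
  by apply: cvg_lim => //; apply: psum_cvg_sup => //; exists M.
apply: ge_sup; first by exists (psum f fset0); exists fset0.
by move=> _ [B _ <-].
Qed.

End UnorderedSum.

Section L2.
Variables (R : realType) (I : choiceType) (H : I -> hilbertSpace R).

Definition sqsum (x : forall i, H i) :=
  bounded_psum (fun i => nrm (x i) ^+ 2).

(* Carrier of the Hilbert space direct sum of the family H. *)
Record l2 := L2 { l2_val :> forall i, H i; l2P : sqsum l2_val }.

Lemma l2_inj (x y : l2) : (forall i, x i = y i) -> x = y.
Proof.
case: x y => [x xP] [y yP] /= xy.
have {}xy : x = y by apply: functional_extensionality_dep.
by subst y; congr L2; exact: Prop_irrelevance.
Qed.

HB.instance Definition _ := gen_eqMixin l2.
HB.instance Definition _ := gen_choiceMixin l2.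

Lemma sqsumD x y : sqsum x -> sqsum y -> sqsum (fun i => x i + y i).
Proof.
move=> [M xM] [N yN]; exists (2 * (M + N)) => A.
apply: (@le_trans _ _ (2 * (psum (fun i => nrm (x i) ^+ 2) A +
  psum (fun i => nrm (y i) ^+ 2) A))).
  rewrite /psum -big_split/= mulr_sumr; apply: ler_sum => i _.
  exact: nrmDsqr.
by have := xM A; have := yN A; lra.
Qed.

Lemma nrmZsqr (K : hilbertSpace R) (a : R[i]) (x : K) :
  nrm (a *: x) ^+ 2 = complex.Re (`|a| ^+ 2) * nrm x ^+ 2.
Proof.
have E : (complex.Re (`|a| ^+ 2))%:C = `|a| ^+ 2.
  by rewrite RRe_real// ger0_real// exprn_ge0.
apply: complexI; rewrite [RHS]rmorphM [X in X * _]E.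
by rewrite !rmorphXn/= [_%:C]nrmZ exprMn.
Qed.

Lemma sqsumZ (a : R[i]) x : sqsum x -> sqsum (fun i => a *: x i).
Proof.
move=> [M xM]; exists (complex.Re (`|a| ^+ 2) * M) => A.
rewrite /psum; under eq_bigr do rewrite nrmZsqr.
rewrite -mulr_sumr ler_wpM2l ?xM//.
have : 0 <= `|a| ^+ 2 by rewrite exprn_ge0.
by rewrite lecE => /andP[].
Qed.

Lemma sqsum0 : sqsum (fun=> 0).
Proof. by exists 0 => A; rewrite /psum big1// => i _; rewrite nrm0 expr0n. Qed.

Lemma sqsumN x : sqsum x -> sqsum (fun i => - x i).
Proof.
move=> [M xM]; exists M => A; apply: le_trans (xM A).
by rewrite /psum; under eq_bigr do rewrite nrmN.
Qed.

Definition l2_add (x y : l2) := L2 (sqsumD (l2P x) (l2P y)).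
Definition l2_opp (x : l2) := L2 (sqsumN (l2P x)).
Definition l2_zero := L2 sqsum0.
Definition l2_scale (a : R[i]) (x : l2) := L2 (sqsumZ a (l2P x)).

Lemma l2_addA : associative l2_add.
Proof. by move=> x y z; apply: l2_inj => i /=; rewrite addrA. Qed.
Lemma l2_addC : commutative l2_add.
Proof. by move=> x y; apply: l2_inj => i /=; rewrite addrC. Qed.
Lemma l2_add0 : left_id l2_zero l2_add.
Proof. by move=> x; apply: l2_inj => i /=; rewrite add0r. Qed.
Lemma l2_addN : left_inverse l2_zero l2_opp l2_add.
Proof. by move=> x; apply: l2_inj => i /=; rewrite addNr. Qed.

HB.instance Definition _ :=
  GRing.isZmodule.Build l2 l2_addA l2_addC l2_add0 l2_addN.

Lemma l2_scaleA a b x : l2_scale a (l2_scale b x) = l2_scale (a * b) x.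
Proof. by apply: l2_inj => i /=; rewrite scalerA. Qed.
Lemma l2_scale1 : left_id 1 l2_scale.
Proof. by move=> x; apply: l2_inj => i /=; rewrite scale1r. Qed.
Lemma l2_scaleDr : right_distributive l2_scale +%R.
Proof. by move=> a x y; apply: l2_inj => i /=; rewrite scalerDr. Qed.
Lemma l2_scaleDl x : {morph l2_scale^~ x : a b / a + b}.
Proof. by move=> a b; apply: l2_inj => i /=; rewrite scalerDl. Qed.

HB.instance Definition _ := GRing.Zmodule_isLmodule.Build R[i] l2
  l2_scaleA l2_scale1 l2_scaleDr l2_scaleDl.

Definition l2_dot (x y : l2) : R[i] :=
  usum (fun i => complex.Re '[x i, y i]) +i*
  usum (fun i => complex.Im '[x i, y i]).

Lemma bounded_psum_hdot (x y : l2) (f : I -> R) :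
  (forall i, `|f i| <= nrm (x i) * nrm (y i)) -> bounded_psum (fun i => `|f i|).
Proof.
case: (l2P x) (l2P y) => M xM [N yN] h; exists ((M + N) / 2) => A.
apply: (@le_trans _ _ ((psum (fun i => nrm (x i) ^+ 2) A +
  psum (fun i => nrm (y i) ^+ 2) A) / 2)).
  rewrite /psum -big_split/= mulr_suml; apply: ler_sum => i _.
  apply: le_trans (h i) _.
  by have := sqr_ge0 (nrm (x i) - nrm (y i)); lra.
by have := xM A; have := yN A; lra.
Qed.

Lemma bounded_Re_hdot (x y : l2) : bounded_psum (fun i => `|complex.Re '[x i, y i]|).
Proof. by apply: (bounded_psum_hdot (x := x) (y := y)) => i; exact: Re_hdot_le. Qed.
Lemma bounded_Im_hdot (x y : l2) : bounded_psum (fun i => `|complex.Im '[x i, y i]|).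
Proof. by apply: (bounded_psum_hdot (x := x) (y := y)) => i; exact: Im_hdot_le. Qed.

Lemma bounded_psumZ (a : R) (f : I -> R) : bounded_psum (fun i => `|f i|) ->
  bounded_psum (fun i => `|a * f i|).
Proof.
move=> [M h]; exists (`|a| * M) => A; rewrite /psum.
by under eq_bigr do rewrite normrM; rewrite -mulr_sumr ler_wpM2l// h.
Qed.

Lemma usum_lin2 (a b : R) (f g : I -> R) : bounded_psum (fun i => `|f i|) ->
  bounded_psum (fun i => `|g i|) ->
  usum (fun i => a * f i + b * g i) = a * usum f + b * usum g.
Proof.
by move=> bf bg; rewrite usumD ?usumZ//; exact: bounded_psumZ.
Qed.

Lemma usum_lin3 (a b c : R) (f g h : I -> R) : bounded_psum (fun i => `|f i|) ->
  bounded_psum (fun i => `|g i|) -> bounded_psum (fun i => `|h i|) ->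
  usum (fun i => a * f i + b * g i + c * h i) =
  a * usum f + b * usum g + c * usum h.
Proof.
move=> bf bg bh; rewrite usumD; [by rewrite usum_lin2 ?usumZ| |exact: bounded_psumZ].
have [M hM] := bounded_psumZ a bf; have [N hN] := bounded_psumZ b bg.
exists (M + N) => A; apply: le_trans (lerD (hM A) (hN A)).
by rewrite /psum -big_split/=; apply: ler_sum => i _; exact: ler_normD.
Qed.

Lemma l2_dotPl (z : l2) a x y :
  l2_dot (a *: x + y) z = a * l2_dot x z + l2_dot y z.
Proof.
rewrite /l2_dot; case: a => a b; apply/eqP; rewrite eq_complex/=.
have E i : '[(a +i* b) *: x i + y i, z i] =
    (a +i* b) * '[x i, z i] + '[y i, z i].
  by rewrite linearDl/= linearZl_LR.
have bI := bounded_Im_hdot x z; have bR := bounded_Re_hdot x z.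
have bI' := bounded_Im_hdot y z; have bR' := bounded_Re_hdot y z.
apply/andP; split; apply/eqP.
  rewrite (_ : (fun i => _) = fun i => a * complex.Re '[x i, z i] +
    (- b) * complex.Im '[x i, z i] + 1 * complex.Re '[y i, z i]).
    by rewrite usum_lin3// mul1r mulNr.
  apply/funext => i; rewrite E.
  by case: '[x i, z i] => u v; case: '[y i, z i] => u' v' /=; ring.
rewrite (_ : (fun i => _) = fun i => a * complex.Im '[x i, z i] +
    b * complex.Re '[x i, z i] + 1 * complex.Im '[y i, z i]).
  by rewrite usum_lin3// mul1r.
apply/funext => i; rewrite E.
by case: '[x i, z i] => u v; case: '[y i, z i] => u' v' /=; ring.
Qed.

Lemma l2_dotC (x y : l2) : l2_dot x y = (-1) ^+ false * Num.conj (l2_dot y x).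
Proof.
rewrite expr0 mul1r conjcE /l2_dot; apply/eqP; rewrite eq_complex/=.
have E i : '[x i, y i] = conjc '[y i, x i] by rewrite hermC/= expr0 mul1r.
apply/andP; split; apply/eqP.
  by congr usum; apply/funext => i; rewrite E; case: '[_, _].
rewrite -mulN1r -usumZ; last exact: bounded_Im_hdot.
by congr usum; apply/funext => i; rewrite E; case: '[_, _] => a b /=; ring.
Qed.

Lemma l2_dot_bilinear : bilinear_for *%R (Num.conj \; *%R) l2_dot.
Proof.
split=> [z a x y|z a x y]; first exact: l2_dotPl.
rewrite l2_dotC expr0 mul1r l2_dotPl rmorphD rmorphM/=.
by rewrite [l2_dot z x]l2_dotC [l2_dot z y]l2_dotC !expr0 !mul1r.
Qed.
HB.instance Definition _ := bilinear_isBilinear.Build R[i] l2 l2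
  R[i] *%R (Num.conj \; *%R) l2_dot l2_dot_bilinear.
HB.instance Definition _ := isHermitianSesquilinear.Build R[i] l2
  false Num.conj l2_dot l2_dotC.

Lemma l2_dotxx (x : l2) : l2_dot x x = (usum (fun i => nrm (x i) ^+ 2))%:C.
Proof.
apply/eqP; rewrite eq_complex/=; apply/andP; split; apply/eqP.
  by congr usum; apply/funext => i; rewrite nrm_sqr.
rewrite -[RHS](@usum0 R I); congr usum; apply/funext => i.
by rewrite dotE.
Qed.

Lemma l2_dot_gt0 (x : l2) : x != 0 -> 0 < l2_dot x x.
Proof.
move=> x0; rewrite l2_dotxx -[0]/(0%:C) ltcR ltNge; apply/negP => h.
move/eqP : x0; apply; apply: l2_inj => i /=.
apply: nrm_eq0; apply/eqP; rewrite -sqrf_eq0 eq_le sqr_ge0 andbT.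
apply: le_trans h; have := @psum_le_usum R I (fun i => nrm (x i) ^+ 2) [fset i]%fset.
by rewrite /psum big_seq_fset1; apply=> //; [move=> j; exact: sqr_ge0|exact: l2P].
Qed.
HB.instance Definition _ := isDotProduct.Build R[i] l2 l2_dot l2_dot_gt0.

Local Notation l2n := (dotnorm l2_dot).

Lemma l2n_sqr (x : l2) : l2n x ^+ 2 = usum (fun i => nrm (x i) ^+ 2).
Proof.
by rewrite dotnorm_sqr; exact: (congr1 (@complex.Re R) (l2_dotxx x)).
Qed.

Lemma l2n_le (x : l2) e : 0 <= e -> l2n x <= e <->
  forall A : {fset I}, psum (fun i => nrm (x i) ^+ 2) A <= e ^+ 2.
Proof.
move=> e0; rewrite -(@ler_pXn2r _ 2)// ?nnegrE ?dotnorm_ge0//.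
rewrite l2n_sqr; split=> [h A|h].
  apply: le_trans h; apply: psum_le_usum; last exact: l2P.
  by move=> j; exact: sqr_ge0.
by apply: usum_le => // i; exact: sqr_ge0.
Qed.

Lemma nrm_le_l2n (x : l2) i : nrm (x i) <= l2n x.
Proof.
have /(l2n_le _ (dotnorm_ge0 _ _))/(_ [fset i]%fset) := lexx (l2n x).
by rewrite /psum big_seq_fset1 ler_pXn2r// ?nnegrE ?dotnorm_ge0.
Qed.

Lemma l2_complete : dot_complete l2_dot.
Proof.
move=> F FF Fc.
have cl i : exists l : H i, forall e : R, 0 < e -> F [set y : l2 | nrm (l - y i) < e].
  have [|l lP] := @hcomplete R (H i) ((fun y : l2 => y i) @ F) _; last by exists l.
  move=> e e0; have [x Fx] := Fc e e0; exists (x i).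
  suff : F [set y : l2 | nrm (x i - y i) < e] by [].
  by apply: filterS Fx => y xy; exact: le_lt_trans (nrm_le_l2n (x - y) i) xy.
pose l i := projT1 (cid (cl i)).
have lP i : forall e : R, 0 < e -> F [set y : l2 | nrm (l i - y i) < e].
  exact: projT2 (cid (cl i)).
have key (e : R) : 0 < e -> exists2 x : l2, F [set y | l2n (x - y) < e] &
    F [set y : l2 | forall A : {fset I},
      psum (fun i => nrm (l i - y i) ^+ 2) A <= (2 * e) ^+ 2].
  move=> e0; have [x Fx] := Fc e e0; exists x => //.
  apply: filterS (Fx) => y /= xy A.
  have cv : (fun z : l2 => psum (fun i => nrm (z i - y i) ^+ 2) A) @ F -->
      psum (fun i => nrm (l i - y i) ^+ 2) A.
    rewrite /psum; apply: cvg_big => [|i _]; first exact: add_continuous.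
    suff : (fun z : l2 => nrm (z i - y i)) @ F --> nrm (l i - y i).
      by move=> h; rewrite expr2; apply: cvgM.
    apply/cvgrPdist_lt => d d0; apply: filterS (lP i d d0) => z /=.
    apply: le_lt_trans; apply: le_trans (ler_nrm_dist _ _) _.
    by rewrite opprB addrA subrK.
  apply: (@cvgr_to_le _ _ _ _ _ _ _ cv).
  apply: filterS (Fx) => z /= xz.
  have e2 : 0 <= 2 * e by lra.
  suff : l2n (z - y) <= 2 * e by move=> /(l2n_le _ e2)/(_ A).
  have := ler_dotnormD l2_dot (z - x) (x - y).
  rewrite addrA subrK; have : l2n (z - x) = l2n (x - z).
    by rewrite /dotnorm -opprB hnormN.
  by move=> ->; lra.
have lsq : sqsum l.
  have [x _ /filter_ex[y /= h]] := key 1 ltr01.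
  have h1 : sqsum (fun i => l i - y i) by exists ((2 * 1) ^+ 2).
  have := sqsumD h1 (l2P y); congr sqsum.
  by apply: functional_extensionality_dep => i; rewrite subrK.
exists (L2 lsq) => e e0; have [|x _ h] := key (e / 4); first by lra.
apply: filterS h => y /= h.
suff : l2n (L2 lsq - y) <= 2 * (e / 4) by lra.
by apply/l2n_le => //; lra.
Qed.

Definition l2_hilbert : hilbertSpace R := dot_hilbert l2_complete.

End L2.

Section ClosedSubspace.
Variables (R : realType) (H : hilbertSpace R).

Record closed_subspace := ClosedSubspace {
  subspace_set :> H -> Prop;
  subspace0 : subspace_set 0;
  subspaceP : forall (a : R[i]) x y,
    subspace_set x -> subspace_set y -> subspace_set (a *: x + y);
  subspace_closed : closed (subspace_set : set H) }.

Variable E : closed_subspace.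

(* Orthogonal projection onto E; [orthprojP] shows that the default value 0 of
   [xget] is never used. *)
Definition orthproj (x : H) : H :=
  xget 0 [set y | E y /\ forall z, E z -> '[x - y, z] = 0].

Lemma subspaceD x y : E x -> E y -> E (x + y).
Proof. by move=> Ex Ey; rewrite -[x]scale1r; apply: subspaceP. Qed.

Lemma subspaceZ a x : E x -> E (a *: x).
Proof. by move=> Ex; rewrite -[_ *: _]addr0; apply: subspaceP => //; exact: subspace0. Qed.

Lemma subspaceN x : E x -> E (- x).
Proof. by move=> Ex; rewrite -scaleN1r; exact: subspaceZ. Qed.

Lemma subspaceB x y : E x -> E y -> E (x - y).
Proof. by move=> Ex Ey; apply: subspaceD => //; exact: subspaceN. Qed.

Lemma nrmD_sqr (x y : H) :
  nrm (x + y) ^+ 2 = nrm x ^+ 2 + nrm y ^+ 2 + 2 * complex.Re '[x, y].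
Proof. by rewrite !nrm_sqr Re_dotD. Qed.

Lemma parallelogram (x y : H) :
  nrm (x + y) ^+ 2 + nrm (x - y) ^+ 2 = 2 * (nrm x ^+ 2 + nrm y ^+ 2).
Proof.
rewrite !nrmD_sqr nrmN linearNr/=; case: '[x, y] => a b /=; ring.
Qed.

Lemma Re_hdotZr (t : R) (u w : H) :
  complex.Re '[u, t%:C *: w] = t * complex.Re '[u, w].
Proof.
have -> : '[u, t%:C *: w] = t%:C * '[u, w].
  by rewrite [LHS]linearZr_LR/= conjcE conjc_real.
by case: '[u, w] => a b /=; ring.
Qed.

Lemma nrmZr_sqr (t : R) (w : H) : nrm (t%:C *: w) ^+ 2 = t ^+ 2 * nrm w ^+ 2.
Proof. by rewrite nrmZsqr -add_Re2_Im2/= expr0n addr0. Qed.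

Lemma orth_of_min (u z : H) :
  (forall a : R[i], nrm u <= nrm (u + a *: z)) -> '[u, z] = 0.
Proof.
have key (w : H) : (forall t : R, nrm u <= nrm (u + t%:C *: w)) ->
    complex.Re '[u, w] = 0.
  move=> h; set r := complex.Re _.
  have {}h (t : R) : 0 <= t ^+ 2 * nrm w ^+ 2 + 2 * t * r.
    have := h t; rewrite -(@ler_pXn2r _ 2)// ?nnegrE ?nrm_ge0// nrmD_sqr.
    by rewrite nrmZr_sqr Re_hdotZr -/r; lra.
  apply/eqP; rewrite -sqrf_eq0 eq_le sqr_ge0 andbT leNgt; apply/negP => r0.
  have [w0|wn] := eqVneq (nrm w) 0.
    by have := h (- r); rewrite w0; lra.
  have wp : 0 < nrm w ^+ 2 by rewrite exprn_gt0// lt_neqAle eq_sym wn nrm_ge0.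
  have := h (- r / nrm w ^+ 2).
  rewrite (_ : _ + _ = - (r ^+ 2 / nrm w ^+ 2)); last by field.
  by rewrite leNgt oppr_lt0 divr_gt0.
move=> h; apply/eqP; rewrite eq_complex; apply/andP; split; apply/eqP => /=.
  by apply: key => t.
have := key ('i *: z); rewrite linearZr_LR/=.
case: '[u, z] => a b /= h1.
rewrite -[b]addr0 -[RHS]h1; last by move=> t; rewrite scalerA.
by ring.
Qed.

Lemma proj_exists (x : H) : exists y, E y /\ forall z, E z -> '[x - y, z] = 0.
Proof.
pose D := [set nrm (x - y) ^+ 2 | y in subspace_set E].
have Dinf : has_inf D.
  split; first by exists (nrm (x - 0) ^+ 2); exists 0 => //; exact: subspace0.
  by exists 0 => _ [y _ <-]; exact: sqr_ge0.
pose d := inf D.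
have dP y : E y -> d <= nrm (x - y) ^+ 2.
  by move=> Ey; apply: ge_inf; [exact: (proj2 Dinf)|exists y].
pose B (e : R) := [set y | E y /\ nrm (x - y) ^+ 2 < d + e].
have Bne e : 0 < e -> B e !=set0.
  by move=> e0; have [_ [y Ey <-] h] := inf_adherent e0 Dinf; exists y.
pose F := filter_from [set e : R | 0 < e] B.
have FF : ProperFilter F.
  apply: filter_from_proper => //; apply: filter_from_filter; first by exists 1 => /=.
  move=> e f /= e0 f0; exists (Num.min e f); first by rewrite /= lt_min e0.
  move=> y [Ey ly]; split; split => //; apply: (lt_le_trans ly); rewrite lerD2l ge_min lexx ?orbT//.
have Bc e y y' : B e y -> B e y' -> nrm (y - y') ^+ 2 <= 4 * e.
  move=> [Ey ly] [Ey' ly'].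
  have := parallelogram (x - y') (x - y).
  rewrite (_ : x - y' - (x - y) = y - y'); last first.
    by rewrite opprB addrC addrA addrNK.
  rewrite (_ : x - y' + (x - y) = 2 *: (x - 2^-1 *: (y + y'))); last first.
    rewrite scalerBr scalerA divff ?scale1r// scaler_nat mulr2n.
    by rewrite addrACA [y + _]addrC opprD.
  rewrite nrmZsqr.
  have -> : complex.Re (`|2 : R[i]| ^+ 2) = 4.
    by rewrite ger0_norm// -natrX raddfMn.
  have := dP (2^-1 *: (y + y')) (subspaceZ _ (subspaceD Ey Ey')).
  by lra.
have [e e0|l lP] := @hcomplete R H F FF.
  have [y By] := Bne (e ^+ 2 / 8) (divr_gt0 (exprn_gt0 2 e0) (ltr0Sn _ 7)).
  exists y; exists (e ^+ 2 / 8) => /=; first by rewrite divr_gt0// exprn_gt0.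
  move=> y' By' /=; rewrite -(@ltr_pXn2r _ 2)// ?nnegrE ?nrm_ge0// ?ltW//.
  have := Bc _ _ _ By By'; have : 0 < e ^+ 2 by rewrite exprn_gt0.
  by rewrite /nrm; lra.
have El : E l.
  apply: (iffLR (hclosedP (subspace_set E))); first exact: subspace_closed.
  move=> e e0; have FE : F (subspace_set E) by exists 1 => //= y [].
  have [y [Ey ly]] := filter_ex (filterI FE (lP e e0)).
  by exists y.
have dl : nrm (x - l) ^+ 2 <= d.
  rewrite leNgt; apply/negP => dl.
  have d0 : 0 <= d by apply: lb_le_inf; [exact: (proj1 Dinf)|move=> _ [y _ <-]; exact: sqr_ge0].
  pose s := Num.sqrt d.
  have sl : s < nrm (x - l).
    by rewrite -(@ltr_pXn2r _ 2)// ?nnegrE ?nrm_ge0 ?sqrtr_ge0// sqr_sqrtr.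
  pose m := (nrm (x - l) + s) / 2.
  have s0 : 0 <= s by exact: sqrtr_ge0.
  have dm : d < m ^+ 2.
    rewrite -[d]sqr_sqrtr// ltr_pXn2r// ?nnegrE; rewrite /m -/s; lra.
  have FB : F (B (m ^+ 2 - d)) by exists (m ^+ 2 - d) => //=; lra.
  have lm : 0 < nrm (x - l) - m by rewrite /m; lra.
  have [y [[Ey xy] ly]] := filter_ex (filterI FB (lP _ lm)).
  have : nrm (x - y) < m.
    rewrite -(@ltr_pXn2r _ 2)// ?nnegrE ?nrm_ge0//; last by rewrite /m; lra.
    by lra.
  have := ler_nrmB x y l; rewrite (nrmB y l); move: ly; rewrite /= -/(nrm _).
  by lra.
exists l; split=> // z Ez; apply: orth_of_min => a.
rewrite -(@ler_pXn2r _ 2)// ?nnegrE ?nrm_ge0//; apply: (le_trans dl).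
have -> : x - l + a *: z = x - (l - a *: z) by rewrite opprB addrA addrAC.
by apply: dP; apply: subspaceB => //; exact: subspaceZ.
Qed.

Lemma orthprojP x : E (orthproj x) /\ forall z, E z -> '[x - orthproj x, z] = 0.
Proof. by rewrite /orthproj; case: xgetP => [y _ //|h]; have [y /h] := proj_exists x. Qed.

Lemma nrm_proj_le x y : E y -> nrm (y - orthproj x) <= nrm (y - x).
Proof.
move=> Ey; have [Ep o] := orthprojP x.
rewrite -(@ler_pXn2r _ 2)// ?nnegrE ?nrm_ge0//.
rewrite (nrmB y x) (_ : x - y = (x - orthproj x) + (orthproj x - y)); last first.
  by rewrite addrA subrK.
rewrite (nrmD_sqr (x - orthproj x)) o/=; last exact: subspaceB.
by rewrite (nrmB y) mulr0 addr0 lerDr sqr_ge0.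
Qed.

Record subspace_type := Subspace { subspace_val :> H; subspace_valP : E subspace_val }.

Lemma subspace_inj (x y : subspace_type) : subspace_val x = subspace_val y -> x = y.
Proof.
case: x y => [x xP] [y yP] /= xy; subst y; congr Subspace; exact: Prop_irrelevance.
Qed.

HB.instance Definition _ := gen_eqMixin subspace_type.
HB.instance Definition _ := gen_choiceMixin subspace_type.

Definition sub_add (x y : subspace_type) :=
  Subspace (subspaceD (subspace_valP x) (subspace_valP y)).
Definition sub_opp (x : subspace_type) := Subspace (subspaceN (subspace_valP x)).
Definition sub_zero := Subspace (subspace0 E).
Definition sub_scale a (x : subspace_type) := Subspace (subspaceZ a (subspace_valP x)).

Lemma sub_addA : associative sub_add.
Proof. by move=> x y z; apply: subspace_inj; exact: addrA. Qed.
Lemma sub_addC : commutative sub_add.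
Proof. by move=> x y; apply: subspace_inj; exact: addrC. Qed.
Lemma sub_add0 : left_id sub_zero sub_add.
Proof. by move=> x; apply: subspace_inj; exact: add0r. Qed.
Lemma sub_addN : left_inverse sub_zero sub_opp sub_add.
Proof. by move=> x; apply: subspace_inj; exact: addNr. Qed.
HB.instance Definition _ :=
  GRing.isZmodule.Build subspace_type sub_addA sub_addC sub_add0 sub_addN.

Lemma sub_scaleA a b x : sub_scale a (sub_scale b x) = sub_scale (a * b) x.
Proof. by apply: subspace_inj; exact: scalerA. Qed.
Lemma sub_scale1 : left_id 1 sub_scale.
Proof. by move=> x; apply: subspace_inj; exact: scale1r. Qed.
Lemma sub_scaleDr : right_distributive sub_scale +%R.
Proof. by move=> a x y; apply: subspace_inj; exact: scalerDr. Qed.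
Lemma sub_scaleDl x : {morph sub_scale^~ x : a b / a + b}.
Proof. by move=> a b; apply: subspace_inj; exact: scalerDl. Qed.
HB.instance Definition _ := GRing.Zmodule_isLmodule.Build R[i] subspace_type
  sub_scaleA sub_scale1 sub_scaleDr sub_scaleDl.

Definition sub_dot (x y : subspace_type) : R[i] := '[subspace_val x, subspace_val y].

Lemma sub_dot_bilinear : bilinear_for *%R (Num.conj \; *%R) sub_dot.
Proof.
split=> [z a x y|z a x y]; first exact: (linearPl hdot _ a).
exact: (linearPr hdot _ a).
Qed.
HB.instance Definition _ := bilinear_isBilinear.Build R[i] subspace_type
  subspace_type R[i] *%R (Num.conj \; *%R) sub_dot sub_dot_bilinear.

Lemma sub_dot_hermitian x y : sub_dot x y = (-1) ^+ false * Num.conj (sub_dot y x).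
Proof. exact: hermC. Qed.
HB.instance Definition _ := isHermitianSesquilinear.Build R[i] subspace_type
  false Num.conj sub_dot sub_dot_hermitian.

Lemma sub_dot_gt0 x : x != 0 -> 0 < sub_dot x x.
Proof.
move=> x0; rewrite dnorm_gt0; apply: contra_neq x0 => x0.
exact: subspace_inj.
Qed.
HB.instance Definition _ := isDotProduct.Build R[i] subspace_type sub_dot
  sub_dot_gt0.

Lemma sub_complete : dot_complete sub_dot.
Proof.
move=> F FF Fc.
have [|l lP] := @hcomplete R H (subspace_val @ F) _.
  by move=> e e0; have [x Fx] := Fc e e0; exists (subspace_val x).
have El : E l.
  apply: (iffLR (hclosedP (subspace_set E))); first exact: subspace_closed.
  move=> e e0; have [y /= ly] := filter_ex (lP e e0).
  have {}lP := lP e e0.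
  have : F [set y : subspace_type | nrm (l - subspace_val y) < e] by [].
  by move=> /filter_ex[z lz]; exists (subspace_val z) => //; exact: subspace_valP.
by exists (Subspace El).
Qed.

Definition subspace_hilbert : hilbertSpace R := dot_hilbert sub_complete.

End ClosedSubspace.

(* Partial operators; the values of [op_app] outside [op_dom] are irrelevant, and
   operators are only compared by [op_sub] and [op_eq]. *)
Record operator (R : realType) (H K : hilbertSpace R) :=
  Operator { op_dom : set H; op_app :> H -> K }.

Section Operators.
Variable R : realType.
Implicit Types H K L : hilbertSpace R.

Definition op_sub H K (S T : operator H K) :=
  forall x, op_dom S x -> op_dom T x /\ T x = S x.

Definition op_eq H K (S T : operator H K) := op_sub S T /\ op_sub T S.

(* Composition on its natural domain. *)
Definition op_comp H K L (S : operator K L) (T : operator H K) : operator H L :=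
  Operator [set x | op_dom T x /\ op_dom S (T x)] (fun x => S (T x)).

Definition op_of H K (f : H -> K) : operator H K := Operator setT f.

Definition op_linear H K (T : operator H K) :=
  op_dom T 0 /\ forall (a : R[i]) x y, op_dom T x -> op_dom T y ->
    op_dom T (a *: x + y) /\ T (a *: x + y) = a *: T x + T y.

Definition op_graph H K (T : operator H K) : set (H * K) :=
  [set p | op_dom T p.1 /\ p.2 = T p.1].

Definition op_closed H K (T : operator H K) := closed (op_graph T).

Definition op_dense H K (T : operator H K) := dense (op_dom T).

Lemma op_closedP H K (T : operator H K) : op_closed T <->
  forall x y, (forall e : R, 0 < e ->
    exists2 u, op_dom T u & nrm (x - u) < e /\ nrm (y - T u) < e) ->
  op_dom T x /\ y = T x.
Proof.
rewrite /op_closed hclosed2P; split=> h x y xy; apply: h => e /xy.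
  by move=> [u Du [xu yu]]; exists u, (T u); split.
by move=> [u [_ [[/= Du ->] xu yu]]]; exists u.
Qed.

Record unitary H K := Unitary {
  unitary_fun :> {linear H -> K};
  unitary_inv : K -> H;
  unitaryK : cancel unitary_fun unitary_inv;
  unitary_invK : cancel unitary_inv unitary_fun;
  unitary_dot : forall x y, '[unitary_fun x, unitary_fun y] = '[x, y] }.

End Operators.

Record CDD (R : realType) (N : nat) := MkCDD {
  hspace : hilbertSpace R;
  cdd_ops :> 'I_N -> operator hspace hspace;
  ops_linear : forall j, op_linear (cdd_ops j);
  ops_closed : forall j, op_closed (cdd_ops j);
  ops_dense : forall j, op_dense (cdd_ops j) }.

Arguments ops_linear {R N} c j.
Arguments ops_closed {R N} c j.
Arguments ops_dense {R N} c j.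

Section Restriction.
Variables (R : realType) (N : nat) (A : CDD R N).
Variable E : closed_subspace (hspace A).

Definition reduces := forall j,
  op_sub (op_comp (op_of (orthproj E)) (A j)) (op_comp (A j) (op_of (orthproj E))).

(* Only applied to elements of E when E reduces A. *)
Definition to_subspace (x : hspace A) : subspace_hilbert E :=
  if pselect (E x) is left Ex then Subspace Ex else sub_zero E.

Definition restrict_op (j : 'I_N) :
    operator (subspace_hilbert E) (subspace_hilbert E) :=
  @Operator R (subspace_hilbert E) (subspace_hilbert E)
           [set x : subspace_type E | op_dom (A j) x]
           (fun x : subspace_type E => to_subspace (A j x)).

Lemma to_subspaceK x : E x -> subspace_val (to_subspace x : subspace_type E) = x.
Proof. by rewrite /to_subspace; case: pselect. Qed.

Hypothesis Ered : reduces.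

Lemma proj_id x : E x -> orthproj E x = x.
Proof.
move=> Ex; have := nrm_proj_le x Ex; rewrite subrr nrm0 => h.
apply/esym/eqP; rewrite -subr_eq0; apply/eqP/nrm_eq0/le_anti.
by rewrite h nrm_ge0.
Qed.

Lemma reduces_E j x : op_dom (A j) x -> E x -> E (A j x).
Proof.
move=> Dx Ex; have [_ /=] := Ered (conj Dx I : op_dom (op_comp (op_of (orthproj E)) (A j)) x).
by rewrite (proj_id Ex) => ->; exact: (orthprojP E _).1.
Qed.

Lemma reduces_dom j x : op_dom (A j) x -> op_dom (A j) (orthproj E x).
Proof. by move=> Dx; have [[_ /=]] := Ered (conj Dx I : op_dom (op_comp (op_of (orthproj E)) (A j)) x). Qed.

Lemma restrict_linear j : op_linear (restrict_op j).
Proof.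
have [D0 Dl] := ops_linear A j; split; first exact: D0.
move=> a x y Dx Dy; have [h1 h2] := Dl a _ _ Dx Dy; split; first exact: h1.
have Ex := reduces_E Dx (subspace_valP x).
have Ey := reduces_E Dy (subspace_valP y).
apply: (@subspace_inj R (hspace A) E).
rewrite to_subspaceK; last by apply: reduces_E; [exact: h1|exact: subspace_valP].
rewrite [LHS]h2; congr (_ *: _ + _); rewrite to_subspaceK//.
Qed.

Lemma restrict_closed j : op_closed (restrict_op j).
Proof.
apply/op_closedP => x y h.
have [|h1 h2] := iffLR (op_closedP _) (ops_closed A j)
    (subspace_val (x : subspace_type E)) (subspace_val (y : subspace_type E)).
  move=> e /h[u Du [xu yu]]; exists (subspace_val u); first exact: Du.
  split; first exact: xu.
  have <- : subspace_val (to_subspace (A j (subspace_val u))) = A j (subspace_val u).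
    by apply: to_subspaceK; exact: (reduces_E Du (subspace_valP u)).
  exact: yu.
split; first exact: h1.
apply: (@subspace_inj R (hspace A) E); rewrite to_subspaceK//.
by apply: (reduces_E h1 (subspace_valP x)).
Qed.

Lemma restrict_dense j : op_dense (restrict_op j).
Proof.
apply/hdenseP => x e e0.
have [y Dy xy] := iffLR (hdenseP _) (ops_dense A j)
  (subspace_val (x : subspace_type E)) e e0.
exists (Subspace (orthprojP E y).1); first exact: reduces_dom.
by apply: le_lt_trans xy; exact: (nrm_proj_le y (subspace_valP x)).
Qed.

Definition restriction : CDD R N :=
  MkCDD restrict_linear restrict_closed restrict_dense.

End Restriction.

Section DirectSum.
Variables (R : realType) (N : nat) (I : choiceType) (A : I -> CDD R N).
Let H (i : I) := hspace (A i).

(* Only applied to square-summable families on the domain of [dsum_op]. *)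
Definition to_l2 (x : forall i, H i) : l2_hilbert H :=
  if pselect (sqsum x) is left xP then L2 xP else l2_zero H.

Definition dsum_op (j : 'I_N) : operator (l2_hilbert H) (l2_hilbert H) :=
  @Operator R (l2_hilbert H) (l2_hilbert H)
    [set x : l2 H | (forall i, op_dom (A i j) (x i)) /\ sqsum (fun i => A i j (x i))]
    (fun x : l2 H => to_l2 (fun i => A i j (x i))).

Lemma to_l2K x : sqsum x -> l2_val (to_l2 x : l2 H) = x.
Proof. by rewrite /to_l2; case: pselect. Qed.

Lemma dsum_linear j : op_linear (dsum_op j).
Proof.
have T0 i : A i j 0 = 0.
  have [D0 Dl] := ops_linear (A i) j.
  have [_] := Dl 1 0 0 D0 D0; rewrite !scale1r addr0 => h.
  by apply: (addrI (A i j 0)); rewrite addr0 -h.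
split.
  split=> [i|]; first exact: (ops_linear (A i) j).1.
  by exists 0 => B; rewrite /psum big1// => i _; rewrite [A i j _]T0 nrm0 expr0n.
move=> a x y [Dx sx] [Dy sy].
have E i : A i j (l2_val (a *: x + y : l2 H) i) =
    a *: A i j (l2_val x i) + A i j (l2_val y i).
  exact: ((ops_linear (A i) j).2 a _ _ (Dx i) (Dy i)).2.
have sxy : sqsum (fun i => A i j (l2_val (a *: x + y : l2 H) i)).
  have := sqsumD (sqsumZ a sx) sy; congr sqsum.
  by apply: functional_extensionality_dep => i; rewrite E.
split.
  split => // i; exact: ((ops_linear (A i) j).2 a _ _ (Dx i) (Dy i)).1.
apply: (@l2_inj R I H) => i; rewrite to_l2K// E.
have -> : l2_val (a *: dsum_op j x + dsum_op j y : l2 H) i =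
  a *: l2_val (dsum_op j x : l2 H) i + l2_val (dsum_op j y : l2 H) i by [].
by rewrite !to_l2K.
Qed.

Lemma dsum_closed j : op_closed (dsum_op j).
Proof.
apply/op_closedP => x y h.
have c i : op_dom (A i j) (l2_val x i) /\ l2_val y i = A i j (l2_val x i).
  apply: (iffLR (op_closedP _) (ops_closed (A i) j)) => e /h[u [Du su] [xu yu]].
  exists (l2_val u i); first exact: Du.
  split; first exact: le_lt_trans (nrm_le_l2n (x - u : l2 H) i) xu.
  have := le_lt_trans (nrm_le_l2n (y - dsum_op j u : l2 H) i) yu.
  have -> : l2_val (y - dsum_op j u : l2 H) i =
    l2_val y i - l2_val (dsum_op j u : l2 H) i by [].
  by rewrite to_l2K.
have sx : sqsum (fun i => A i j (l2_val x i)).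
  have := l2P y; congr sqsum; apply: functional_extensionality_dep => i.
  exact: (c i).2.
split; first by split=> // i; exact: (c i).1.
by apply: (@l2_inj R I H) => i; rewrite to_l2K//; exact: (c i).2.
Qed.

Lemma dsum_dense j : op_dense (dsum_op j).
Proof.
apply/hdenseP => x e e0.
pose f i := nrm (l2_val x i) ^+ 2.
have f0 i : 0 <= f i by exact: sqr_ge0.
have [B hB] : exists B : {fset I}, usum f - e ^+ 2 / 4 < psum f B.
  have : psum f @ summability.totally --> usum f.
    apply: usum_cvg; have [M xM] := l2P x; exists M => B.
    apply: le_trans (xM B); rewrite /psum; apply: ler_sum => i _.
    by rewrite ger0_norm.
  have e4 : 0 < e ^+ 2 / 4 by apply: divr_gt0 => //; exact: exprn_gt0.
  move=> /cvgrPdist_lt/(_ _ e4) [B _ hB].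
  exists B; have := hB B (fsubset_refl B); rewrite ltr_norml => /andP[_].
  by rewrite /=; lra.
pose n : R := (#|` B|).+1%:R.
have n0 : 0 < n by rewrite ltr0n.
pose d := e / (2 * n).
have d0 : 0 < d by rewrite divr_gt0// mulr_gt0.
have D0 i : op_dom (A i j) 0 by exact: (ops_linear (A i) j).1.
have T0 i : A i j 0 = 0.
  have [_] := (ops_linear (A i) j).2 1 0 0 (D0 i) (D0 i).
  rewrite !scale1r addr0 => h.
  by apply: (addrI (A i j 0)); rewrite addr0 -h.
have ex i : exists y, [/\ op_dom (A i j) y, i \in B -> nrm (l2_val x i - y) < d &
    i \notin B -> y = 0].
  have [iB|iB] := boolP (i \in B); last by exists 0; split.
  have [y Dy xy] := iffLR (hdenseP _) (ops_dense (A i) j) (l2_val x i) d d0.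
  by exists y.
pose y i := projT1 (cid (ex i)).
have yP i : [/\ op_dom (A i j) (y i), i \in B -> nrm (l2_val x i - y i) < d &
    i \notin B -> y i = 0] by exact: projT2 (cid (ex i)).
have fin (z : forall i, H i) : (forall i, i \notin B -> z i = 0) -> sqsum z.
  move=> z0; exists (psum (fun i => nrm (z i) ^+ 2) B) => C.
  rewrite /psum (big_fsetID _ (mem B))/= [X in _ + X]big1_fset ?addr0; last first.
    by move=> i; rewrite !inE => /andP[_ /z0 ->] _; rewrite nrm0 expr0n.
  apply: (@psum_sub R I (fun i => nrm (z i) ^+ 2)); first by move=> i; exact: sqr_ge0.
  by apply/fsubsetP => i; rewrite !inE => /andP[].
have sy : sqsum y by apply: fin => i; case: (yP i).
exists (L2 sy).
  split; first by move=> i; case: (yP i).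
  apply: fin => i iB; have [_ _ /(_ iB) /= ->] := yP i; exact: T0.
suff : nrm (x - L2 sy : l2_hilbert H) <= 3 / 4 * e by lra.
have e3 : 0 <= 3 / 4 * e by lra.
apply: (iffRL (l2n_le (x - L2 sy : l2 H) e3)) => C.
have step1 : psum (fun i => nrm (l2_val (x - L2 sy : l2 H) i) ^+ 2) C <=
    psum (fun i => nrm (l2_val (x - L2 sy : l2 H) i) ^+ 2) B + (usum f - psum f B).
  rewrite {1}/psum (big_fsetID _ (mem B))/=; apply: lerD.
    apply: (@psum_sub R I (fun i => nrm (l2_val (x - L2 sy : l2 H) i) ^+ 2)).
      by move=> i; exact: sqr_ge0.
    by apply/fsubsetP => i; rewrite !inE => /andP[].
  have := @psum_le_usum R I f (B `|` C)%fset f0 (l2P x).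
  rewrite {1}/psum (big_fsetID _ (mem B))/=.
  have -> : [fset i in (B `|` C)%fset | i \in B]%fset = B.
    by apply/fsetP => i; rewrite !inE; case: (i \in B); rewrite /= ?andbF.
  have -> : [fset i in (B `|` C)%fset | i \notin B]%fset = [fset i in C | i \notin B]%fset.
    by apply/fsetP => i; rewrite !inE; case: (i \in B); rewrite /= ?andbF.
  rewrite -/(psum f B) => h; rewrite lerBrDl; apply: le_trans h.
  rewrite lerD2l le_eqVlt; apply/orP; left; apply/eqP; apply: eq_fbigr => i.
  rewrite !inE => /andP[_ iB] _.
  by have [_ _ ->] := yP i; rewrite ?subr0.
have step2 : psum (fun i => nrm (l2_val (x - L2 sy : l2 H) i) ^+ 2) B <= e ^+ 2 / 4.
  apply: (@le_trans _ _ (\sum_(i <- B) d ^+ 2)).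
    rewrite /psum !big_seq; apply: ler_sum => i iB.
    have -> : l2_val (x - L2 sy : l2 H) i = l2_val x i - y i by [].
    rewrite ler_pXn2r// ?nnegrE ?nrm_ge0// ?ltW//.
    by have [_ /(_ iB)] := yP i.
  rewrite big_const_seq count_predT iter_addr addr0.
  rewrite -[leLHS]mulr_natr -/(#|` B|).
  have cn : (#|` B|)%:R <= n ^+ 2.
    by rewrite /n -natrX ler_nat (leq_trans (leqnSn _))// expnS expn1 leq_pmulr.
  apply: (@le_trans _ _ (d ^+ 2 * n ^+ 2)).
    by rewrite ler_wpM2l ?sqr_ge0.
  by rewrite /d le_eqVlt; apply/orP; left; apply/eqP; field; rewrite gt_eqF.
by have := sqr_ge0 e; lra.
Qed.

Definition dsum : CDD R N := MkCDD dsum_linear dsum_closed dsum_dense.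

End DirectSum.

Section UnitaryEquivalenceClasses.
Variables (R : realType) (N : nat).
Implicit Types A B M X J : CDD R N.

(* Members of the class of unitary equivalence classes are handled through
   representatives: equality of classes is [uequiv], and the zero class is the
   class of the [is_trivial] tuples. *)
Definition uequiv A B := exists U : unitary (hspace A) (hspace B), forall j,
  op_eq (A j) (op_comp (op_of (unitary_inv U)) (op_comp (B j) (op_of U))).

Definition is_trivial A := forall x : hspace A, x = 0.

Definition usub A B := exists (E : closed_subspace (hspace B))
  (Ered : reduces E), uequiv A (restriction Ered).

Definition udisjoint A B := ~ exists X, [/\ ~ is_trivial X, usub X A & usub X B].

(* The cardinal is the one of the index type I. *)
Definition multiple (I : choiceType) A : CDD R N := dsum (fun _ : I => A).

Definition ull A B := exists I : choiceType, usub A (multiple I B).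

Definition is_boxplus (I : choiceType) A (F : I -> CDD R N) :=
  (forall i k, i <> k -> udisjoint (F i) (F k)) /\ uequiv A (dsum F).

Definition is_minimal A := forall B, ull A B -> usub A B.

Definition multiplicity_free A :=
  ~ exists B, ~ is_trivial B /\ usub (multiple 'I_2 B) A.

Definition hereditary_idempotent A :=
  forall B, usub B A -> uequiv B (multiple 'I_2 B).

(* The summand of index n >= 1 is [F n.-1]. *)
Definition is_semiminimal A :=
  (forall M, is_minimal M -> udisjoint A M) /\
  forall B, ull A B -> exists F : nat -> CDD R N,
    is_boxplus A F /\ forall n, usub (F n) (multiple 'I_n.+1 B).

Definition is_greatest (P : CDD R N -> Prop) J := P J /\ forall X, P X -> usub X J.

Definition is_JI J := is_greatest multiplicity_free J.

Definition is_JII J :=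
  is_greatest (fun X => exists A, is_semiminimal A /\ uequiv X (multiple nat A)) J.

Definition is_JIII J :=
  is_greatest (fun X => is_minimal X /\ hereditary_idempotent X) J.

Definition is_unity J := exists JI JII JIII,
  [/\ is_JI JI, is_JII JII, is_JIII JIII &
      is_boxplus J (fun k : 'I_3 => nth JI [:: JI; JII; JIII] k)].

End UnitaryEquivalenceClasses.

(* Main.v *)
Require Import Defs.
From mathcomp Require Import all_boot all_order all_algebra.
From mathcomp Require Import all_classical all_reals all_analysis.
From HB Require Import structures.
From mathcomp Require Import finmap complex ring lra.
From mathcomp.analysis Require showcase.summability.

(** The bounded operators that intertwine two tuples together with their adjoints form a
    category ([intw]) in which the endomorphisms of [A] are the commutant of [A]. In it
    [usub] is the existence of an isometry ([usubP]), disjointness is the absence of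
    nonzero morphisms ([disjointP]), and [A] lies below a multiple of [C] exactly when
    the morphisms from [A] to [C] separate the points of [A] ([ullP]). All this rests on
    the partial isometry of the polar decomposition of an intertwiner ([polar]), obtained
    as a strong limit of Newton iterates, and on summing maximal orthogonal families of
    partial isometries ([orth_sum], [maximal_pisoms]).

    Hence it is enough that every nontrivial tuple [B] shares a nontrivial part with [J]
    ([unity_meets]), and for this that [B] has a nontrivial part of one of the three kinds
    which the summands of [J] dominate ([typed_subobject]). If [B] has a multiplicity free
    part, there is nothing to do. Otherwise suppose that [B] has a finite part [X], one
    whose commutant contains no isometry besides unitaries. Then every part [Y] of [X] is a
    double, and a minimal tuple above a finite double would embed [Y] into one half of
    [Y]; so [X] is disjoint from all minimal tuples. If [X] lies below a multiple of [B'],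
    copies of pieces of [B'] are removed from [X] greedily; finiteness of [X] makes the
    central covers of the remainders decrease to 0, and their successive differences
    decompose [X] as required. So [X] is semiminimal ([finite_semiminimal]).

    If [B] has no finite part either, each of its parts is its own double
    ([purely_infinite_doubling]). The part [X] generated by a single vector admits only
    countable orthogonal families of projections. If [X] lies below a multiple of [B'],
    a maximal partial isometry from [X] to [B'] leaves over countably many pieces, each
    equivalent to a piece of its own initial space, and the latter, being equivalent to
    infinitely many copies of itself, has room for all of them: [X] is minimal
    ([purely_infinite_minimal]). *)

Set Implicit Arguments.
Unset Strict Implicit.
Unset Printing Implicit Defensive.

Import Order.TTheory GRing.Theory Num.Theory.
Import numFieldNormedType.Exports.

Local Open Scope classical_set_scope.
Local Open Scope ring_scope.
Local Open Scope complex_scope.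

#[local] Existing Instance summability.totally_filter.

(** * The category of intertwiners *)

Section RealInnerProduct.
Variables (R : realType) (H : hilbertSpace R).
Implicit Types x y z : H.

Definition rdot x y : R := complex.Re '[x, y].

Lemma rdotC x y : rdot x y = rdot y x.
Proof. by rewrite /rdot hermC/= expr0 mul1r ReJ. Qed.

Lemma rdotDl x y z : rdot (x + y) z = rdot x z + rdot y z.
Proof. by rewrite /rdot linearDl/= ReD. Qed.

Lemma rdotDr x y z : rdot x (y + z) = rdot x y + rdot x z.
Proof. by rewrite !(rdotC x) rdotDl. Qed.

Lemma rdotNl x y : rdot (- x) y = - rdot x y.
Proof. by rewrite /rdot linearNl/=; case: '[x, y]. Qed.

Lemma rdotNr x y : rdot x (- y) = - rdot x y.
Proof. by rewrite !(rdotC x) rdotNl. Qed.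

Lemma rdotBl x y z : rdot (x - y) z = rdot x z - rdot y z.
Proof. by rewrite rdotDl rdotNl. Qed.

Lemma rdotBr x y z : rdot x (y - z) = rdot x y - rdot x z.
Proof. by rewrite rdotDr rdotNr. Qed.

Lemma rdotZr (c : R) x y : rdot x (c%:C *: y) = c * rdot x y.
Proof. exact: Re_hdotZr. Qed.

Lemma rdotZl (c : R) x y : rdot (c%:C *: x) y = c * rdot x y.
Proof. by rewrite rdotC rdotZr rdotC. Qed.

Lemma rdot0l x : rdot 0 x = 0.
Proof. by rewrite /rdot linear0l. Qed.

Lemma rdotxx x : rdot x x = nrm x ^+ 2.
Proof. by rewrite nrm_sqr. Qed.

Lemma rdot_le x y : rdot x y <= nrm x * nrm y.
Proof. exact: Re_dot_le. Qed.

Lemma hdot_eq0P (c : R[i]) : complex.Re c = 0 -> complex.Im c = 0 -> c = 0.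
Proof. by case: c => a b /= -> ->. Qed.

Lemma hdotBl x y z : '[x - y, z] = '[x, z] - '[y, z].
Proof. by rewrite linearBl. Qed.

Lemma hdotBr x y z : '[x, y - z] = '[x, y] - '[x, z].
Proof. by rewrite linearBr. Qed.

Lemma hdot_ext x y : (forall z, '[x, z] = '[y, z]) -> x = y.
Proof.
move=> h; apply/eqP; rewrite -subr_eq0 -(dnorm_eq0 hdot).
by rewrite hdotBl h subrr.
Qed.

Lemma hdotC x y : '[x, y] = Num.conj '[y, x].
Proof. by rewrite hermC/= expr0 mul1r. Qed.

Lemma hdot_extr x y : (forall z, '[z, x] = '[z, y]) -> x = y.
Proof. by move=> h; apply: hdot_ext => z; rewrite hdotC h -hdotC. Qed.

Lemma nrm_le0 x : nrm x <= 0 -> x = 0.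
Proof. by move=> h; apply: nrm_eq0; apply/le_anti; rewrite h nrm_ge0. Qed.

Lemma nrm_sqr_le (u v : R) : 0 <= v -> u ^+ 2 <= v ^+ 2 -> u <= v.
Proof.
move=> v0 h; rewrite leNgt; apply/negP => vu.
have : v ^+ 2 < u ^+ 2.
  by rewrite ltr_pXn2r// nnegrE; exact: ltW (le_lt_trans v0 vu).
by rewrite ltNge h.
Qed.

End RealInnerProduct.

Section Intertwiners.
Variables (R : realType) (N : nat).
Implicit Types A B C : CDD R N.

(** Bounded operators intertwining [A] and [B] in both directions. For [A = B] they
form the commutant of [A], a von Neumann algebra whose projections are those onto
the reducing subspaces of [A], so that all order relations between tuples become
statements about partial isometries. Carrying the adjoint as a field makes linearity
automatic, see [intw_linear]. *)
Record intw A B := Intw {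
  fn :> hspace A -> hspace B;
  ad : hspace B -> hspace A;
  fn_ad : forall x y, '[fn x, y] = '[x, ad y];
  fn_bd : exists M, forall x, nrm (fn x) <= M * nrm x;
  fn_dom : forall j x, op_dom (A j) x ->
    op_dom (B j) (fn x) /\ B j (fn x) = fn (A j x);
  ad_dom : forall j y, op_dom (B j) y ->
    op_dom (A j) (ad y) /\ A j (ad y) = ad (B j y) }.

Lemma ad_fn A B (T : intw A B) y x : '[ad T y, x] = '[y, T x].
Proof. by rewrite hdotC -fn_ad -hdotC. Qed.

Lemma intw_ext A B (T S : intw A B) : (forall x, T x = S x) -> T = S.
Proof.
move=> h; have E : fn T = fn S by apply/funext.
have E' : ad T = ad S.
  by apply/funext => y; apply: hdot_extr => x; rewrite -!fn_ad h.
case: T S E E' {h} => f f' a b c d [g g' a' b' c' d'] /= E E'.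
by subst g g'; congr Intw; exact: Prop_irrelevance.
Qed.

Lemma intw_linear A B (T : intw A B) a x y : T (a *: x + y) = a *: T x + T y.
Proof.
apply: hdot_ext => z.
by rewrite fn_ad !linearDl/= !linearZl_LR/= !fn_ad.
Qed.

Lemma intw0 A B (T : intw A B) : T 0 = 0.
Proof. by apply: hdot_ext => z; rewrite fn_ad !linear0l. Qed.

Lemma intwD A B (T : intw A B) x y : T (x + y) = T x + T y.
Proof. by rewrite -{1}[x]scale1r intw_linear scale1r. Qed.

Lemma intwZ A B (T : intw A B) a x : T (a *: x) = a *: T x.
Proof. by rewrite -[a *: x]addr0 intw_linear intw0 addr0. Qed.

Lemma intwN A B (T : intw A B) x : T (- x) = - T x.
Proof. by apply/eqP; rewrite -subr_eq0 opprK -intwD addNr intw0. Qed.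

Lemma intwB A B (T : intw A B) x y : T (x - y) = T x - T y.
Proof. by rewrite intwD intwN. Qed.

Lemma intw_bd A B (T : intw A B) :
  exists2 M, 0 <= M & forall x, nrm (T x) <= M * nrm x.
Proof.
have [M h] := fn_bd T; exists `|M|; rewrite ?normr_ge0// => x.
by apply: le_trans (h x) _; rewrite ler_wpM2r ?nrm_ge0 ?ler_norm.
Qed.

Lemma rdot_fn A B (T : intw A B) x y : rdot (T x) y = rdot x (ad T y).
Proof. by rewrite /rdot fn_ad. Qed.

Lemma adj_bd A B (f : hspace A -> hspace B) (g : hspace B -> hspace A) (M : R) :
  (forall x y, '[f x, y] = '[x, g y]) -> 0 <= M ->
  (forall x, nrm (f x) <= M * nrm x) -> forall y, nrm (g y) <= M * nrm y.
Proof.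
move=> fg M0 h y.
have [->|g0] := eqVneq (nrm (g y)) 0; first by rewrite mulr_ge0 ?nrm_ge0.
have gp : 0 < nrm (g y) by rewrite lt_neqAle eq_sym g0 nrm_ge0.
rewrite -(ler_pM2r gp) -expr2 -rdotxx /rdot -fg.
apply: le_trans (rdot_le _ _) _; apply: le_trans (ler_wpM2r (nrm_ge0 _) (h _)) _.
by rewrite mulrAC.
Qed.

Lemma ad_bd A B (T : intw A B) :
  exists M, forall x, nrm (ad T x) <= M * nrm x.
Proof. by have [M M0 h] := intw_bd T; exists M; exact: (adj_bd (fn_ad T)). Qed.

Definition iadj A B (T : intw A B) : intw B A :=
  @Intw B A (ad T) (fn T) (@ad_fn A B T) (ad_bd T) (@ad_dom A B T) (@fn_dom A B T).

Section Comp.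
Variables (A B C : CDD R N) (S : intw B C) (T : intw A B).
Lemma comp_fn_ad x y : '[S (T x), y] = '[x, ad T (ad S y)].
Proof. by rewrite !fn_ad. Qed.
Lemma comp_bd : exists M, forall x, nrm (S (T x)) <= M * nrm x.
Proof.
have [M M0 h] := intw_bd S; have [L L0 k] := intw_bd T.
exists (M * L) => x; apply: le_trans (h _) _.
by rewrite -mulrA ler_wpM2l.
Qed.
Lemma comp_dom j x : op_dom (A j) x ->
  op_dom (C j) (S (T x)) /\ C j (S (T x)) = S (T (A j x)).
Proof. by move=> /(fn_dom T)[h1 <-]; exact: fn_dom. Qed.
Lemma comp_adom j y : op_dom (C j) y ->
  op_dom (A j) (ad T (ad S y)) /\ A j (ad T (ad S y)) = ad T (ad S (C j y)).
Proof. by move=> /(ad_dom S)[h1 <-]; exact: ad_dom. Qed.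
Definition icomp : intw A C :=
  @Intw A C (fun x => S (T x)) (fun y => ad T (ad S y)) comp_fn_ad comp_bd comp_dom comp_adom.
End Comp.

Section One.
Variable A : CDD R N.
Lemma one_fn_ad (x y : hspace A) : '[x, y] = '[x, y]. Proof. by []. Qed.
Lemma one_bd : exists M : R, forall x : hspace A, nrm x <= M * nrm x.
Proof. by exists 1 => x; rewrite mul1r. Qed.
Lemma one_dom j (x : hspace A) : op_dom (A j) x -> op_dom (A j) x /\ A j x = A j x.
Proof. by []. Qed.
Definition ione : intw A A := @Intw A A id id one_fn_ad one_bd one_dom one_dom.
End One.

Section Lin.
Variables (A B : CDD R N) (c : R) (T S : intw A B).
Lemma lin_fn_ad x y : '[c%:C *: T x + S x, y] = '[x, c%:C *: ad T y + ad S y].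
Proof.
rewrite linearDl/= linearZl_LR/= linearDr/= linearZr_LR/= conjcE conjc_real.
by rewrite !fn_ad.
Qed.
Lemma lin_bd : exists M, forall x, nrm (c%:C *: T x + S x) <= M * nrm x.
Proof.
have [M M0 h] := intw_bd S; have [L L0 k] := intw_bd T.
exists (`|c| * L + M) => x; apply: le_trans (ler_nrmD _ _) _.
rewrite mulrDl lerD// -mulrA.
have -> : nrm (c%:C *: T x) = `|c| * nrm (T x).
  apply/eqP; rewrite -(@eqrXn2 _ 2)// ?mulr_ge0 ?nrm_ge0//.
  by rewrite nrmZr_sqr exprMn real_normK ?num_real.
by rewrite ler_wpM2l.
Qed.
Lemma lin_dom j x : op_dom (A j) x -> op_dom (B j) (c%:C *: T x + S x) /\
  B j (c%:C *: T x + S x) = c%:C *: T (A j x) + S (A j x).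
Proof.
move=> Dx; have [h1 h2] := fn_dom T Dx; have [h3 h4] := fn_dom S Dx.
by rewrite -h2 -h4; exact: (ops_linear B j).2.
Qed.
Lemma lin_adom j y : op_dom (B j) y -> op_dom (A j) (c%:C *: ad T y + ad S y) /\
  A j (c%:C *: ad T y + ad S y) = c%:C *: ad T (B j y) + ad S (B j y).
Proof.
move=> Dx; have [h1 h2] := ad_dom T Dx; have [h3 h4] := ad_dom S Dx.
by rewrite -h2 -h4; exact: (ops_linear A j).2.
Qed.
Definition ilin : intw A B :=
  @Intw A B (fun x => c%:C *: T x + S x) (fun y => c%:C *: ad T y + ad S y) lin_fn_ad lin_bd lin_dom lin_adom.
End Lin.

Section Zero.
Variables (A B : CDD R N).
Lemma zero_fn_ad (x : hspace A) (y : hspace B) : '[0 : hspace B, y] = '[x, 0 : hspace A].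
Proof. by rewrite linear0l linear0r. Qed.
Lemma zero_bd : exists M : R, forall x : hspace A, nrm (0 : hspace B) <= M * nrm x.
Proof. by exists 0 => x; rewrite nrm0 mul0r. Qed.
Lemma op0 C j : op_dom (C j) 0 /\ C j 0 = 0.
Proof.
have [D0 Dl] := ops_linear C j; split=> //.
have [_] := Dl 1 0 0 D0 D0; rewrite !scale1r addr0 => h.
by apply: (addrI (C j 0)); rewrite addr0 -h.
Qed.
Lemma zero_dom C (D : CDD R N) j (x : hspace C) : op_dom (C j) x ->
  op_dom (D j) (0 : hspace D) /\ D j 0 = 0.
Proof. by move=> _; exact: op0. Qed.
Definition izero : intw A B :=
  @Intw A B (fun=> 0) (fun=> 0) zero_fn_ad zero_bd (@zero_dom A B) (@zero_dom B A).
End Zero.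

Section Zmod.
Variables (A B : CDD R N).
HB.instance Definition _ := gen_eqMixin (intw A B).
HB.instance Definition _ := gen_choiceMixin (intw A B).
Definition iadd (T S : intw A B) := ilin 1 T S.
Definition iopp (T : intw A B) := ilin (-1) T (izero A B).
Lemma iaddE T S x : iadd T S x = T x + S x.
Proof. by rewrite /iadd /= scale1r. Qed.
Lemma ioppE T x : iopp T x = - T x.
Proof. by rewrite /iopp /= rmorphN scaleN1r addr0. Qed.
Lemma iaddA : associative iadd.
Proof. by move=> x y z; apply: intw_ext => u; rewrite !iaddE addrA. Qed.
Lemma iaddC : commutative iadd.
Proof. by move=> x y; apply: intw_ext => u; rewrite !iaddE addrC. Qed.
Lemma iadd0 : left_id (izero A B) iadd.
Proof. by move=> x; apply: intw_ext => u; rewrite iaddE add0r. Qed.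
Lemma iaddN : left_inverse (izero A B) iopp iadd.
Proof. by move=> x; apply: intw_ext => u; rewrite iaddE ioppE addNr. Qed.
HB.instance Definition _ :=
  GRing.isZmodule.Build (intw A B) iaddA iaddC iadd0 iaddN.
End Zmod.

End Intertwiners.
Arguments ione {R N A}.
Arguments fn_ad {R N A B} i x y.
Arguments ad_fn {R N A B} T y x.

Notation "T ^†" := (iadj T) (at level 2, format "T ^†").
Notation "S ∘ T" := (icomp S T) (at level 40, left associativity).

Section IntertwinerAlgebra.
Variables (R : realType) (N : nat).
Implicit Types A B C D : CDD R N.

Lemma i_comp A B C (S : intw B C) (T : intw A B) x : (S ∘ T) x = S (T x).
Proof. by []. Qed.
Lemma i_one A x : (ione : intw A A) x = x. Proof. by []. Qed.
Lemma i_zero A B x : (0 : intw A B) x = 0. Proof. by []. Qed.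
Lemma i_add A B (T S : intw A B) x : (T + S) x = T x + S x.
Proof. exact: iaddE. Qed.
Lemma i_opp A B (T : intw A B) x : (- T) x = - T x.
Proof. exact: ioppE. Qed.
Lemma i_sub A B (T S : intw A B) x : (T - S) x = T x - S x.
Proof. by rewrite i_add i_opp. Qed.
Definition iE := (i_comp, i_one, i_zero, i_sub, i_add, i_opp).

Lemma i_at A B (T S : intw A B) x : T = S -> T x = S x.
Proof. by move->. Qed.

Lemma compA A B C D (S : intw C D) (T : intw B C) (U : intw A B) :
  S ∘ (T ∘ U) = S ∘ T ∘ U.
Proof. exact: intw_ext. Qed.
Lemma comp1i A B (T : intw A B) : ione ∘ T = T. Proof. exact: intw_ext. Qed.
Lemma compi1 A B (T : intw A B) : T ∘ ione = T. Proof. exact: intw_ext. Qed.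
Lemma comp0i A B C (T : intw A B) : (0 : intw B C) ∘ T = 0.
Proof. exact: intw_ext. Qed.
Lemma compi0 A B C (T : intw B C) : T ∘ (0 : intw A B) = 0.
Proof. by apply: intw_ext => x; rewrite !iE intw0. Qed.
Lemma compDl A B C (S T : intw B C) (U : intw A B) : (S + T) ∘ U = S ∘ U + T ∘ U.
Proof. by apply: intw_ext => x; rewrite !iE. Qed.
Lemma compDr A B C (S : intw B C) (T U : intw A B) : S ∘ (T + U) = S ∘ T + S ∘ U.
Proof. by apply: intw_ext => x; rewrite !iE intwD. Qed.
Lemma compNl A B C (S : intw B C) (U : intw A B) : (- S) ∘ U = - (S ∘ U).
Proof. by apply: intw_ext => x; rewrite !iE. Qed.
Lemma compNr A B C (S : intw B C) (U : intw A B) : S ∘ (- U) = - (S ∘ U).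
Proof. by apply: intw_ext => x; rewrite !iE intwN. Qed.
Lemma compBl A B C (S T : intw B C) (U : intw A B) : (S - T) ∘ U = S ∘ U - T ∘ U.
Proof. by rewrite compDl compNl. Qed.
Lemma compBr A B C (S : intw B C) (T U : intw A B) : S ∘ (T - U) = S ∘ T - S ∘ U.
Proof. by rewrite compDr compNr. Qed.

Lemma adjK A B (T : intw A B) : T^†^† = T. Proof. exact: intw_ext. Qed.
Lemma adjM A B C (S : intw B C) (T : intw A B) : (S ∘ T)^† = T^† ∘ S^†.
Proof. exact: intw_ext. Qed.
Lemma adj1 A : (ione : intw A A)^† = ione. Proof. exact: intw_ext. Qed.
Lemma adj0 A B : (0 : intw A B)^† = 0. Proof. exact: intw_ext. Qed.
Lemma adjD A B (S T : intw A B) : (S + T)^† = S^† + T^†.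
Proof. exact: intw_ext. Qed.
Lemma adjN A B (T : intw A B) : (- T)^† = - T^†.
Proof. exact: intw_ext. Qed.
Lemma adjB A B (S T : intw A B) : (S - T)^† = S^† - T^†.
Proof. by rewrite adjD adjN. Qed.
Definition adjE := (adjM, adjK, adj1, adj0, adjB, adjD, adjN).

Lemma adj_inj A B (S T : intw A B) : S^† = T^† -> S = T.
Proof. by move=> h; rewrite -[S]adjK h adjK. Qed.

Lemma hdot_adj A B (T : intw A B) x y : '[T x, y] = '[x, T^† y].
Proof. exact: fn_ad. Qed.
Lemma rdot_adj A B (T : intw A B) x y : rdot (T x) y = rdot x (T^† y).
Proof. exact: rdot_fn. Qed.
Lemma rdot_adjr A B (T : intw A B) x y : rdot (T^† x) y = rdot x (T y).
Proof. by rewrite rdotC -rdot_adj rdotC. Qed.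

(** Because |T x|^2 = <T^† T x, x>. *)
Lemma adj_comp0 A B (T : intw A B) : T^† ∘ T = 0 -> T = 0.
Proof.
move=> h; apply: intw_ext => x; apply: nrm_le0.
have := rdotxx (T x); rewrite rdot_adj -i_comp h i_zero rdotC rdot0l => /esym/eqP.
by rewrite expf_eq0/= => /eqP ->.
Qed.

End IntertwinerAlgebra.

(** * Strong limits and orthogonal sums of intertwiners *)

Section Limits.
Variables (R : realType) (I : Type) (F : set_system I).
Context {FF : ProperFilter F}.

(** Stated with the real-valued [nrm], as the norm of the underlying normed module takes
values in [R[i]]. *)
Definition hlim (H : hilbertSpace R) (u : I -> H) (l : H) :=
  forall e : R, 0 < e -> F [set i | nrm (l - u i) < e].

Lemma ltr_eps0 (a c : R) : 0 <= c -> (forall e, 0 < e -> a <= e * c) -> a <= 0.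
Proof.
move=> c0 h; rewrite leNgt; apply/negP => a0.
have c1 : 0 < c + 1 by lra.
have := h (a / (c + 1)) (divr_gt0 a0 c1).
rewrite mulrAC ler_pdivlMr// ler_pM2l//; lra.
Qed.

Lemma hlim_unique (H : hilbertSpace R) (u : I -> H) l m :
  hlim u l -> hlim u m -> l = m.
Proof.
move=> ul um; apply/eqP; rewrite -subr_eq0; apply/eqP/nrm_le0.
apply: (@ltr_eps0 _ 2) => // e e0.
have [i [/= h1 h2]] := filter_ex (filterI (ul e e0) (um e e0)).
by have := ler_nrmB l (u i) m; rewrite (nrmB (u i)); lra.
Qed.

Lemma hlim_near (H : hilbertSpace R) (u v : I -> H) l :
  F [set i | u i = v i] -> hlim u l -> hlim v l.
Proof.
by move=> uv ul e e0; apply: filterS (filterI uv (ul e e0)) => i [/= <-].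
Qed.

Lemma hlim_le (H : hilbertSpace R) (u : I -> H) l (M : R) :
  hlim u l -> (forall i, nrm (u i) <= M) -> nrm l <= M.
Proof.
move=> ul uM; rewrite -subr_le0; apply: (@ltr_eps0 _ 1) => // e e0.
have [i /= h] := filter_ex (ul e e0).
by have := ler_nrmD (l - u i) (u i); rewrite subrK; have := uM i; lra.
Qed.

Lemma hlim_cauchy (H : hilbertSpace R) (u : I -> H) :
  (forall e, 0 < e -> exists i, F [set j | nrm (u i - u j) < e]) ->
  exists l, hlim u l.
Proof.
move=> h; have [|l lP] := @hcomplete R H (u @ F) _; last by exists l.
by move=> e e0; have [i Fi] := h e e0; exists (u i).
Qed.

Lemma hlim_adj (H K : hilbertSpace R) (u : I -> H) (v : I -> K) l m y x :
  hlim u l -> hlim v m -> (forall i, '[u i, y] = '[x, v i]) -> '[l, y] = '[x, m].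
Proof.
move=> ul vm uv; apply/eqP; rewrite -subr_eq0; apply/eqP.
have E i : '[l, y] - '[x, m] = '[l - u i, y] - '[x, m - v i].
  by rewrite hdotBl hdotBr uv; ring.
pose c := nrm x + nrm y.
have c0 : 0 <= c by rewrite addr_ge0 ?nrm_ge0.
apply: hdot_eq0P; apply/eqP; rewrite -normr_le0; apply: (ltr_eps0 c0) => e e0.
  have [i [/= h1 h2]] := filter_ex (filterI (ul e e0) (vm e e0)).
  rewrite (E i) raddfB/=; apply: le_trans (ler_normB _ _) _; rewrite /c mulrDr addrC.
  apply: lerD; apply: le_trans (Re_hdot_le _ _) _.
    by rewrite mulrC ler_wpM2r ?nrm_ge0 ?ltW.
  by rewrite ler_wpM2r ?nrm_ge0 ?ltW.
have [i [/= h1 h2]] := filter_ex (filterI (ul e e0) (vm e e0)).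
rewrite (E i) raddfB/=; apply: le_trans (ler_normB _ _) _; rewrite /c mulrDr addrC.
apply: lerD; apply: le_trans (Im_hdot_le _ _) _.
  by rewrite mulrC ler_wpM2r ?nrm_ge0 ?ltW.
by rewrite ler_wpM2r ?nrm_ge0 ?ltW.
Qed.

Variable N : nat.
Implicit Types A B : CDD R N.

Lemma hlim_fn A B (T : intw A B) (u : I -> hspace A) l :
  hlim u l -> hlim (fun i => T (u i)) (T l).
Proof.
move=> ul e e0; have [M M0 h] := intw_bd T.
have M1 : 0 < M + 1 by lra.
apply: filterS (ul _ (divr_gt0 e0 M1)) => i /= hi.
rewrite -intwB; apply: le_lt_trans (h _) _; rewrite ltr_pdivlMr// in hi.
by have := nrm_ge0 (l - u i); lra.
Qed.

(** Since the operators [A j], [B j] are closed, the intertwining relations survive a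
strong limit: if T_i x tends to W x and B_j (T_i x) = T_i (A_j x) tends to W (A_j x),
then W x is in the domain of B_j. The adjoints must converge strongly as well, as
the limit has to intertwine in both directions. *)
Lemma strong_limit A B (T : I -> intw A B) (M : R) :
  (forall i x, nrm (T i x) <= M * nrm x) ->
  (forall x, exists l, hlim (fun i => T i x) l) ->
  (forall y, exists l, hlim (fun i => (T i)^† y) l) ->
  exists W : intw A B, (forall x, hlim (fun i => T i x) (W x)) /\
    (forall y, hlim (fun i => (T i)^† y) (W^† y)).
Proof.
move=> TM fl gl; pose f x := projT1 (cid (fl x)); pose g y := projT1 (cid (gl y)).
have fP x : hlim (fun i => T i x) (f x) by exact: projT2 (cid (fl x)).
have gP y : hlim (fun i => (T i)^† y) (g y) by exact: projT2 (cid (gl y)).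
have fg x y : '[f x, y] = '[x, g y].
  by apply: (hlim_adj (fP x) (gP y)) => i; exact: hdot_adj.
have fb : exists M, forall x, nrm (f x) <= M * nrm x.
  by exists M => x; apply: (hlim_le (fP x)) => i; exact: TM.
have dom (C D : CDD R N) (S : I -> intw C D) (s : hspace C -> hspace D) j x :
    (forall x, hlim (fun i => S i x) (s x)) -> op_dom (C j) x ->
    op_dom (D j) (s x) /\ D j (s x) = s (C j x).
  move=> sP Dx; have [|h1 h2] := iffLR (op_closedP _) (ops_closed D j) (s x) (s (C j x)).
    move=> e e0.
    have [i [/= h1 h2]] := filter_ex (filterI (sP x e e0) (sP (C j x) e e0)).
    by have [h3 h4] := fn_dom (S i) Dx; exists (S i x); rewrite ?h4.
  by split.
have fd j x : op_dom (A j) x -> op_dom (B j) (f x) /\ B j (f x) = f (A j x).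
  exact: dom fP.
have gd j x : op_dom (B j) x -> op_dom (A j) (g x) /\ A j (g x) = g (B j x).
  exact: (dom _ _ (fun i => (T i)^†)).
by exists (@Intw R N A B f g fg fb fd gd).
Qed.

End Limits.

Section PartialIsometries.
Variables (R : realType) (N : nat).
Implicit Types A B : CDD R N.

Definition pisom A B (T : intw A B) := T ∘ T^† ∘ T = T.
Definition is_proj A (p : intw A A) := p^† = p /\ p ∘ p = p.
Definition isom A B (T : intw A B) := T^† ∘ T = ione.

Lemma pisom_adj A B (T : intw A B) : pisom T -> pisom T^†.
Proof. by move=> /(congr1 (@iadj _ _ _ _)); rewrite /pisom !adjE compA. Qed.

Lemma pisom_proj A B (T : intw A B) : pisom T -> is_proj (T^† ∘ T).
Proof. by move=> h; split; rewrite ?adjE// compA -!(compA T^†) h. Qed.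

Lemma isom_pisom A B (T : intw A B) : isom T -> pisom T.
Proof. by move=> h; rewrite /pisom -compA h compi1. Qed.

Lemma proj_pisom A (p : intw A A) : is_proj p -> pisom p.
Proof. by move=> [h1 h2]; rewrite /pisom h1 !h2. Qed.

Lemma proj1 A : is_proj (ione : intw A A).
Proof. by split; rewrite ?adjE ?compi1. Qed.

Lemma projC A (p : intw A A) : is_proj p -> is_proj (ione - p).
Proof.
move=> [h1 h2]; split; rewrite ?adjE ?h1//.
by rewrite compBl comp1i compBr compi1 h2 subrr subr0.
Qed.

Lemma pythagoras (H : hilbertSpace R) (x y : H) :
  rdot x y = 0 -> nrm (x + y) ^+ 2 = nrm x ^+ 2 + nrm y ^+ 2.
Proof. by move=> h; rewrite nrmD_sqr -/(rdot x y) h mulr0 addr0. Qed.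

Lemma proj_nrm A (p : intw A A) x : is_proj p -> nrm (p x) <= nrm x.
Proof.
move=> [h1 h2]; apply: nrm_sqr_le; rewrite ?nrm_ge0//.
rewrite -[x in leRHS](subrK (p x)) addrC pythagoras ?lerDl ?sqr_ge0//.
by rewrite rdot_adj h1 intwB -i_comp h2 subrr rdotC rdot0l.
Qed.

Lemma pisom_nrm_sqr A B (T : intw A B) x : pisom T ->
  nrm (T x) = nrm ((T^† ∘ T) x).
Proof.
move=> h; have [h1 h2] := pisom_proj h.
apply/eqP; rewrite -(@eqrXn2 _ 2)// ?nrm_ge0//; apply/eqP.
rewrite -!rdotxx [RHS]rdot_adj h1 -!i_comp h2 i_comp.
by rewrite rdot_adj.
Qed.

Lemma pisom_nrm A B (T : intw A B) x : pisom T -> nrm (T x) <= nrm x.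
Proof.
by move=> h; rewrite pisom_nrm_sqr//; apply: proj_nrm; exact: pisom_proj.
Qed.

Lemma isomK A B (T : intw A B) : isom T -> forall x, T^† (T x) = x.
Proof. by move=> h x; exact: (i_at x h). Qed.

Lemma isom_inj A B (T : intw A B) x : isom T -> T x = 0 -> x = 0.
Proof. by move=> /isomK h h0; rewrite -(h x) h0 intw0. Qed.

End PartialIsometries.

Section OrthogonalSums.
Variables (R : realType) (I : choiceType).
Local Notation tot := (@summability.totally I).

Lemma hlim_tot_cst (H : hilbertSpace R) (u : {fset I} -> H) l m (A0 : {fset I}) :
  hlim tot u l -> (forall F, (A0 `<=` F)%fset -> u F = m) -> l = m.
Proof.
move=> ul um; apply: (@hlim_unique R _ tot _ H u) => // e e0.
by exists A0 => // F /um /= ->; rewrite subrr nrm0.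
Qed.

Section Vectors.
Variables (H : hilbertSpace R) (u : I -> H).
Hypothesis uo : forall i k, i <> k -> rdot (u i) (u k) = 0.

Lemma rdot_sum (s : seq I) x : (forall k, k \in s -> rdot x (u k) = 0) ->
  rdot x (\sum_(k <- s) u k) = 0.
Proof.
move=> h; rewrite big_seq; elim/big_ind : _ => //.
- by rewrite rdotC rdot0l.
- by move=> a b ha hb; rewrite rdotDr ha hb addr0.
Qed.

Lemma nrm_sum (s : seq I) : uniq s ->
  nrm (\sum_(i <- s) u i) ^+ 2 = \sum_(i <- s) nrm (u i) ^+ 2.
Proof.
elim: s => [|i s IH] /=; first by rewrite !big_nil nrm0 expr0n.
move=> /andP[si us]; rewrite !big_cons pythagoras ?IH//.
by apply: rdot_sum => k ks; apply: uo => E; rewrite E ks in si.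
Qed.

(** By the Pythagorean identity the distance between two partial sums is a difference of
partial sums of the bounded family |u_i|^2. *)
Lemma orth_sum_cvg (M : R) : (forall A, psum (fun i => nrm (u i) ^+ 2) A <= M) ->
  exists l, hlim tot (fun A : {fset I} => \sum_(i <- A) u i) l.
Proof.
move=> hM; apply: hlim_cauchy => e e0.
pose f i := nrm (u i) ^+ 2.
have f0 i : 0 <= f i by exact: sqr_ge0.
have bf : bounded_psum f by exists M.
have hs : has_sup (range (psum f)).
  split; first by exists (psum f fset0); exists fset0.
  by exists M => _ [A _ <-].
have [_ [A _ <-] sA] := sup_adherent (exprn_gt0 2 e0) hs.
exists A; exists A => // B AB /=.
rewrite -(@ltr_pXn2r _ 2)// ?nnegrE ?nrm_ge0// ?ltW// nrmB.
have E : \sum_(i <- B) u i - \sum_(i <- A) u i = \sum_(i <- [fset x in B | x \notin A]%fset) u i.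
  rewrite (big_fsetID _ (mem A))/=.
  have -> : [fset x in B | x \in A]%fset = A.
    by apply/fsetP => x; rewrite !inE andb_idl//; apply/fsubsetP.
  by rewrite addrAC subrr add0r.
rewrite E nrm_sum ?fset_uniq//.
have h1 : psum f B <= sup (range (psum f)).
  by apply: sup_upper_bound => //; exists B.
have h2 : psum f B = psum f A + \sum_(i <- [fset x in B | x \notin A]%fset) f i.
  rewrite /psum (big_fsetID _ (mem A))/=.
  have -> // : [fset x in B | x \in A]%fset = A.
  by apply/fsetP => x; rewrite !inE andb_idl//; apply/fsubsetP.
by move: h1; rewrite h2 /f; lra.
Qed.
End Vectors.

Variable N : nat.
Implicit Types A B : CDD R N.

Definition pairwise_orth A B (T : I -> intw A B) := forall i k, i <> k ->
  T i ∘ (T k)^† = 0 /\ (T i)^† ∘ T k = 0.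

Lemma pairwise_orth_adj A B (T : I -> intw A B) :
  pairwise_orth T -> pairwise_orth (fun i => (T i)^†).
Proof. by move=> h i k /h[h1 h2]; rewrite !adjK. Qed.

Lemma sum_at A B (T : I -> intw A B) (s : seq I) x :
  (\sum_(i <- s) T i) x = \sum_(i <- s) T i x.
Proof.
elim: s => [|i s IH]; first by rewrite !big_nil.
by rewrite !big_cons i_add IH.
Qed.

Lemma adj_sum A B (T : I -> intw A B) (s : seq I) :
  (\sum_(i <- s) T i)^† = \sum_(i <- s) (T i)^†.
Proof.
elim: s => [|i s IH]; first by rewrite !big_nil adj0.
by rewrite !big_cons adjD IH.
Qed.

Lemma comp_sum0 A B (T : I -> intw A B) C (S : intw B C) (s : seq I) :
  (forall k, k \in s -> S ∘ T k = 0) -> S ∘ (\sum_(i <- s) T i) = 0.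
Proof.
move=> h; rewrite big_seq; elim/big_ind : _ => //; first by rewrite compi0.
by move=> a b ha hb; rewrite compDr ha hb addr0.
Qed.

(** Partial isometries with orthogonal initial spaces and orthogonal final spaces add up
to a partial isometry; being contractive, the finite sums satisfy Bessel's
inequality uniformly. *)
Lemma pisom_sum A B (T : I -> intw A B) (s : seq I) : (forall i, pisom (T i)) ->
  pairwise_orth T -> uniq s -> pisom (\sum_(i <- s) T i).
Proof.
move=> Tp To; elim: s => [|i s IH] /=; first by rewrite big_nil /pisom !compi0.
move=> /andP[si us]; rewrite big_cons; have {}IH := IH us.
set S := \sum_(j <- s) T j in IH *.
have ne k : k \in s -> i <> k by move=> ks E; rewrite E ks in si.
have h1 : (T i)^† ∘ S = 0 by apply: comp_sum0 => k /ne/To[].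
have h2 : T i ∘ S^† = 0.
  by rewrite /S adj_sum; apply: comp_sum0 => k /ne/To[].
have h3 : S ∘ (T i)^† = 0 by apply: adj_inj; rewrite !adjE.
have h4 : S^† ∘ T i = 0 by apply: adj_inj; rewrite !adjE.
have E : (T i + S) ∘ (T i + S)^† = T i ∘ (T i)^† + S ∘ S^†.
  by rewrite adjD compDl !compDr h2 h3 addr0 add0r.
rewrite /pisom E compDl !compDr Tp IH.
by rewrite -(compA (T i)) h1 -(compA S) h4 !compi0 addr0 add0r.
Qed.

Lemma bessel A B (T : I -> intw A B) x (F : {fset I}) : (forall i, pisom (T i)) ->
  pairwise_orth T -> psum (fun i => nrm (T i x) ^+ 2) F <= nrm x ^+ 2.
Proof.
move=> Tp To; have := pisom_nrm x (pisom_sum Tp To (fset_uniq F)).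
rewrite -(@ler_pXn2r _ 2)// ?nnegrE ?nrm_ge0// sum_at nrm_sum ?fset_uniq//.
move=> i k /To[_ h]; have := i_at x h; rewrite iE i_zero => h0.
by rewrite rdot_adj h0 rdotC rdot0l.
Qed.

(** [W] is the strong sum of the orthogonal family [T]: it agrees with each T_k on the
initial space of T_k, its adjoint agrees with T_k^† on the final space, and both
vanish on what is orthogonal to all of these spaces. *)
Definition is_orth_sum A B (T : I -> intw A B) (W : intw A B) :=
  [/\ pisom W,
      forall k, W ∘ (T k)^† = T k ∘ (T k)^†,
      forall k, (T k)^† ∘ W = (T k)^† ∘ T k,
      forall x, (forall i, T i x = 0) -> W x = 0 &
      forall y, (forall i, (T i)^† y = 0) -> W^† y = 0].

Lemma orth_sum A B (T : I -> intw A B) : (forall i, pisom (T i)) ->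
  pairwise_orth T -> exists W : intw A B, is_orth_sum T W.
Proof.
move=> Tp To; pose S (F : {fset I}) := \sum_(i <- F) T i.
have Tp' i : pisom (T i)^† by exact: pisom_adj.
have To' := pairwise_orth_adj To.
have oT C D (U : I -> intw C D) x : pairwise_orth U -> forall i k, i <> k ->
    rdot (U i x) (U k x) = 0.
  by move=> Uo i k /Uo[_ h]; rewrite rdot_adj -i_comp h rdotC rdot0l.
have lim C D (U : I -> intw C D) x : (forall i, pisom (U i)) -> pairwise_orth U ->
    exists l, hlim tot (fun F : {fset I} => (\sum_(i <- F) U i) x) l.
  move=> Up Uo; have [|l lP] := @orth_sum_cvg _ (fun i => U i x) (oT _ _ _ x Uo) (nrm x ^+ 2).
    by move=> F; exact: bessel.
  exists l; apply: hlim_near lP; rewrite [X in tot X](_ : _ = setT); first exact: filterT.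
  by rewrite predeqE => F /=; rewrite sum_at.
have [|x|y|W [WP WP']] := @strong_limit R {fset I} tot _ N A B S 1.
- by move=> F x; rewrite mul1r; apply: pisom_nrm; exact: pisom_sum (fset_uniq F).
- exact: lim.
- have [l lP] := lim _ _ _ y Tp' To'; exists l; apply: hlim_near lP.
  rewrite [X in tot X](_ : _ = setT); first exact: filterT.
  by rewrite predeqE => F /=; rewrite -adj_sum.
have c1 k : W ∘ (T k)^† = T k ∘ (T k)^†.
  apply: intw_ext => x; rewrite !i_comp.
  apply: (hlim_tot_cst (A0 := [fset k]%fset) (WP _)) => F; rewrite fsub1set => kF.
  rewrite /S sum_at (big_rem k)//= big_seq big1 ?addr0// => i.
  rewrite (rem_filter _ (fset_uniq F)) mem_filter => /andP[/eqP ik _].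
  exact: (i_at x (To i k ik).1).
have c2 k : W^† ∘ T k = (T k)^† ∘ T k.
  apply: intw_ext => x; rewrite !i_comp.
  apply: (hlim_tot_cst (A0 := [fset k]%fset) (WP' _)) => F; rewrite fsub1set => kF.
  rewrite /S adj_sum sum_at (big_rem k)//= big_seq big1 ?addr0// => i.
  rewrite (rem_filter _ (fset_uniq F)) mem_filter => /andP[/eqP ik _].
  exact: (i_at x (To i k ik).2).
have c2' k : (T k)^† ∘ W = (T k)^† ∘ T k by apply: adj_inj; rewrite !adjE.
have c3 x : (forall i, T i x = 0) -> W x = 0.
  move=> h; apply: (hlim_tot_cst (A0 := fset0) (WP x)) => F _.
  by rewrite /S sum_at big1.
have c4 y : (forall i, (T i)^† y = 0) -> W^† y = 0.
  move=> h; apply: (hlim_tot_cst (A0 := fset0) (WP' y)) => F _.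
  by rewrite /S adj_sum sum_at big1.
(* W (1 - W^† W) = 0, because T_k W^† W = T_k for every k. *)
exists W; split=> //.
apply/esym/eqP; rewrite -subr_eq0 -{1}[W]compi1 -(compA W) -compBr; apply/eqP.
apply: intw_ext => x; rewrite i_comp i_zero; apply: c3 => k.
rewrite -i_comp compBr compi1 compA.
have -> : T k ∘ W^† = T k ∘ (T k)^† by apply: adj_inj; rewrite !adjE.
by rewrite -compA c2' compA Tp subrr.
Qed.

End OrthogonalSums.

(** * Polar parts of intertwiners *)

Section NewtonIteration.
Variables (R : realType) (N : nat).
Implicit Types A B : CDD R N.

Definition contraction A B (T : intw A B) := forall x, nrm (T x) <= nrm x.

Lemma contraction_adj A B (T : intw A B) : contraction T -> contraction T^†.
Proof.
move=> h y; rewrite -[leRHS]mul1r; apply: (adj_bd (hdot_adj T)) => // x.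
by rewrite mul1r.
Qed.

Lemma rdot_ext (H : hilbertSpace R) (x y : H) :
  (forall z, rdot x z = rdot y z) -> x = y.
Proof.
move=> h; apply/eqP; rewrite -subr_eq0; apply/eqP/nrm_le0.
have := rdotxx (x - y); rewrite rdotBl h subrr => /esym/eqP.
by rewrite expf_eq0/= => /eqP ->.
Qed.

(** The obstruction to [T] being isometric. It is locked so that the linearity rules do
not see the sum in its definition. *)
Definition defect A B (T : intw A B) : intw A A := locked (ione - T^† ∘ T).

(** One Newton step T (3 - T^† T) / 2 towards the partial isometry of the polar
decomposition; it uses no square root and stays among the intertwiners. *)
Definition newton A B (T : intw A B) : intw A B := ilin 2^-1 (T ∘ defect T) T.

Lemma newtonE A B (T : intw A B) x :
  newton T x = (2^-1)%:C *: T (defect T x) + T x.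
Proof. by []. Qed.

Lemma defectE A B (T : intw A B) x : defect T x = x - T^† (T x).
Proof. by rewrite /defect -lock !iE. Qed.

Lemma gramE A B (T : intw A B) x : T^† (T x) = x - defect T x.
Proof. by rewrite defectE opprB addrC subrK. Qed.

Lemma rdot_defect A B (T : intw A B) x y : rdot (defect T x) y = rdot x (defect T y).
Proof. by rewrite rdot_adj /defect -lock !adjE. Qed.

Lemma defect_ge0 A B (T : intw A B) x : contraction T -> 0 <= rdot (defect T x) x.
Proof.
move=> h; rewrite defectE rdotBl rdot_adjr !rdotxx subr_ge0.
by rewrite ler_pXn2r ?nnegrE ?nrm_ge0.
Qed.

Lemma newton_contraction A B (T : intw A B) : contraction T -> contraction (newton T).
Proof.
move=> h x; apply: nrm_sqr_le; rewrite ?nrm_ge0//.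
rewrite newtonE -intwZ -intwD -rdotxx rdot_adj gramE !(intwD, intwZ).
have := defect_ge0 (defect T x) h; have := sqr_ge0 (nrm (defect T x)).
have := rdot_defect T (defect T x) x; rewrite -!rdotxx.
move: (defect T (defect T x)) => v; move: (defect T x) => u.
rewrite !(rdotBr, rdotDl, rdotDr, rdotZl, rdotZr).
by rewrite (rdotC x u) (rdotC x v) (rdotC v u); lra.
Qed.

Lemma defect_newton A B (T : intw A B) (P := defect T) :
  defect (newton T) = ilin (3 / 4) (P ∘ P) (ilin 4^-1 (P ∘ P ∘ P) 0).
Proof.
apply: intw_ext => x; apply: rdot_ext => z.
have -> : ilin (3 / 4) (P ∘ P) (ilin 4^-1 (P ∘ P ∘ P) 0) x =
  (3 / 4)%:C *: P (P x) + ((4^-1)%:C *: P (P (P x)) + 0) by [].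
rewrite addr0 defectE rdotBl rdot_adjr !newtonE -!intwZ -!intwD.
rewrite rdot_adj gramE !intwD !intwZ -/P.
have h1 y : rdot x (P y) = rdot (P x) y by rewrite rdot_defect.
have h2 y : rdot (P x) (P y) = rdot (P (P x)) y by rewrite -rdot_defect.
have h3 := rdot_defect T (P (P x)) z; rewrite -/P in h3.
move: h1 h2 h3 => /[dup] h1a /(_ z) h1b h2 h3.
have h4 := h1a (P z); have h5 := h2 z; have h6 := h2 (P z).
move: h1b h4 h5 h6 h3.
move: (P (P (P x))) (P (P x)) (P x) (P (P z)) (P z) => x3 x2 x1 z2 z1.
rewrite !(rdotBr, rdotDl, rdotDr, rdotZl, rdotZr); lra.
Qed.

Lemma newton_adj A B (T : intw A B) : (newton T)^† = newton T^†.
Proof.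
apply: intw_ext => y; apply: rdot_ext => z.
have E : rdot (newton T z) y = rdot z (newton T^† y).
  rewrite !newtonE rdotDl rdotDr rdotZl rdotZr !(rdot_adj T) rdot_defect.
  by rewrite !defectE adjK intwB.
by rewrite rdot_adjr rdotC E rdotC.
Qed.

(** Polynomials in [P] with nonnegative coefficients, in Horner form. The iterates are
explicit such polynomials in the defect of the starting point, and this replaces
the positivity of products of commuting positive operators. *)
Inductive ncone A (P : intw A A) : intw A A -> Prop :=
| ncone0 : ncone P 0
| ncone1 : ncone P ione
| nconeM G : ncone P G -> ncone P (P ∘ G)
| ncone_lin c G G' : 0 <= c -> ncone P G -> ncone P G' -> ncone P (ilin c G G').

Lemma ncone_comp A (P G G' : intw A A) : ncone P G -> ncone P G' -> ncone P (G ∘ G').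
Proof.
move=> h h'; elim: h => [||K _ IH|c K K' c0 _ IH _ IH'].
- by rewrite comp0i; exact: ncone0.
- by rewrite comp1i.
- by rewrite -compA; exact: nconeM.
- have -> : ilin c K K' ∘ G' = ilin c (K ∘ G') (K' ∘ G') by exact: intw_ext.
  exact: ncone_lin.
Qed.

Lemma ncone_iter A B (T : intw A B) m :
  ncone (defect T) (defect (iter m (@newton A B) T)) /\
  exists2 G, ncone (defect T) G & iter m (@newton A B) T = T ∘ G.
Proof.
elim: m => [|m [hR [G hG E]]] /=.
  split; first by rewrite -[X in ncone _ X]compi1; exact: nconeM (ncone1 _).
  by exists ione; [exact: ncone1|rewrite compi1].
set S := iter m _ T in hR E *; split.
  rewrite defect_newton; apply: ncone_lin; first by lra.
    exact: ncone_comp.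
  apply: ncone_lin; [by lra| |exact: ncone0].
  by do 2! apply: ncone_comp => //.
exists (ilin 2^-1 (G ∘ defect S) G).
  by apply: ncone_lin => //; exact: ncone_comp.
apply: intw_ext => x; rewrite newtonE E.
have -> : (T ∘ ilin 2^-1 (G ∘ defect (T ∘ G)) G) x =
  T ((2^-1)%:C *: G (defect (T ∘ G) x) + G x) by [].
by rewrite intw_linear.
Qed.

Lemma rdot_gram_defect A B (T : intw A B) x y :
  rdot (T (defect T x)) (T y) = rdot (T x) (T (defect T y)).
Proof.
rewrite !defectE !intwB rdotBl rdotBr; congr (_ - _).
by rewrite (rdot_adj T (_ (T x))) -(rdot_adjr T (T x)).
Qed.

(** It suffices to treat a power P^n of the defect P. As P is self-adjoint and commutes
with T^† T, half of the factors move to the other side, which leaves the case n = 0,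
a square, or n = 1, where <T P x, T x> = |T x|^2 - |T^† T x|^2. *)
Lemma ncone_ge0 A B (T : intw A B) G x : contraction T -> ncone (defect T) G ->
  0 <= rdot (T (G x)) (T x).
Proof.
move=> hT hG; have hT' := contraction_adj hT.
have key n : forall y, 0 <= rdot (T (iter n (defect T) y)) (T y).
  elim/ltn_ind: n => -[|[|n]] IH y /=.
  - by rewrite rdotxx sqr_ge0.
  - rewrite defectE intwB rdotBl subr_ge0 rdot_adj !rdotxx.
    by rewrite ler_pXn2r ?nnegrE ?nrm_ge0.
  - by rewrite -iterS iterSr -iterS iterS rdot_gram_defect; exact: IH.
(* the extra power makes the induction over the Horner form go through *)
suff : forall n, 0 <= rdot (T (iter n (defect T) (G x))) (T x) by move/(_ 0%N).
elim: hG => [||K _ IH|c K K' c0 _ IH _ IH'] n.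
- rewrite i_zero; elim: n => [|n IHn]; first by rewrite /= intw0 rdot0l.
  by rewrite iterSr intw0.
- exact: key.
- by rewrite i_comp -iterSr; exact: IH.
- have -> : iter n (defect T) (ilin c K K' x) =
    c%:C *: iter n (defect T) (K x) + iter n (defect T) (K' x).
    by elim: n => //= n ->; rewrite intw_linear.
  by rewrite intw_linear rdotDl rdotZl addr_ge0 ?mulr_ge0.
Qed.

Lemma newton_iter_contraction A B (T : intw A B) m : contraction T ->
  contraction (iter m (@newton A B) T).
Proof. by move=> h; elim: m => //= m; exact: newton_contraction. Qed.

(** With u = T_m x and v = T x, the claim |u - v|^2 <= |u|^2 - |v|^2 says that
|v|^2 <= Re <u, v>; each Newton step adds to u a term T G x with G in the cone. *)
Lemma newton_dist A B (T : intw A B) m x : contraction T ->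
  nrm (iter m (@newton A B) T x - T x) ^+ 2 <=
  nrm (iter m (@newton A B) T x) ^+ 2 - nrm (T x) ^+ 2.
Proof.
move=> hT; suff : nrm (T x) ^+ 2 <= rdot (iter m (@newton A B) T x) (T x).
  move: (iter m _ T x) (T x) => u v.
  by rewrite -!rdotxx !(rdotBl, rdotBr) (rdotC v u); lra.
elim: m => [|m IH]; first by rewrite rdotxx.
rewrite iterS newtonE rdotDl rdotZl.
have [hR [G hG E]] := ncone_iter T m.
have := ncone_ge0 x hT (ncone_comp hG hR).
by move: IH; rewrite E !i_comp; lra.
Qed.

(** The norms |T_m x| increase and are bounded by |x|, so [newton_dist] applied from T_k
on makes the iterates a Cauchy sequence. *)
Lemma newton_cauchy A B (T : intw A B) x : contraction T ->
  exists l, hlim \oo (fun m => iter m (@newton A B) T x) l.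
Proof.
move=> hT; pose a m := nrm (iter m (@newton A B) T x) ^+ 2.
have dist k m : (k <= m)%N ->
    nrm (iter m (@newton A B) T x - iter k (@newton A B) T x) ^+ 2 <= a m - a k.
  move=> km; rewrite /a -(subnK km) iterD; apply: newton_dist.
  exact: newton_iter_contraction.
apply: hlim_cauchy => e e0.
have hs : has_sup (range a).
  split; first by exists (a 0%N); exists 0%N.
  exists (nrm x ^+ 2) => _ [m _ <-].
  by rewrite /a ler_pXn2r ?nnegrE ?nrm_ge0//; exact: newton_iter_contraction.
have [_ [k _ <-] sk] := sup_adherent (exprn_gt0 2 e0) hs.
exists k; exists k => // m /= km.
rewrite -(@ltr_pXn2r _ 2)// ?nnegrE ?nrm_ge0// ?ltW// nrmB.
apply: le_lt_trans (dist _ _ km) _.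
have : a m <= sup (range a) by apply: sup_upper_bound => //; exists m.
by move: sk; rewrite /a; lra.
Qed.

Lemma newton_iter_adj A B (T : intw A B) m :
  (iter m (@newton A B) T)^† = iter m (@newton B A) T^†.
Proof. by elim: m => //= m <-; rewrite newton_adj. Qed.

Lemma newton_iter_compl A B (T : intw A B) (d : intw B B) m : d ∘ T = T ->
  d ∘ iter m (@newton A B) T = iter m (@newton A B) T.
Proof.
move=> h; elim: m => //= m IH; apply: intw_ext => x.
by rewrite i_comp newtonE intw_linear -!(i_comp d) IH.
Qed.

(** The Newton iterates of [T] and those of [T^†] converge strongly to a pair of adjoint
intertwiners. The limit [W] is a partial isometry because T_k (1 - T_k^† T_k) is
twice the step T_(k+1) - T_k, hence tends to 0, and [W] is nonzero because the
norms |T_k x| increase. *)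
Lemma polar_contraction A B (T : intw A B) : contraction T -> T <> 0 ->
  exists W : intw A B, [/\ pisom W, W <> 0,
    forall d : intw B B, d ∘ T = T -> d ∘ W = W &
    forall b : intw A A, b ∘ T^† = T^† -> b ∘ W^† = W^†].
Proof.
move=> hT T0; pose S m := iter m (@newton A B) T.
have hS m : contraction (S m) by exact: newton_iter_contraction.
have hS' m := contraction_adj (hS m).
have [|x|y|W [WP WP']] := @strong_limit R nat \oo _ N A B S 1.
- by move=> m x; rewrite mul1r; exact: hS.
- exact: newton_cauchy.
- have [l lP] := newton_cauchy y (contraction_adj hT); exists l => e e0.
  by apply: filterS (lP e e0) => m /=; rewrite -newton_iter_adj.
have lim2 C D (U : nat -> intw C D) (V : intw C D) u l : (forall m, contraction (U m)) ->
    (forall x, hlim \oo (fun m => U m x) (V x)) -> hlim \oo u l ->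
    hlim \oo (fun m => U m (u m)) (V l).
  move=> hU UV ul e e0; have e2 : 0 < e / 2 by lra.
  apply: filterS (filterI (ul _ e2) (UV l _ e2)) => m /= [h1 h2].
  apply: le_lt_trans (ler_nrmB _ (U m l) _) _.
  by rewrite -intwB; have := hU m (l - u m); lra.
exists W; split.
- rewrite /pisom; apply: intw_ext => x; rewrite !i_comp.
  have WWW := lim2 _ _ _ _ _ _ hS WP (lim2 _ _ _ _ _ _ hS' WP' (WP x)).
  apply/eqP; rewrite -subr_eq0; apply/eqP/nrm_le0.
  (* W W^† W x is within e of S_m S_m^† S_m x, which differs from S_m x by twice the step,
     at most 4 e, and S_m x is within e of W x *)
  apply: (@ltr_eps0 R _ 6) => // e e0.
  have [k _ hk] := WP x e e0.
  have [m [/= h1 /= km]] := filter_ex (filterI (WWW e e0) (nbhs_infty_ge k)).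
  have h2 := hk m km; have h3 := hk m.+1 (leqW km).
  have E : S m (x - (S m)^† (S m x)) = 2%:C *: (S m.+1 x - S m x).
    rewrite /S iterS newtonE -/(S m) addrK scalerA -rmorphM/= mulfV// scale1r.
    by rewrite defectE.
  have E2 : nrm (S m (x - (S m)^† (S m x))) = 2 * nrm (S m.+1 x - S m x).
    by apply: complexI; rewrite E nrmZ rmorphM normc_def/= expr0n addr0 sqrtr_sqr ger0_norm.
  have := ler_nrmB (S m x) (W x) (S m.+1 x); have := E2.
  rewrite intwB (nrmB (S m x) (W x)) => E3 h4.
  have := ler_nrmB (W (W^† (W x))) (S m ((S m)^† (S m x))) (W x).
  have := ler_nrmB (S m ((S m)^† (S m x))) (S m x) (W x).
  rewrite (nrmB (S m ((S m)^† (S m x))) (S m x)) E3 (nrmB (S m x) (W x)).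
  by rewrite (nrmB (S m.+1 x)); move: h1 h2 h3 h4 => /=; lra.
- move=> W0; apply: T0; apply: intw_ext => x; apply: nrm_le0.
  rewrite leNgt; apply/negP => Tx.
  have [m /= h] := filter_ex (WP x _ Tx).
  have := newton_dist m x hT; have := sqr_ge0 (nrm (S m x - T x)).
  move: h; rewrite W0 i_zero sub0r nrmN => h.
  have : nrm (S m x) ^+ 2 < nrm (T x) ^+ 2 by rewrite ltr_pXn2r ?nnegrE ?nrm_ge0.
  by rewrite -/(S m); lra.
- move=> d dT; apply: intw_ext => x; rewrite i_comp.
  apply: (@hlim_unique _ _ \oo _ _ (fun m => S m x)) => //.
  apply: hlim_near (hlim_fn d (WP x)); apply: filterE => m.
  exact: (i_at x (newton_iter_compl m dT)).
- move=> b bT; apply: intw_ext => y; rewrite i_comp.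
  apply: (@hlim_unique _ _ \oo _ _ (fun m => (S m)^† y)) => //.
  apply: hlim_near (hlim_fn b (WP' y)); apply: filterE => m.
  by have := i_at y (newton_iter_compl m bT); rewrite -newton_iter_adj.
Qed.

(** Existence of a nonzero partial isometry under a nonzero intertwiner, whose initial and
final spaces lie in every reducing subspace that carries [T]. This is the only
analytic input to the comparison theory. *)
Lemma polar A B (T : intw A B) : T <> 0 ->
  exists W : intw A B, [/\ pisom W, W <> 0,
    forall d : intw B B, d ∘ T = T -> d ∘ W = W &
    forall b : intw A A, T ∘ b^† = T -> W ∘ b^† = W].
Proof.
move=> T0; have [M M0 hM] := intw_bd T.
have M1 : 0 < M + 1 by lra.
pose c := (M + 1)^-1; have c0 : 0 < c by rewrite invr_gt0.
pose S := ilin c T 0; have SE x : S x = c%:C *: T x by rewrite /S /= addr0.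
have hS : contraction S.
  move=> x; apply: nrm_sqr_le; rewrite ?nrm_ge0// SE nrmZr_sqr -exprMn.
  rewrite ler_pXn2r// ?nnegrE ?mulr_ge0 ?nrm_ge0 ?(ltW c0)//.
  rewrite /c mulrC ler_pdivrMr//; have := hM x; have := nrm_ge0 x; lra.
have S0 : S <> 0.
  move=> S0; apply: T0; apply: intw_ext => x; apply/eqP.
  have := i_at x S0; rewrite SE i_zero => /eqP; rewrite scaler_eq0.
  case/orP=> // /eqP/(congr1 (@complex.Re R))/= c1.
  by rewrite c1 ltxx in c0.
have [W [h1 h2 h3 h4]] := polar_contraction hS S0.
exists W; split=> // [d dT|b Tb].
  by apply: h3; apply: intw_ext => x; rewrite i_comp !SE intwZ -i_comp dT.
apply: adj_inj; rewrite adjM adjK; apply: h4; apply: adj_inj; rewrite !adjE.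
by apply: intw_ext => x; rewrite i_comp !SE -i_comp Tb.
Qed.

End NewtonIteration.

(** * Maximal orthogonal families *)

Section Families.
Variables (R : realType) (N : nat).
Implicit Types A B C : CDD R N.

Section Sum.
Variables (I : choiceType) (A B : CDD R N) (T : I -> intw A B) (W : intw A B).
Hypothesis Tp : forall i, pisom (T i).
Hypothesis TW : is_orth_sum T W.

Lemma osum_adjl k : W^† ∘ T k = (T k)^† ∘ T k.
Proof. by case: TW => _ _ h _ _; apply: adj_inj; rewrite !adjE. Qed.

Lemma osum_adjr k : T k ∘ W^† = T k ∘ (T k)^†.
Proof. by case: TW => _ h _ _ _; apply: adj_inj; rewrite !adjE. Qed.

Lemma osum_gram k : W ∘ (T k)^† ∘ T k = T k.
Proof. by case: TW => _ h _ _ _; rewrite h Tp. Qed.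

Lemma osum_cogram k : T k ∘ W^† ∘ W = T k.
Proof.
case: TW => _ _ h _ _; rewrite osum_adjr -compA h compA; exact: Tp.
Qed.

Lemma osum_comp0 C (S : intw C A) : (forall i, T i ∘ S = 0) -> W ∘ S = 0.
Proof.
move=> h; case: TW => _ _ _ h1 _; apply: intw_ext => x; rewrite iE i_zero.
by apply: h1 => i; exact: (i_at x (h i)).
Qed.

Lemma osum_0comp C (S : intw B C) : (forall i, S ∘ T i = 0) -> S ∘ W = 0.
Proof.
move=> h; case: TW => _ _ _ _ h1; apply: adj_inj; rewrite adjM adj0.
apply: intw_ext => x; rewrite iE i_zero; apply: h1 => i.
by apply: (@i_at _ _ _ _ ((T i)^† ∘ S^†) 0 x); apply: adj_inj; rewrite !adjE h.
Qed.

(** The initial projection of a sum is recognized from the outside: it is the projection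
that every T_i absorbs and that vanishes where all T_i do. *)
Lemma osum_gramE (r : intw A A) : is_proj r -> (forall i, T i ∘ r = T i) ->
  (forall x, (forall i, T i x = 0) -> r x = 0) -> W^† ∘ W = r.
Proof.
move=> rp h1 h2; have [Wp _ _ _ _] := TW; have [p1 p2] := pisom_proj Wp.
have [r1 r2] := rp.
have e1 : W ∘ (ione - r) = 0.
  by apply: osum_comp0 => i; rewrite compBr compi1 h1 subrr.
have e2 : r ∘ (ione - W^† ∘ W) = 0.
  apply: intw_ext => x; rewrite i_comp i_zero; apply: h2 => i.
  apply: (@i_at _ _ _ _ (T i ∘ (ione - W^† ∘ W)) 0 x).
  by rewrite compBr compi1 compA osum_cogram subrr.
have e3 : W^† ∘ W ∘ r = W^† ∘ W.
  rewrite -compA; congr (_ ∘ _); apply/esym/eqP; rewrite -subr_eq0.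
  by rewrite -{1}[W]compi1 -compBr e1.
have e4 : r = r ∘ (W^† ∘ W).
  by apply/eqP; rewrite -subr_eq0 -{1}[r]compi1 -compBr e2.
by rewrite -e3; apply: adj_inj; rewrite adjM p1 r1.
Qed.

Lemma osum_isom : (forall x, (forall i, T i x = 0) -> x = 0) -> isom W.
Proof.
by move=> h; apply: osum_gramE => // [|i]; [exact: proj1|rewrite compi1].
Qed.

End Sum.

(** Zorn's lemma for families whose members are pairwise related by [r]; the family is
indexed by its own set of values. *)
Lemma maximal_family (T : choiceType) (r : T -> T -> Prop) (P : T -> Prop) :
  exists (I : choiceType) (f : I -> T), [/\ forall i, P (f i),
    forall i k, i <> k -> r (f i) (f k) &
    forall t, P t -> (forall i, r (f i) t /\ r t (f i)) -> exists i, f i = t].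
Proof.
pose good (S : set T) := (forall t, S t -> P t) /\
  (forall s t, S s -> S t -> s <> t -> r s t).
have [|S [[SP Sr] Smax]] := @Zorn_bigcup T good.
  move=> F Fgood Ftot; split=> [t [X FX Xt]|s t [X FX Xs] [Y FY Yt] st].
    exact: (Fgood X FX).1.
  have [XY|YX] := Ftot X Y FX FY; first by apply: (Fgood Y FY).2 => //; exact: XY.
  by apply: (Fgood X FX).2 => //; exact: YX.
exists (set_type S), (fun i => val i); split.
- by move=> i; apply: SP; exact: set_valP.
- by move=> i k ik; apply: Sr; try exact: set_valP; move=> E; apply: ik; exact: val_inj.
move=> t Pt rt; have [St|nSt] := pselect (S t).
  by exists (SigSub (mem_set St)).
exfalso; apply: (Smax (S `|` [set t])).
  by split=> [s Ss|/(_ t)]; [left|move=> h; apply: nSt; apply: h; right].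
have rS s : S s -> r s t /\ r t s by move=> Ss; exact: rt (SigSub (mem_set Ss)).
split=> [s [/SP //|->//]|s u [Ss|->] [Su|->] //]; first exact: Sr.
  by move=> _; exact: (rS _ Ss).1.
by move=> _; exact: (rS _ Su).2.
Qed.

(** A maximal orthogonal family is summed to [W]; maximality then becomes a statement
about [W] alone, since being orthogonal to [W] is being orthogonal to every T_i. *)
Lemma maximal_pisoms A B (P : intw A B -> Prop) : (forall W, P W -> pisom W) ->
  exists (I : choiceType) (T : I -> intw A B) (W : intw A B),
  [/\ forall i, P (T i), pairwise_orth T, is_orth_sum T W &
      forall V, P V -> V ∘ W^† = 0 -> V^† ∘ W = 0 -> V = 0].
Proof.
move=> Pp; have [I [T [TP To Tmax]]] := maximal_family
  (fun V W : intw A B => V ∘ W^† = 0 /\ V^† ∘ W = 0) P.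
have Tp i : pisom (T i) by exact: Pp.
have [W TW] := orth_sum Tp To.
exists I, T, W; split=> // V PV h1 h2.
have e1 i : V ∘ (T i)^† = 0.
  have -> : (T i)^† = W^† ∘ T i ∘ (T i)^†.
    by rewrite (osum_adjl TW); rewrite -compA; rewrite -{1}[T i]Tp !adjE.
  by rewrite !compA h1 !comp0i.
have e2 i : V^† ∘ T i = 0.
  by rewrite -(osum_gram Tp TW) !compA h2 !comp0i.
have [|i E] := Tmax V PV.
  by move=> i; split; split=> //; apply: adj_inj; rewrite !adjE.
by rewrite -(Pp V PV) -{2}E e1 comp0i.
Qed.

(** The case of projections: [p] is the supremum of the family, so no nonzero projection
with the property is orthogonal to [p]. *)
Lemma maximal_projs A (P : intw A A -> Prop) : (forall q, P q -> is_proj q) ->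
  exists (I : choiceType) (q : I -> intw A A) (p : intw A A),
  [/\ forall i, P (q i), forall i k, i <> k -> q i ∘ q k = 0,
      is_proj p /\ forall i, p ∘ q i = q i,
      forall x, (forall i, q i x = 0) -> p x = 0 &
      forall r, P r -> r ∘ p = 0 -> r = 0].
Proof.
move=> Pp; have [|I [q [W [qP qo qW qmax]]]] := maximal_pisoms (P := P).
  by move=> r /Pp; exact: proj_pisom.
have qp i : is_proj (q i) by exact: Pp.
have qpi i : pisom (q i) by exact: proj_pisom.
have [Wp _ _ h4 _] := qW.
have pq i : W^† ∘ W ∘ q i = q i.
  have [q1 q2] := qp i; have := osum_gram qpi qW i.
  rewrite q1 -compA q2 -(compA W^†) => ->.
  by rewrite (osum_adjl qW) q1 q2.
exists I, q, (W^† ∘ W); split=> //.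
- by move=> i k ik; have [q1 _] := qp k; rewrite -[q k]q1; exact: (qo i k ik).1.
- by split=> //; exact: pisom_proj.
- by move=> x hx; rewrite i_comp h4// intw0.
move=> r Pr rp; have [r1 r2] := Pp r Pr.
have rq i : r ∘ q i = 0 by rewrite -(pq i) compA rp comp0i.
apply: qmax => //.
  apply: adj_inj; rewrite adjM adjK adj0 r1.
  apply: adj_inj; rewrite adj0 adjM r1.
  apply: adj_inj; rewrite adj0 adjM adjK r1.
  have := osum_comp0 qW (S := r); apply.
  by move=> i; have [q1 _] := qp i; apply: adj_inj; rewrite !adjE r1 q1.
by rewrite r1; exact: (osum_0comp qW).
Qed.

End Families.

(** * Reducing subspaces as projections *)

Section Subobjects.
Variables (R : realType) (N : nat).
Implicit Types A B C X Y : CDD R N.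

Section Inclusion.
Variables (A : CDD R N) (E : closed_subspace (hspace A)) (Er : reduces E).
Local Notation X := (restriction Er).

Lemma proj_in x : E (orthproj E x). Proof. exact: (orthprojP E x).1. Qed.

Definition incl_fn (x : hspace X) : hspace A := subspace_val (x : subspace_type E).
Definition incl_ad (y : hspace A) : hspace X := (Subspace (proj_in y) : subspace_type E).

Lemma incl_fn_ad x y : '[incl_fn x, y] = '[x, incl_ad y].
Proof.
have [Ep o] := orthprojP E y.
have -> : '[x, incl_ad y] = '[incl_fn x, orthproj E y] by [].
apply/eqP; rewrite -subr_eq0 -hdotBr hdotC o ?rmorph0//.
exact: (subspace_valP (x : subspace_type E)).
Qed.

Lemma incl_bd : exists M, forall x, nrm (incl_fn x) <= M * nrm x.
Proof. by exists 1 => x; rewrite mul1r. Qed.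

Lemma incl_fn_dom j x : op_dom (X j) x ->
  op_dom (A j) (incl_fn x) /\ A j (incl_fn x) = incl_fn (X j x).
Proof.
move=> Dx; split; first exact: Dx.
rewrite /incl_fn /= to_subspaceK//.
by apply: (reduces_E Er); [exact: Dx|exact: (subspace_valP (x : subspace_type E))].
Qed.

Lemma incl_ad_dom j y : op_dom (A j) y ->
  op_dom (X j) (incl_ad y) /\ X j (incl_ad y) = incl_ad (A j y).
Proof.
move=> Dy; have [[_ /= h1] /= h2] := Er (conj Dy I : op_dom (op_comp (op_of (orthproj E)) (A j)) y).
split; first exact: h1.
apply: (@subspace_inj R (hspace A) E); rewrite [LHS]to_subspaceK; first exact: h2.
by apply: (reduces_E Er); [exact: h1|exact: proj_in].
Qed.

Definition incl : intw X A :=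
  @Intw R N X A incl_fn incl_ad incl_fn_ad incl_bd incl_fn_dom incl_ad_dom.

Lemma incl_isom : isom incl.
Proof.
apply: intw_ext => x; apply: (@subspace_inj R (hspace A) E).
exact: (proj_id (subspace_valP (x : subspace_type E))).
Qed.

Lemma incl_proj y : (incl ∘ incl^†) y = orthproj E y.
Proof. by []. Qed.

End Inclusion.

(** A projection in the commutant has a closed range, and it intertwines [A] with itself,
which is exactly the condition that this range reduces [A]. *)
Lemma range_subspace A (p : intw A A) : is_proj p ->
  exists (E : closed_subspace (hspace A)) (Er : reduces E),
    (forall x, E x <-> p x = x) /\ forall x, orthproj E x = p x.
Proof.
move=> [p1 p2].
have c0 : p 0 = 0 by rewrite intw0.
have c1 (a : R[i]) x y : p x = x -> p y = y -> p (a *: x + y) = a *: x + y.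
  by move=> h1 h2; rewrite intw_linear h1 h2.
have c2 : closed [set x | p x = x].
  apply/hclosedP => x h; apply/eqP; rewrite -subr_eq0; apply/eqP/nrm_le0.
  apply: (@ltr_eps0 R _ 2) => // e e0; have [y /= py xy] := h e e0.
  have := ler_nrmB (p x) y x; rewrite -{1}py -intwB.
  have := proj_nrm (x - y) (conj p1 p2); rewrite (nrmB y); lra.
pose E := @ClosedSubspace R (hspace A) (fun x => p x = x) c0 c1 c2.
have Ep x : orthproj E x = p x.
  have [/= h1 h2] := orthprojP E x.
  apply/esym/eqP; rewrite -subr_eq0; apply/eqP/nrm_le0.
  have ppx : p (p x) = p x by exact: (i_at x p2).
  have hp : p (p x - orthproj E x) = p x - orthproj E x by rewrite intwB ppx h1.
  have o1 : rdot (x - orthproj E x) (p x - orthproj E x) = 0.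
    by rewrite /rdot h2.
  have o2 : rdot (x - p x) (p x - orthproj E x) = 0.
    by rewrite -hp rdotC rdot_adj p1 intwB ppx subrr rdotC rdot0l.
  have : rdot (p x - orthproj E x) (p x - orthproj E x) = 0.
    rewrite [LHS]rdotBl; move: o1 o2; move: (p x - orthproj E x) => w.
    by rewrite !rdotBl; lra.
  by rewrite rdotxx => /eqP; rewrite expf_eq0/= => /eqP ->.
have Er : reduces E.
  move=> j x /= [Dx _]; have [h1 h2] := fn_dom p Dx.
  by rewrite /= !Ep; split.
by exists E, Er; split.
Qed.

Lemma split_proj A (p : intw A A) : is_proj p ->
  exists X (V : intw X A), isom V /\ V ∘ V^† = p.
Proof.
move=> /range_subspace[E [Er [_ Ep]]]; exists (restriction Er), (incl Er).
split; first exact: incl_isom.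
by apply: intw_ext => x; rewrite incl_proj Ep.
Qed.

Lemma uequivP A B : uequiv A B <-> exists V : intw A B, isom V /\ isom V^†.
Proof.
split=> [[U UP]|[V [V1 V2]]].
  have dot x y : '[U x, y] = '[x, unitary_inv U y].
    by rewrite -{1}[y](unitary_invK U) unitary_dot.
  have bd : exists M, forall x, nrm (U x) <= M * nrm x.
    exists 1 => x; rewrite mul1r; apply: nrm_sqr_le; rewrite ?nrm_ge0//.
    by rewrite -!rdotxx /rdot unitary_dot.
  have d1 j x : op_dom (A j) x -> op_dom (B j) (U x) /\ B j (U x) = U (A j x).
    move=> Dx; have [[/= [_ h1] _] h2] := (UP j).1 x Dx.
    by split=> //; rewrite -h2/= unitary_invK.
  have d2 j y : op_dom (B j) y -> op_dom (A j) (unitary_inv U y) /\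
      A j (unitary_inv U y) = unitary_inv U (B j y).
    move=> Dy; have [|h1 h2] := (UP j).2 (unitary_inv U y).
      by rewrite /=; do !split; rewrite unitary_invK.
    by split=> //; rewrite h2/= unitary_invK.
  exists (@Intw R N A B U (unitary_inv U) dot bd d1 d2).
  by split; apply: intw_ext => x; [exact: unitaryK|exact: unitary_invK].
have V1' := isomK V1; have V2' := isomK V2; rewrite adjK in V2'.
have Vlin : linear (fn V) by move=> a x y; exact: intw_linear.
pose L : {linear hspace A -> hspace B} :=
  HB.pack (fn V) (GRing.isLinear.Build _ _ _ _ (fn V) Vlin).
have dot x y : '[L x, L y] = '[x, y].
  by rewrite [LHS](fn_ad V); congr '[_, _]; exact: V1'.
exists (@Unitary R (hspace A) (hspace B) L (fn V^†) V1' V2' dot) => j; split.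
  move=> x Dx; have [h1 h2] := fn_dom V Dx; split; first by [].
  by rewrite /= h2; exact: V1'.
move=> x [[_ /= Dx] _]; have [h1 h2] := fn_dom V^† Dx.
by rewrite V1' in h1 h2; split.
Qed.

(** The order relation is isometric embedding: conversely, the range of an isometric
intertwiner [V] is the range of the projection V V^†. *)
Lemma usubP X A : usub X A <-> exists V : intw X A, isom V.
Proof.
split=> [[E [Er /uequivP[V [V1 _]]]]|[V V1]].
  exists (incl Er ∘ V); rewrite /isom adjM -compA (compA _ _ V).
  by rewrite (incl_isom Er) comp1i.
have Vp : is_proj (V ∘ V^†).
  by rewrite -{1}[V]adjK; apply: pisom_proj; apply: pisom_adj; exact: isom_pisom.
have [E [Er [EP Ep]]] := range_subspace Vp; exists E, Er; apply/uequivP.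
have ip : incl Er ∘ (incl Er)^† = V ∘ V^†.
  by apply: intw_ext => x; rewrite incl_proj Ep.
exists ((incl Er)^† ∘ V); split.
  by rewrite /isom adjM adjK -compA (compA (incl Er)) ip !compA V1 comp1i V1.
rewrite /isom adjK adjM adjK -compA (compA V) -ip -compA.
by rewrite (incl_isom Er) compi1; exact: incl_isom.
Qed.

End Subobjects.

(** * Direct sums, disjointness and absorption *)

Section DirectSums.
Variables (R : realType) (N : nat) (I : choiceType) (F : I -> CDD R N).
Local Notation H := (fun i => hspace (F i)).

Definition single i (y : hspace (F i)) : forall k, hspace (F k) :=
  @dfwith I (fun k => hspace (F k) : Type) (fun k => 0 : hspace (F k)) i y.

Lemma single_in i y : @single i y i = y. Proof. exact: dfwithin. Qed.

Lemma single_out i y k : i <> k -> @single i y k = 0.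
Proof. by move=> /eqP ik; rewrite /single dfwithout. Qed.

Lemma psum_single (f : I -> R) i (A : {fset I}) : (forall k, i <> k -> f k = 0) ->
  (i \in A) -> psum f A = f i.
Proof.
move=> f0 iA; rewrite /psum (big_rem i)//= big_seq big1 ?addr0// => k.
by rewrite (rem_filter _ (fset_uniq A)) mem_filter => /andP[/eqP ki _]; apply/f0/nesym.
Qed.

Lemma usum_single (f : I -> R) i : (forall k, i <> k -> f k = 0) -> usum f = f i.
Proof.
move=> f0; apply: cvg_lim => //; apply: (@cvg_trans _ (f i @[_ --> summability.totally])).
  apply: near_eq_cvg; exists [fset i]%fset => // A /= /fsubsetP/(_ i); rewrite inE eqxx => /(_ isT) iA.
  by rewrite (psum_single f0 iA).
exact: cvg_cst.
Qed.

Lemma single_sqsum i y : sqsum (@single i y).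
Proof.
exists (nrm y ^+ 2) => A; pose f k := nrm (@single i y k) ^+ 2.
have f0 k : i <> k -> f k = 0 by move=> ik; rewrite /f single_out// nrm0 expr0n.
have fi : f i = nrm y ^+ 2 by rewrite /f single_in.
rewrite -fi -(psum_single (A := (i |` A)%fset) f0) ?fset1U1//.
by apply: psum_sub => [k|]; [exact: sqr_ge0|exact: fsubsetU1].
Qed.

Definition dinj_fn i (y : hspace (F i)) : hspace (dsum F) := (L2 (single_sqsum y) : l2 H).
Definition dpr_fn i (x : hspace (dsum F)) : hspace (F i) := l2_val (x : l2 H) i.

Lemma dpr_fn_ad i x y : '[@dpr_fn i x, y] = '[x, dinj_fn y].
Proof.
have -> : '[x, dinj_fn y] =
  usum (fun k => complex.Re '[@dpr_fn k x, @single i y k]) +i*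
  usum (fun k => complex.Im '[@dpr_fn k x, @single i y k]) by [].
rewrite !(@usum_single _ i).
- by rewrite single_in; case: '[_, _].
- by move=> k ik; rewrite single_out// linear0r.
- by move=> k ik; rewrite single_out// linear0r.
Qed.

Lemma dpr_bd i : exists M, forall x, nrm (@dpr_fn i x) <= M * nrm x.
Proof. by exists 1 => x; rewrite mul1r; exact: (nrm_le_l2n (x : l2 H) i). Qed.

Lemma dpr_dom i j x : op_dom (dsum F j) x ->
  op_dom (F i j) (@dpr_fn i x) /\ F i j (@dpr_fn i x) = @dpr_fn i (dsum F j x).
Proof. by move=> [Dx sx]; split; [exact: Dx|rewrite /dpr_fn /= to_l2K]. Qed.

Lemma single_op i j y k : F k j (@single i y k) = @single i (F i j y) k.
Proof.
have [<-|/eqP ik] := eqVneq i k; first by rewrite !single_in.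
by rewrite !single_out//; case: (op0 (F k) j).
Qed.

Lemma dinj_dom i j y : op_dom (F i j) y ->
  op_dom (dsum F j) (dinj_fn y) /\ dsum F j (dinj_fn y) = dinj_fn (F i j y).
Proof.
move=> Dy; have E : (fun k => F k j (@single i y k)) = @single i (F i j y).
  by apply: functional_extensionality_dep => k; exact: single_op.
have sE : sqsum (fun k => F k j (@single i y k)) by rewrite E; exact: single_sqsum.
split.
  split=> [k|]; last exact: sE.
  have [<-|/eqP ik] := eqVneq i k; first by rewrite /= single_in.
  by rewrite /= single_out//; case: (op0 (F k) j).
by apply: l2_inj => k; rewrite to_l2K// single_op.
Qed.

Definition dpr i : intw (dsum F) (F i) :=
  @Intw R N (dsum F) (F i) (@dpr_fn i) (@dinj_fn i) (@dpr_fn_ad i) (dpr_bd i)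
    (@dpr_dom i) (@dinj_dom i).

Lemma dpr_isom i : isom (dpr i)^†.
Proof. by apply: intw_ext => y; exact: single_in. Qed.

Lemma dpr_orth i k : i <> k -> dpr i ∘ (dpr k)^† = 0.
Proof. by move=> ik; apply: intw_ext => y; apply: single_out; exact/nesym. Qed.

Lemma dpr_sep x : (forall i, dpr i x = 0) -> x = 0.
Proof. by move=> h; apply: l2_inj => i; exact: h. Qed.

End DirectSums.

Section Order.
Variables (R : realType) (N : nat).
Implicit Types A B C X Y Z : CDD R N.

Lemma isom_comp A B C (V : intw B C) (U : intw A B) : isom V -> isom U -> isom (V ∘ U).
Proof. by move=> hV hU; rewrite /isom adjM -compA (compA _ V) hV comp1i. Qed.

Lemma isom1 A : isom (ione : intw A A).
Proof. by rewrite /isom adj1 comp1i. Qed.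

Lemma usub_trans B A C : usub A B -> usub B C -> usub A C.
Proof.
move=> /usubP[U hU] /usubP[V hV]; apply/usubP; exists (V ∘ U); exact: isom_comp.
Qed.

(** Universal property of the Hilbert sum with respect to isometries with orthogonal
ranges; the embedding is the orthogonal sum of the operators V_i pr_i. *)
Lemma dsum_map (I : choiceType) (F : I -> CDD R N) B (V : forall i, intw (F i) B) :
  (forall i, isom (V i)) -> (forall i k, i <> k -> (V i)^† ∘ V k = 0) ->
  exists W : intw (dsum F) B, [/\ isom W, forall i, W ∘ (dpr F i)^† = V i &
    (forall y, (forall i, (V i)^† y = 0) -> y = 0) -> isom W^†].
Proof.
move=> hV Vo; pose T i := V i ∘ dpr F i.
have Tp i : pisom (T i).
  rewrite /pisom /T adjM !compA -(compA _ (V i)^†) hV compi1.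
  have := dpr_isom F i; rewrite /isom adjK -!compA => h.
  by rewrite (compA (dpr F i)) h comp1i.
have To : pairwise_orth T.
  move=> i k ik; rewrite /T !adjM; split.
    by rewrite -!compA (compA (dpr F i)) (dpr_orth F ik) !comp0i !compi0.
  by rewrite -!compA (compA (V i)^†) (Vo _ _ ik) !comp0i !compi0.
have [W TW] := orth_sum Tp To.
have VT i : V i = T i ∘ (dpr F i)^†.
  by have := dpr_isom F i; rewrite /isom adjK /T -compA => ->; rewrite compi1.
have Wi : isom W.
  apply: (osum_isom Tp TW) => x hx; apply: dpr_sep => i.
  by apply: (isom_inj (hV i)); exact: hx.
have WV i : W ∘ (dpr F i)^† = V i.
  have -> : (dpr F i)^† = (T i)^† ∘ V i.
    by rewrite /T adjM -compA hV compi1.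
  case: (TW) => _ h _ _ _; rewrite compA h /T adjM.
  have := dpr_isom F i; rewrite /isom adjK => h'.
  by rewrite -!compA (compA (dpr F i)) h' comp1i hV compi1.
exists W; split=> // h.
rewrite /isom adjK; apply/eqP; rewrite -subr_eq0 -oppr_eq0 opprB; apply/eqP.
apply: intw_ext => y; rewrite i_zero; apply: h => i.
apply: (@i_at _ _ _ _ ((V i)^† ∘ (ione - W ∘ W^†)) 0 y).
apply: adj_inj; rewrite !adjE compBl comp1i -compA.
by rewrite -{2}(WV i) (compA W^†) Wi comp1i WV subrr.
Qed.

Lemma trivialP A : is_trivial A <-> (ione : intw A A) = 0.
Proof.
split=> [h|h x]; first by apply: intw_ext => x; rewrite i_zero; exact: h.
exact: (i_at x h).
Qed.

Lemma isom_neq0 A B (V : intw A B) : ~ is_trivial A -> isom V -> V <> 0.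
Proof.
by move=> A0 hV V0; apply/A0/trivialP; rewrite -hV V0 compi0.
Qed.

Lemma split_nontrivial A X (V : intw X A) p : isom V -> V ∘ V^† = p -> p <> 0 ->
  ~ is_trivial X.
Proof.
move=> hV Vp p0 /trivialP X0; apply: p0.
by rewrite -Vp -[V]compi1 X0 compi0 comp0i.
Qed.

Lemma pisom_common_sub A B (W : intw A B) : pisom W -> W <> 0 ->
  exists X, [/\ ~ is_trivial X, usub X A & usub X B].
Proof.
move=> Wp W0; have [X [V [hV Vp]]] := split_proj (pisom_proj Wp).
exists X; split.
- by apply: (split_nontrivial hV Vp) => /adj_comp0.
- by apply/usubP; exists V.
- apply/usubP; exists (W ∘ V); rewrite /isom adjM -compA (compA W^†) -Vp.
  by rewrite -compA hV compi1.
Qed.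

(** Unitary disjointness is the vanishing of all intertwiners, because the polar part of a
nonzero one identifies a nonzero part of [A] with a part of [B]. In this form it is
a linear condition, stable under sums, limits and composition. *)
Lemma disjointP A B : udisjoint A B <-> forall T : intw A B, T = 0.
Proof.
split=> [dAB T|h [X [X0 /usubP[U hU] /usubP[V hV]]]].
  apply: contrapT => /polar[W [Wp W0 _ _]]; apply: dAB.
  exact: pisom_common_sub Wp W0.
apply: (isom_neq0 X0 hU); have := h (V ∘ U^†) => VU.
by apply: adj_inj; rewrite adj0 -[U^†]comp1i -hV -compA VU compi0.
Qed.

Lemma gram_orth A B C (V : intw A B) (W : intw A C) : pisom V -> pisom W ->
  (V^† ∘ V) ∘ (W^† ∘ W) = 0 -> V ∘ W^† = 0.
Proof.
move=> Vp Wp h; have hW : W^† ∘ W ∘ W^† = W^†.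
  by have := pisom_adj Wp; rewrite /pisom adjK.
have -> : V ∘ W^† = V ∘ ((V^† ∘ V) ∘ (W^† ∘ W)) ∘ W^†.
  by rewrite !compA Vp -!(compA V) hW.
by rewrite h compi0 comp0i.
Qed.

(** [A] is contained in a multiple of [C] as soon as the intertwiners to [C] separate the
points of [A]: take a maximal orthogonal family of projections of [A] equivalent to
parts of [C]. Under the supremum of this family there is one copy of [C] per
member, and a nonzero intertwiner on its complement would yield a further member. *)
Lemma ullP A C : ull A C <-> forall x, (forall T : intw A C, T x = 0) -> x = 0.
Proof.
split=> [[I /usubP[V hV]] x hx|sep].
  apply: (isom_inj hV); apply: dpr_sep => i.
  exact: (hx (dpr (fun=> C) i ∘ V)).
pose P (q : intw A A) := exists W : intw A C, pisom W /\ W^† ∘ W = q.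
have Pp q : P q -> is_proj q by move=> [W [Wp <-]]; exact: pisom_proj.
have [I [q [p [qP qo [pp pq] psep pmax]]]] := maximal_projs Pp.
(* the family exhausts A: otherwise some T is nonzero on the complement of p *)
have p1 : p = ione.
  apply/esym/eqP; rewrite -subr_eq0; apply/eqP; apply: contrapT => p0.
  have [T Tp0] : exists T : intw A C, T ∘ (ione - p) <> 0.
    apply: contrapT => nT; apply: p0; apply: intw_ext => x; rewrite i_zero; apply: sep => T.
    apply: (@i_at _ _ _ _ (T ∘ (ione - p)) 0 x).
    by apply: contrapT => hT; apply: nT; exists T.
  have [W [Wp W0 _ Wb]] := polar Tp0.
  have [c1 c2] := projC pp.
  have Wb1 : W ∘ (ione - p) = W.
    by rewrite -{1}c1; apply: Wb; rewrite c1 -compA c2.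
  apply: W0; apply: adj_comp0; apply: pmax; first by exists W.
  by rewrite -Wb1 -!compA compBl comp1i pp.2 subrr !compi0.
pose W i := projT1 (cid (qP i)).
have WP i : pisom (W i) /\ (W i)^† ∘ W i = q i by exact: projT2 (cid (qP i)).
pose T i := (dpr (fun=> C) i)^† ∘ W i : intw A (multiple I C).
have di i := dpr_isom (fun _ : I => C) i.
have Tp i : pisom (T i).
  rewrite /pisom /T adjM adjK !compA -(compA _ (dpr _ i)).
  by have := di i; rewrite /isom adjK => ->; rewrite compi1 -!compA (compA (W i)) (WP i).1.
have To : pairwise_orth T.
  move=> i k ik; rewrite /T !adjM !adjK; split.
    rewrite -!compA (compA (W i)) gram_orth ?comp0i ?compi0//.
    - exact: (WP i).1.
    - exact: (WP k).1.
    - by rewrite (WP i).2 (WP k).2 qo.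
  by rewrite -!compA (compA (dpr _ i)) (dpr_orth _ ik) comp0i compi0.
have [V TV] := orth_sum Tp To.
exists I; apply/usubP; exists V; apply: (osum_isom Tp TV) => x hx.
have <- : p x = x by rewrite p1.
apply: psep => i; rewrite -(WP i).2 i_comp.
by rewrite (isom_inj (di i) (hx i)) intw0.
Qed.

End Order.

(** * Comparison of projections, finite tuples *)

Section Comparison.
Variables (R : realType) (N : nat).
Implicit Types A B C X Y Z M : CDD R N.

Lemma projB A (p q : intw A A) : is_proj p -> is_proj q -> p ∘ q = q ->
  is_proj (p - q).
Proof.
move=> [p1 p2] [q1 q2] pq; have qp : q ∘ p = q by apply: adj_inj; rewrite adjM p1 q1.
split; first by rewrite adjB p1 q1.
by rewrite compBl !compBr p2 q2 pq qp subrr subr0.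
Qed.

Lemma projD A (p q : intw A A) : is_proj p -> is_proj q -> p ∘ q = 0 ->
  is_proj (p + q).
Proof.
move=> [p1 p2] [q1 q2] pq.
have qp : q ∘ p = 0 by apply: adj_inj; rewrite adjM p1 q1 adj0.
split; first by rewrite adjD p1 q1.
by rewrite compDl !compDr p2 q2 pq qp addr0 add0r.
Qed.

Lemma gram_pisom A B (S : intw A B) : is_proj (S^† ∘ S) -> pisom S.
Proof.
move=> [e1 e2]; apply/esym/eqP; rewrite -subr_eq0; apply/eqP.
have h : S^† ∘ (S ∘ S^† ∘ S) = S^† ∘ S by rewrite !compA -(compA (S^† ∘ S)) e2.
have h' : (S ∘ S^† ∘ S)^† ∘ S = S^† ∘ S by apply: adj_inj; rewrite adjM adjK h e1.
have h2 : (S ∘ S^† ∘ S)^† ∘ (S ∘ S^† ∘ S) = S^† ∘ S.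
  by rewrite -[X in _ ∘ X](compA S) compA h' e2.
by apply: adj_comp0; rewrite adjB compBl !compBr h h' h2 !subrr.
Qed.

Lemma pisom_coproj A B (W : intw A B) : pisom W -> is_proj (W ∘ W^†).
Proof. by move=> h; rewrite -{1}[W]adjK; apply: pisom_proj; exact: pisom_adj. Qed.

Lemma isom_coproj A B (V : intw A B) : isom V -> is_proj (V ∘ V^†).
Proof. by move=> h; apply: pisom_coproj; exact: isom_pisom. Qed.

(** The central cover of [g], the supremum of a maximal orthogonal family of projections
equivalent to parts of [g]. The vectors it kills are those whose orbit under the
commutant is killed by [g]; this set is invariant, so [z] is central. *)
Lemma central_cover A (g : intw A A) : is_proj g ->
  exists z : intw A A, [/\ is_proj z, forall G, z ∘ G = G ∘ z, z ∘ g = g &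
    forall x, (forall T : intw A A, g (T x) = 0) -> z x = 0].
Proof.
move=> [g1 g2].
pose P (q : intw A A) := exists U : intw A A, [/\ pisom U, U ∘ g = U & U ∘ U^† = q].
have Pp q : P q -> is_proj q by move=> [U [Up _ <-]]; exact: pisom_coproj.
have [I [q [z [qP qo [zp zq] zsep zmax]]]] := maximal_projs Pp.
have [z1 z2] := zp; have [c1 c2] := projC zp.
have key T : (ione - z) ∘ T ∘ g = 0.
  apply: contrapT => /polar[W [Wp W0 Wd Wb]].
  have Wz : (ione - z) ∘ W = W by apply: Wd; rewrite !compA c2.
  have Wg : W ∘ g = W by rewrite -{1}g1; apply: Wb; rewrite g1 -!compA g2.
  apply: W0; apply: adj_inj; rewrite adj0; apply: adj_comp0; rewrite adjK.
  apply: zmax.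
    by exists W.
  have zW : z ∘ W = 0 by rewrite -Wz compA compBr compi1 z2 subrr comp0i.
  have : W^† ∘ z = 0 by apply: adj_inj; rewrite !adjE z1.
  by rewrite -compA => ->; rewrite compi0.
have zsep' x : (forall T : intw A A, g (T x) = 0) -> z x = 0.
  move=> h; apply: zsep => i; have [U [_ Ug <-]] := qP i.
  have -> : U^† = g ∘ U^† by apply: adj_inj; rewrite !adjE g1.
  by rewrite !i_comp h intw0.
have half G : (ione - z) ∘ G ∘ z = 0.
  apply: adj_inj; rewrite adj0 adjM; apply: intw_ext => x; rewrite i_comp i_zero z1.
  apply: zsep' => T; apply: (@i_at _ _ _ _ (g ∘ T ∘ ((ione - z) ∘ G)^†) 0 x).
  apply: adj_inj; rewrite (adjM (g ∘ T)) adjK (adjM g) g1 adj0.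
  by rewrite compA -(compA (ione - z)) key.
have e G : G ∘ z = z ∘ G ∘ z.
  by have := half G; rewrite compBl comp1i compBl => /eqP; rewrite subr_eq0 => /eqP.
exists z; split=> //.
  move=> G; rewrite e; apply: adj_inj; rewrite !adjM z1 [LHS]e.
  by rewrite compA.
have := key ione; rewrite compi1 compBl comp1i => /eqP.
by rewrite subr_eq0 => /eqP.
Qed.

(** A maximal partial isometry from [g] to [B]: what it leaves over in [g] and in [B] is
unitarily disjoint, because the polar part of an intertwiner between the two
remainders could be added to it. *)
Lemma maximal_match A B (g : intw A A) : is_proj g ->
  exists W : intw A B, [/\ pisom W, W ∘ g = W &
    forall T, (ione - W ∘ W^†) ∘ T ∘ (g - W^† ∘ W) = 0].
Proof.
move=> gp; have [g1 g2] := gp.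
pose P (V : intw A B) := pisom V /\ V ∘ g = V.
have [|I [T [W [TP To TW Wmax]]]] := maximal_pisoms (P := P); first by move=> V [].
have Wp : pisom W by case: TW.
have Wg : W ∘ g = W.
  apply/esym/eqP; rewrite -subr_eq0 -{1}[W]compi1 -compBr; apply/eqP.
  by apply: (osum_comp0 TW) => i; rewrite compBr compi1 (TP i).2 subrr.
have gW : g ∘ W^† = W^† by apply: adj_inj; rewrite !adjE g1.
have bp : is_proj (g - W^† ∘ W).
  by apply: projB => //; [exact: pisom_proj|rewrite compA gW].
have [d1 d2] := projC (pisom_coproj Wp); have [b1 b2] := bp.
exists W; split=> // S; apply: contrapT => /polar[V [Vp V0 Vd Vb]].
have dV : (ione - W ∘ W^†) ∘ V = V by apply: Vd; rewrite !compA d2.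
have bV : V ∘ (g - W^† ∘ W) = V by rewrite -{1}b1; apply: Vb; rewrite b1 -!compA b2.
apply: V0; apply: Wmax.
- split=> //; rewrite -{1}bV -compA compBl g2 -(compA _ _ g) Wg; exact: bV.
- rewrite -bV -compA compBl gW; have := pisom_adj Wp; rewrite /pisom adjK => ->.
  by rewrite subrr compi0.
apply: adj_inj; rewrite adjM adjK adj0 -dV compA compBr compi1 compA.
have := pisom_adj Wp; rewrite /pisom adjK => ->.
by rewrite subrr comp0i.
Qed.

(** Finiteness of the identity in the commutant of [A], in the sense of Murray and von Neumann. *)
Definition finite_obj A := forall V : intw A A, isom V -> V ∘ V^† = ione.

(** Infinitely many orthogonal equivalent projections S_n S_n^† can be shifted by one; the
shift, extended by the identity, is an isometry that misses S_0. *)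
Lemma finite_orth_copies A (S : nat -> intw A A) (e : intw A A) : finite_obj A ->
  is_proj e -> (forall n, (S n)^† ∘ S n = e) ->
  (forall n m, n <> m -> (S n)^† ∘ S m = 0) -> e = 0.
Proof.
move=> Afin ep Se So; have [e1 e2] := ep.
have Sp n : pisom (S n) by apply: gram_pisom; rewrite Se.
have SeS n : S n ∘ e = S n by rewrite -(Se n) compA Sp.
pose T n := S n.+1 ∘ (S n)^†.
have Tp n : pisom (T n).
  rewrite /pisom /T adjM adjK !compA -(compA _ _ (S n)) Se -(compA _ e).
  have -> : e ∘ (S n.+1)^† = (S n.+1)^† by apply: adj_inj; rewrite !adjE e1 SeS.
  by rewrite Sp.
have To : pairwise_orth T.
  move=> n m nm; rewrite /T !adjM !adjK; split.
    by rewrite -!compA (compA (S n)^†) (So _ _ nm) comp0i compi0.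
  rewrite -!compA (compA (S n.+1)^†) So ?comp0i ?compi0//.
  by move=> [] /nm.
have [W TW] := orth_sum Tp To.
have [Wp _ _ _ _] := TW; have [a1 a2] := pisom_proj Wp.
set a := W^† ∘ W in a1 a2; have [c1 c2] : is_proj (ione - a) := projC (conj a1 a2).
have aS n : a ∘ S n = S n.
  have h : a ∘ (T n)^† = (T n)^†.
    apply: adj_inj; rewrite !adjM !adjK compA; exact: (osum_cogram Tp TW).
  have := congr1 (fun G => G ∘ S n.+1) h; rewrite /T adjM adjK -!compA Se.
  by rewrite SeS.
have aW : (ione - a) ∘ W = 0.
  by apply: (osum_0comp TW) => n; rewrite compBl comp1i /T compA aS subrr.
have aS0 : (S 0%N)^† ∘ (ione - a) = 0.
  by apply: adj_inj; rewrite adjM c1 adjK compBl comp1i aS subrr adj0.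
have [c Ec] : exists c, c = ione - a by exists (ione - a).
rewrite -Ec in c1 c2 aW aS0.
have hV : isom (W + c).
  have Wa : W^† ∘ c = 0 by apply: adj_inj; rewrite adjM adjK c1 adj0.
  rewrite /isom adjD c1 compDl !compDr aW Wa c2 addr0 add0r Ec.
  by rewrite addrC subrK.
have S0V : (S 0%N)^† ∘ (W + c) = 0.
  rewrite compDr (osum_0comp TW) ?aS0 ?addr0//.
  by move=> n; rewrite /T compA So// comp0i.
by rewrite -(Se 0%N) -[(S 0%N)^†]compi1 -(Afin _ hV) compA S0V !comp0i.
Qed.

(** An isometry of a reducing subspace extends by the identity of the complement. *)
Lemma finite_sub A X : finite_obj A -> usub X A -> finite_obj X.
Proof.
move=> Afin /usubP[V hV] U hU.
have [p1 p2] := isom_coproj hV; have [c1 c2] := projC (isom_coproj hV).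
have Vc : (ione - V ∘ V^†) ∘ V = 0 by rewrite compBl comp1i -compA hV compi1 subrr.
have cV : V^† ∘ (ione - V ∘ V^†) = 0 by apply: adj_inj; rewrite adjM adjK c1 adj0.
have [c Ec] : exists c, c = ione - V ∘ V^† by exists (ione - V ∘ V^†).
rewrite -Ec in c1 c2 Vc cV.
have hU' : isom (V ∘ U ∘ V^† + c).
  rewrite /isom adjD c1 !adjM adjK compDl !compDr c2.
  have -> : V ∘ (U^† ∘ V^†) ∘ (V ∘ U ∘ V^†) = V ∘ V^†.
    by rewrite -!compA (compA V^† V) hV comp1i (compA U^†) hU comp1i.
  by rewrite -!compA cV !compA Vc !compi0 !comp0i addr0 add0r Ec addrC subrK.
have VU : V^† ∘ (V ∘ U ∘ V^† + c) = U ∘ V^†.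
  by rewrite compDr cV addr0 !compA hV comp1i.
have := congr1 (fun G => V^† ∘ G ∘ V) (Afin _ hU'); rewrite compi1 hV.
rewrite compA VU -compA -[X in _ ∘ (_ ∘ X)]adjK -adjM VU adjM adjK.
by rewrite -compA (compA V^†) hV comp1i.
Qed.

(** [Y] is the double of some tuple. *)
Definition halvable Y := exists Z (V0 V1 : intw Z Y),
  [/\ isom V0, isom V1, V0^† ∘ V1 = 0 & V0 ∘ V0^† + V1 ∘ V1^† = ione].

(** A maximal orthogonal family of projections that are split into two equivalent halves,
W_i sending one half to the other. A nonzero complement of their supremum would not
be multiplicity free, so it would contain the double of a nonzero tuple, hence a
further such projection. The sum of the W_i then halves [Y]. The condition W W = 0
says that the two halves are orthogonal. *)
Lemma no_multiplicity_free_halvable Y :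
  (forall X, ~ is_trivial X -> usub X Y -> ~ multiplicity_free X) -> halvable Y.
Proof.
move=> nomf.
pose Q (W q : intw Y Y) := [/\ pisom W, W ∘ W = 0 & W^† ∘ W + W ∘ W^† = q].
pose P q := exists W, Q W q.
have Qp W q : Q W q -> is_proj q /\ (W ∘ q = W /\ q ∘ W = W).
  move=> [Wp WW <-]; split.
    apply: projD; [exact: pisom_proj|exact: pisom_coproj|].
    by rewrite -compA (compA W W) WW comp0i compi0.
  split; first by rewrite compDr !compA Wp WW comp0i addr0.
  by rewrite compDl Wp -compA WW compi0 add0r.
have Pp q : P q -> is_proj q by move=> [W /Qp[]].
have [I [q [p [qP qo [pp pq] psep pmax]]]] := maximal_projs Pp.
pose W i := projT1 (cid (qP i)).
have WP i : Q (W i) (q i) by exact: projT2 (cid (qP i)).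
have Wq i := (Qp _ _ (WP i)).2.1; have qW i := (Qp _ _ (WP i)).2.2.
have q1 i := (Qp _ _ (WP i)).1.1.
have Wq' i : q i ∘ (W i)^† = (W i)^† by apply: adj_inj; rewrite !adjE q1 Wq.
have qW' i : (W i)^† ∘ q i = (W i)^† by apply: adj_inj; rewrite !adjE q1 qW.
have Wp i : pisom (W i) by case: (WP i).
have Wo : pairwise_orth W.
  move=> i k ik; split.
    by rewrite -(Wq i) -(Wq' k) -compA (compA (q i)) (qo _ _ ik) comp0i compi0.
  by rewrite -(qW' i) -(qW k) -compA (compA (q i)) (qo _ _ ik) comp0i compi0.
have WW i k : W i ∘ W k = 0.
  have [->|/eqP ik] := eqVneq i k; first by case: (WP k).
  by rewrite -(Wq i) -(qW k) -compA (compA (q i)) (qo _ _ ik) comp0i compi0.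
have [S SW] := orth_sum Wp Wo; have [Sp _ S3 _ _] := SW.
have WS i : W i ∘ S = 0 by apply: (osum_0comp SW) => k.
have SS : S ∘ S = 0 by exact: (osum_comp0 SW).
have SWi i : S ∘ W i = 0 by apply: (osum_comp0 SW) => k.
have fp : is_proj (S^† ∘ S + S ∘ S^†).
  apply: projD; [exact: pisom_proj|exact: pisom_coproj|].
  by rewrite -compA (compA S S) SS comp0i compi0.
have ep := projC fp; set e := ione - _ in ep; have [e1 e2] := ep.
have pe : p ∘ e = 0.
  apply: intw_ext => x; rewrite i_comp i_zero; apply: psep => i.
  apply: (@i_at _ _ _ _ (q i ∘ e) 0 x).
  have We : W i ∘ e = 0.
    rewrite /e compBr compi1 compDr !compA (osum_cogram Wp SW) WS.
    by rewrite comp0i addr0 subrr.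
  have We' : (W i)^† ∘ e = 0.
    have h : (W i)^† ∘ S^† = 0 by apply: adj_inj; rewrite !adjE SWi.
    rewrite /e compBr compi1 compDr !compA h S3 comp0i add0r -compA.
    rewrite (osum_adjr SW) compA; have := pisom_adj (Wp i); rewrite /pisom adjK => ->.
    by rewrite subrr.
  by have [_ _ <-] := WP i; rewrite compDl -!compA We We' !compi0 addr0.
have e0 : e = 0.
  apply: contrapT => e0.
  have [X [V [hV Vp]]] := split_proj ep.
  have X0 := split_nontrivial hV Vp e0.
  have [|Z [Z0 /usubP[U hU]]] := contrapT (nomf X X0 _); first by apply/usubP; exists V.
  pose v k := V ∘ U ∘ (dpr (fun _ : 'I_2 => Z) k)^†.
  have hv k : isom (v k).
    by apply: isom_comp; [exact: isom_comp|exact: dpr_isom].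
  have vo k l : k <> l -> (v k)^† ∘ v l = 0.
    move=> kl; rewrite /v !adjM adjK -!compA (compA V^†) hV comp1i.
    by rewrite (compA U^†) hU comp1i dpr_orth.
  have pv k : p ∘ v k = 0.
    have -> : v k = e ∘ v k by rewrite -Vp /v !compA -(compA V V^†) hV compi1.
    by rewrite compA pe comp0i.
  have vp k : (v k)^† ∘ p = 0 by apply: adj_inj; rewrite !adjE pp.1 pv.
  have v01 : (v ord0)^† ∘ v ord_max = 0 by apply: vo => /(congr1 val).
  move: (v ord0) (v ord_max) (hv ord0) (hv ord_max) v01 (vp ord0) (vp ord_max).
  move=> v0 v1 h0 h1 v01 vp0 vp1.
  have E1 : (v1 ∘ v0^†)^† ∘ (v1 ∘ v0^†) = v0 ∘ v0^†.
    by rewrite adjM adjK -compA (compA v1^†) h1 comp1i.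
  have E2 : (v1 ∘ v0^†) ∘ (v1 ∘ v0^†)^† = v1 ∘ v1^†.
    by rewrite adjM adjK -compA (compA v0^†) h0 comp1i.
  have : v0 ∘ v0^† + v1 ∘ v1^† = 0.
    apply: pmax; last by rewrite compDl -!compA vp0 vp1 !compi0 addr0.
    exists (v1 ∘ v0^†); split; last by rewrite E1 E2.
      by apply: gram_pisom; rewrite E1; exact: isom_coproj.
    by rewrite -compA (compA v0^†) v01 comp0i compi0.
  move=> /(congr1 (fun G => v0^† ∘ G ∘ v0)).
  rewrite compi0 comp0i compDr compDl !compA h0 comp1i v01 !comp0i addr0 h0.
  by move=> /trivialP.
have f1 : S^† ∘ S + S ∘ S^† = ione.
  by apply/esym/eqP; rewrite -subr_eq0; apply/eqP.
have [Z [V [hV Vp]]] := split_proj (pisom_proj Sp).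
have SV : V^† ∘ S = 0.
  rewrite -[V^†]comp1i -hV -(compA V^†) Vp -!compA SS !compi0 //.
exists Z, V, (S ∘ V); split=> //.
- by rewrite /isom adjM -compA (compA S^†) -Vp -compA hV compi1.
- by rewrite compA SV comp0i.
rewrite -f1 Vp; congr (_ + _).
by rewrite adjM -compA (compA V) Vp !compA Sp.
Qed.

(** Write [Y] as the double of [Z], and let [z] be the central cover of [Y] in [M], with
complement [M2]. Then [M] is absorbed by the sum of [Z] and [M2], so by minimality
it embeds there; as there are no intertwiners from [Y] to [M2], the part [Y] embeds
into [Z], which is half of [Y], contrary to finiteness. *)
Lemma finite_halvable_not_below_minimal Y M : ~ is_trivial Y -> finite_obj Y ->
  halvable Y -> usub Y M -> ~ is_minimal M.
Proof.
move=> Y0 Yfin [Z [V0 [V1 [h0 h1 V01 V1E]]]] /usubP[V hV] Mmin.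
have gp := isom_coproj hV; set g := V ∘ V^† in gp.
have [z [zp zC zg zsep]] := central_cover gp.
have [M2 [k [hk kp]]] := split_proj (projC zp).
pose F (b : bool) : CDD R N := if b then Z else M2.
pose D := dsum F.
pose pZ : intw D Z := dpr F true; pose pM : intw D M2 := dpr F false.
have hZ : isom pZ^† by exact: (dpr_isom F true).
have hM : isom pM^† by exact: (dpr_isom F false).
have /usubP[U hU] : usub M D.
  apply: Mmin; apply/ullP => x hx.
  have kx : k^† x = 0.
    by apply: (isom_inj hM); exact: (hx (pM^† ∘ k^†)).
  have zx : z x = 0.
    apply: zsep => G; rewrite /g i_comp; have -> : V^† (G x) = 0; last by rewrite intw0.
    have a0 : V0^† (V^† (G x)) = 0.
      by apply: (isom_inj hZ); exact: (hx (pZ^† ∘ (V0^† ∘ (V^† ∘ G)))).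
    have a1 : V1^† (V^† (G x)) = 0.
      by apply: (isom_inj hZ); exact: (hx (pZ^† ∘ (V1^† ∘ (V^† ∘ G)))).
    have := i_at (V^† (G x)) V1E.
    by rewrite i_add !i_comp a0 a1 !intw0 addr0 i_one => <-.
  have := i_at x kp; rewrite i_comp kx intw0 i_sub zx subr0 i_one.
  by move=> /esym.
have c0 : pM ∘ U ∘ V = 0.
  pose G := k ∘ (pM ∘ U ∘ V) ∘ V^†.
  have kG : (ione - z) ∘ G = G by rewrite /G -kp !compA -(compA k k^†) hk compi1.
  have Gg : G ∘ g = G by rewrite /G /g !compA -(compA _ V^†) hV compi1.
  have G0 : G = 0.
    rewrite -Gg -zg compA -kG -(compA _ G) -zC compA compBl comp1i zp.2 subrr.
    by rewrite !comp0i.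
  have : k^† ∘ G ∘ V = 0 by rewrite G0 compi0 comp0i.
  by rewrite /G !compA hk comp1i -compA hV compi1.
pose a := pZ ∘ U ∘ V.
have Ea : pZ^† ∘ a = U ∘ V.
  apply: intw_ext => x; apply/eqP; rewrite -subr_eq0; apply/eqP.
  apply: dpr_sep => -[].
    rewrite intwB; apply/eqP; rewrite subr_eq0; apply/eqP.
    rewrite i_comp; exact: (isomK hZ (a x)).
  rewrite intwB; have -> : dpr F false ((pZ^† ∘ a) x) = 0.
    by apply: (@i_at _ _ _ _ (dpr F false ∘ (dpr F true)^†) 0 (a x)); exact: dpr_orth.
  by have c0x : dpr F false ((U ∘ V) x) = 0 := i_at x c0; rewrite c0x subrr.
have ha : isom a.
  have : isom (pZ^† ∘ a) by rewrite Ea; exact: isom_comp.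
  by rewrite /isom adjM adjK -compA (compA pZ) -{1}[pZ]adjK hZ comp1i.
have := Yfin (V0 ∘ a) (isom_comp h0 ha); rewrite adjM => E.
have V10 : V1^† ∘ V0 = 0 by apply: adj_inj; rewrite !adjE.
have V1z : V1^† = 0 by rewrite -[V1^†]compi1 -E -!compA compA V10 comp0i.
have Z0 : (ione : intw Z Z) = 0 by rewrite -h1 V1z comp0i.
by apply/Y0/trivialP; rewrite -V1E -[V0]compi1 Z0 compi0 V1z compi0 comp0i addr0.
Qed.

End Comparison.

(** * Finite tuples without multiplicity free part are semiminimal *)

Section Semiminimal.
Variables (R : realType) (N : nat).
Implicit Types A B C X Y Z M : CDD R N.

Lemma ull_neq0 A B (c : intw A A) : ull A B -> c <> 0 -> exists T : intw A B, T ∘ c <> 0.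
Proof.
move=> /ullP sep c0; apply: contrapT => nT; apply: c0.
apply: intw_ext => x; rewrite i_zero; apply: sep => T.
apply: (@i_at _ _ _ _ (T ∘ c) 0 x).
by apply: contrapT => hT; apply: nT; exists T.
Qed.

Lemma adj_proj A B (p : intw A A) (T : intw A B) : is_proj p -> T ∘ p = T ->
  p ∘ T^† = T^†.
Proof. by move=> [p1 _] h; apply: adj_inj; rewrite !adjE p1. Qed.

Lemma adj_projl A B (p : intw B B) (T : intw A B) : is_proj p -> p ∘ T = T ->
  T^† ∘ p = T^†.
Proof. by move=> [p1 _] h; apply: adj_inj; rewrite !adjE p1. Qed.

(** Let [X] be finite and absorbed by [B]. Copies of pieces of [B] are removed from [X]
greedily: [piece n] is a maximal partial isometry to [B] from [rest n], the part of
[X] still present, and [rest n.+1] is what it leaves. On the complement of the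
central cover of [rest n] the first n pieces use up everything, so this complement
lies below n copies of [B]. The summands required by semiminimality are the
differences of consecutive central covers: they are disjoint, being cut out by
orthogonal central projections. *)
Section Decomposition.
Variables (X B : CDD R N).
Hypotheses (Xfin : finite_obj X) (XB : ull X B).

Definition match_spec (g : intw X X) (W : intw X B) := [/\ pisom W, W ∘ g = W &
  forall T, (ione - W ∘ W^†) ∘ T ∘ (g - W^† ∘ W) = 0].

Lemma match_ex g : exists W, is_proj g -> match_spec g W.
Proof.
have [gp|ng] := pselect (is_proj g); last by exists 0.
by have [W hW] := maximal_match B gp; exists W.
Qed.

Definition match_of g := projT1 (cid (match_ex g)).

Definition rest n := iter n (fun g => g - (match_of g)^† ∘ match_of g) ione.
Definition piece n := match_of (rest n).

Lemma match_ofP g : is_proj g -> match_spec g (match_of g).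
Proof. exact: projT2 (cid (match_ex g)). Qed.

Lemma rest_proj n : is_proj (rest n).
Proof.
elim: n => [|n IH] /=; first exact: proj1.
have [h1 h2 _] := match_ofP IH.
apply: projB => //; first exact: pisom_proj.
by rewrite compA (adj_proj IH h2).
Qed.

Lemma piece_pisom n : pisom (piece n).
Proof. by have [] := match_ofP (rest_proj n). Qed.

Lemma piece_rest n : piece n ∘ rest n = piece n.
Proof. by have [] := match_ofP (rest_proj n). Qed.

Lemma restS n : rest n.+1 = rest n - (piece n)^† ∘ piece n.
Proof. by []. Qed.

Lemma piece_max n T : (ione - piece n ∘ (piece n)^†) ∘ T ∘ rest n.+1 = 0.
Proof. by have [_ _] := match_ofP (rest_proj n); apply. Qed.

Lemma rest_decS n : rest n ∘ rest n.+1 = rest n.+1.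
Proof.
rewrite restS compBr (rest_proj n).2 compA.
by rewrite (adj_proj (rest_proj n) (piece_rest n)).
Qed.

Lemma rest_dec n m : (n <= m)%N -> rest n ∘ rest m = rest m.
Proof.
move=> /subnK <-; elim: (m - n)%N => [|k IH]; first exact: (rest_proj n).2.
by rewrite addSn -rest_decS compA IH.
Qed.

Lemma piece_restS n : piece n ∘ rest n.+1 = 0.
Proof. by rewrite restS compBr piece_rest compA piece_pisom subrr. Qed.

Lemma piece_orth n m : n <> m -> piece n ∘ (piece m)^† = 0.
Proof.
have lt k l : (k < l)%N -> piece k ∘ (piece l)^† = 0.
  move=> kl; rewrite -(adj_proj (rest_proj l) (piece_rest l)).
  by rewrite -(rest_dec kl) !compA piece_restS !comp0i.
move=> nm; have [|/lt mn|//] := ltngtP n m; first exact: lt.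
by apply: adj_inj; rewrite !adjE.
Qed.

Lemma rest_id n x : (forall k, (k < n)%N -> piece k x = 0) -> rest n x = x.
Proof.
elim: n => [|n IH] h //; rewrite restS i_sub IH => [|k kn].
  by rewrite i_comp h// intw0 subr0.
by apply: h; exact: ltnW.
Qed.

Definition cover_spec (g z : intw X X) := [/\ is_proj z, forall G, z ∘ G = G ∘ z,
  z ∘ g = g & forall x, (forall T : intw X X, g (T x) = 0) -> z x = 0].

Definition cover n : intw X X := projT1 (cid (central_cover (rest_proj n))).

Lemma coverP n : cover_spec (rest n) (cover n).
Proof. exact: projT2 (cid (central_cover (rest_proj n))). Qed.

Lemma cover_proj n : is_proj (cover n). Proof. by case: (coverP n). Qed.

Lemma coverC n G : cover n ∘ G = G ∘ cover n. Proof. by case: (coverP n). Qed.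

Lemma cover_rest n m : (n <= m)%N -> cover n ∘ rest m = rest m.
Proof. by move=> nm; rewrite -(rest_dec nm) compA; case: (coverP n) => _ _ -> _. Qed.

Lemma cover_dec n m : (n <= m)%N -> cover n ∘ cover m = cover m.
Proof.
move=> nm; have [_ _ _ sep] := coverP m; have [c1 c2] := cover_proj n.
rewrite coverC; apply/esym/eqP; rewrite -subr_eq0 -{1}[cover m]compi1 -compBr.
apply/eqP/intw_ext => x; rewrite i_comp i_zero; apply: sep => T.
apply: (@i_at _ _ _ _ (rest m ∘ T ∘ (ione - cover n)) 0 x).
rewrite -compA compBr compi1 -coverC compBr compA -coverC cover_rest//.
by rewrite subrr.
Qed.

Lemma cover0 : cover 0 = ione.
Proof. by have [_ _] := coverP 0; rewrite compi1. Qed.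

Definition layer n := cover n - cover n.+1.

Lemma layer_proj n : is_proj (layer n).
Proof. by apply: projB; rewrite ?cover_dec//; exact: cover_proj. Qed.

Lemma layerC n G : layer n ∘ G = G ∘ layer n.
Proof. by rewrite /layer compBl compBr !coverC. Qed.

Lemma layer_orth n m : n <> m -> layer n ∘ layer m = 0.
Proof.
have lt k l : (k < l)%N -> layer k ∘ layer l = 0.
  move=> kl; rewrite /layer compBl !compBr.
  by rewrite !cover_dec ?subrr// ?(ltnW kl) ?leqW// (ltnW kl).
move=> nm; have [|/lt mn|//] := ltngtP n m; first exact: lt.
by rewrite layerC.
Qed.

Lemma layer_rest n : rest n.+1 ∘ layer n = 0.
Proof. by rewrite -layerC /layer compBl !cover_rest// subrr. Qed.

Definition summand n := projT1 (cid (split_proj (layer_proj n))).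
Definition summand_in n : intw (summand n) X :=
  projT1 (cid (projT2 (cid (split_proj (layer_proj n))))).

Lemma summand_isom n : isom (summand_in n).
Proof. exact: (projT2 (cid (projT2 (cid (split_proj (layer_proj n)))))).1. Qed.

Lemma summand_range n : summand_in n ∘ (summand_in n)^† = layer n.
Proof. exact: (projT2 (cid (projT2 (cid (split_proj (layer_proj n)))))).2. Qed.

Lemma layer_summand n : layer n ∘ summand_in n = summand_in n.
Proof. by rewrite -summand_range -compA summand_isom compi1. Qed.

Lemma summand_disjoint n m : n <> m -> udisjoint (summand n) (summand m).
Proof.
move=> nm; apply/disjointP => T.
pose G := summand_in m ∘ T ∘ (summand_in n)^†.
have Gl : G ∘ layer n = G.
  by rewrite /G -compA (adj_projl (layer_proj n) (layer_summand n)).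
have lG : layer m ∘ G = G by rewrite /G !compA layer_summand.
have G0 : G = 0.
  by rewrite -lG -Gl -layerC compA layer_orth ?comp0i//; exact: nesym.
have : (summand_in m)^† ∘ G ∘ summand_in n = 0 by rewrite G0 compi0 comp0i.
by rewrite /G !compA summand_isom comp1i -compA summand_isom compi1.
Qed.

(** On [layer n] the part [rest n.+1] vanishes, so the restrictions of the first n + 1
pieces are jointly injective there. *)
Lemma summand_sub n : usub (summand n) (multiple 'I_n.+1 B).
Proof.
pose D := fun _ : 'I_n.+1 => B.
pose T (k : 'I_n.+1) := (dpr D k)^† ∘ (piece k ∘ summand_in n).
have dT k : (T k)^† ∘ T k = (summand_in n)^† ∘ ((piece k)^† ∘ piece k) ∘ summand_in n.
  rewrite /T !adjM adjK -!compA (compA (dpr D k)).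
  by have := dpr_isom D k; rewrite /isom adjK => ->; rewrite comp1i.
have Tp k : pisom (T k).
  apply: gram_pisom; rewrite dT.
  move: (_ ∘ piece k) (pisom_proj (piece_pisom k)) => a [a1 a2].
  split; first by rewrite !adjM adjK a1 compA.
  rewrite -!compA (compA (summand_in n)) summand_range (compA a) -layerC.
  by rewrite !compA (adj_projl (layer_proj n) (layer_summand n)) -(compA _ a a) a2.
have To : pairwise_orth T.
  move=> k l kl; rewrite /T !adjM !adjK; split.
    have kl' : (k : nat) <> l by move=> /val_inj.
    rewrite -!compA (compA (summand_in n)) summand_range.
    have -> : piece k ∘ (layer n ∘ ((piece l)^† ∘ dpr D l)) = 0; last by rewrite compi0.
    rewrite -{1}(piece_pisom k) -(compA _ _ (piece k)) -!compA.
    rewrite (compA (piece k) (layer n)).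
    have -> : piece k ∘ layer n = piece k ∘ layer n ∘ ((piece k)^† ∘ piece k).
      by rewrite -compA layerC !compA piece_pisom.
    by rewrite -!compA (compA _ _ (dpr D l)) piece_orth// comp0i !compi0.
  by rewrite -!compA (compA (dpr D k)) dpr_orth// comp0i !compi0.
have [V TV] := orth_sum Tp To.
apply/usubP; exists V; apply: (osum_isom Tp TV) => x hx.
apply: (isom_inj (summand_isom n)).
have <- : rest n.+1 (summand_in n x) = summand_in n x.
  apply: rest_id => k kn; apply: (isom_inj (dpr_isom D (Ordinal kn))).
  exact: (hx (Ordinal kn)).
apply: (@i_at _ _ _ _ (rest n.+1 ∘ summand_in n) 0 x).
by rewrite -layer_summand compA layer_rest comp0i.
Qed.

(** The covers decrease to 0. Otherwise some partial isometry [U] to [B] lives under all of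
them. What [piece n] leaves in [B] is disjoint from [rest n.+1], hence from its
central cover, so the range of [U] lies in the range of every [piece n]. Then the
operators (piece n)^† U are infinitely many orthogonal copies of the same nonzero
projection in the finite tuple [X]. *)
Lemma summand_total : uequiv X (dsum summand).
Proof.
have [|W [hW Wi _]] := dsum_map summand_isom.
  move=> n m nm; rewrite -(layer_summand m).
  rewrite -(adj_projl (layer_proj n) (layer_summand n)).
  by rewrite -compA (compA (layer n)) layer_orth// comp0i compi0.
apply/uequivP; exists W^†; rewrite adjK; split=> //.
have cp := projC (isom_coproj hW); set c := ione - W ∘ W^† in cp.
suff c0 : c = 0.
  rewrite /isom adjK; apply/esym/eqP; rewrite -subr_eq0; exact/eqP.
have cl n : c ∘ layer n = 0.
  rewrite -summand_range -Wi !compA.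
  by rewrite /c compBl comp1i -(compA W) hW compi1 subrr !comp0i.
have cz n : c ∘ cover n = c.
  elim: n => [|n IH]; first by rewrite cover0 compi1.
  have := cl n; rewrite /layer compBr IH => /eqP; rewrite subr_eq0 => /eqP.
  by move=> <-.
apply: contrapT => /(ull_neq0 XB)[T /polar[U [Up U0 _ Ub]]].
have Uc : U ∘ c = U by rewrite -{1}cp.1; apply: Ub; rewrite cp.1 -compA cp.2.
have Uz n : U ∘ cover n = U by rewrite -{1}Uc -compA cz.
have WU n : piece n ∘ (piece n)^† ∘ U = U.
  apply/esym/eqP; rewrite -subr_eq0 -{1}[U]comp1i -compBl; apply/eqP.
  rewrite -(Uz n.+1); apply: adj_inj; rewrite adj0 !adjM (cover_proj n.+1).1.
  apply: intw_ext => y; rewrite -compA i_comp i_zero.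
  have [_ _ _ sep] := coverP n.+1; apply: sep => S.
  have := congr1 (@iadj _ _ _ _) (piece_max n (U ∘ S^†)).
  rewrite !adjM adjK (rest_proj n.+1).1 adj0 => h.
  exact: (i_at y h).
apply: U0; apply: adj_comp0.
apply: (@finite_orth_copies _ _ _ (fun n => (piece n)^† ∘ U) _ Xfin).
- exact: pisom_proj.
- by move=> n; rewrite adjM adjK -compA (compA (piece n)) WU.
move=> n m nm; rewrite adjM adjK -compA (compA (piece n)) piece_orth//.
by rewrite comp0i compi0.
Qed.

End Decomposition.

(** Disjointness from minimal tuples is [finite_halvable_not_below_minimal] applied to a
common part, which inherits both hypotheses. *)
Lemma finite_semiminimal X : finite_obj X ->
  (forall Y, ~ is_trivial Y -> usub Y X -> ~ multiplicity_free Y) ->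
  is_semiminimal X.
Proof.
move=> Xfin nomf; split.
  move=> M Mmin [Y [Y0 YX YM]].
  apply: (finite_halvable_not_below_minimal Y0 (finite_sub Xfin YX) _ YM Mmin).
  apply: no_multiplicity_free_halvable => Z Z0 ZY; apply: nomf => //.
  exact: usub_trans ZY YX.
move=> B XB; exists (summand X B); split; last exact: summand_sub.
by split; [exact: summand_disjoint|exact: summand_total].
Qed.

End Semiminimal.

(** * Purely infinite tuples are idempotent *)

Section PurelyInfinite.
Variables (R : realType) (N : nat).
Implicit Types A B C X Y Z M : CDD R N.

Definition orth_copies A (v : nat -> intw A A) (e : intw A A) :=
  (forall n, (v n)^† ∘ v n = e) /\ (forall n m, n <> m -> (v n)^† ∘ v m = 0).

(** The wandering subspace of an isometry [V] and its translates. *)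
Lemma orth_copies_iter A (V w e : intw A A) : isom V -> w^† ∘ w = e ->
  w^† ∘ V = 0 -> orth_copies (fun n => iter n (icomp V) w) e.
Proof.
move=> hV we wV.
have S n m : (iter n.+1 (icomp V) w)^† ∘ iter m.+1 (icomp V) w =
    (iter n (icomp V) w)^† ∘ iter m (icomp V) w.
  by rewrite /= adjM -compA (compA V^†) hV comp1i.
split; first by elim=> [|n IH]; rewrite ?S.
have lt n m : (n < m)%N -> (iter n (icomp V) w)^† ∘ iter m (icomp V) w = 0.
  elim: n m => [|n IH] [|m]// nm; last by rewrite S; exact: IH.
  by rewrite /= compA wV comp0i.
move=> n m nm; have [|/lt mn|//] := ltngtP n m; first exact: lt.
by apply: adj_inj; rewrite !adjE.
Qed.

(** The relations of the Cuntz algebra on two generators, in the corner cut out by [q]. *)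
Definition doubling A (q U0 U1 : intw A A) := [/\ U0^† ∘ U0 = q,
  U1^† ∘ U1 = q, U0^† ∘ U1 = 0 & U0 ∘ U0^† + U1 ∘ U1^† = q].

(** The supremum [q] of infinitely many copies of [e] is its own double: send the n-th copy
to the copies 2 n and 2 n + 1. *)
Lemma orth_copies_doubling A (v : nat -> intw A A) (e : intw A A) : is_proj e ->
  orth_copies v e ->
  exists q U0 U1 : intw A A, [/\ is_proj q, forall n, q ∘ v n = v n & doubling q U0 U1].
Proof.
move=> [e1 e2] [vv vo].
have vp n : pisom (v n) by apply: gram_pisom; rewrite vv.
have ve n : v n ∘ e = v n by rewrite -(vv n) compA vp.
have ev n : e ∘ (v n)^† = (v n)^† by apply: adj_inj; rewrite !adjE e1 ve.
(* the operator moving the n-th copy to the copy of index f n *)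
have shift (f : nat -> nat) : injective f -> exists S : intw A A,
    is_orth_sum (fun n => v (f n) ∘ (v n)^†) S /\
    forall n, pisom (v (f n) ∘ (v n)^†).
  move=> fi; have Tp n : pisom (v (f n) ∘ (v n)^†).
    by rewrite /pisom adjM adjK !compA -(compA _ _ (v n)) vv -(compA _ e) ev vp.
  have [|S hS] := orth_sum Tp; last by exists S.
  move=> n m nm; rewrite !adjM !adjK; split.
    by rewrite -!compA (compA (v n)^†) vo// comp0i compi0.
  by rewrite -!compA (compA (v (f n))^†) vo ?comp0i ?compi0// => /fi.
have shiftv (f : nat -> nat) S : (forall n, pisom (v (f n) ∘ (v n)^†)) ->
    is_orth_sum (fun n => v (f n) ∘ (v n)^†) S -> forall n, S ∘ v n = v (f n).
  move=> Tp hS n; case: (hS) => _ h _ _ _.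
  have := congr1 (fun G => G ∘ v (f n)) (h n).
  by rewrite adjM adjK -!compA !vv !ve vv ve.
have [Q [hQ Qp]] := shift id (fun _ _ h => h).
have Qv := shiftv id Q Qp hQ.
have [Qpi Q2 Q3 Q4 Q5] := hQ.
pose q := Q^† ∘ Q.
have qp : is_proj q by exact: pisom_proj.
have qv n : q ∘ v n = v n.
  rewrite /q -compA Qv; have := congr1 (fun G => G ∘ v n) (osum_adjl hQ n).
  by rewrite adjM adjK -!compA !vv !ve vv ve.
have qsep x : (forall n, (v n)^† x = 0) -> q x = 0.
  by move=> hx; rewrite i_comp Q4 ?intw0// => n; rewrite i_comp hx intw0.
clearbody q.
have vq n : (v n)^† ∘ q = (v n)^† by apply: adj_inj; rewrite adjM adjK qp.1 qv.
have gram f S : (forall n, pisom (v (f n) ∘ (v n)^†)) ->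
    is_orth_sum (fun n => v (f n) ∘ (v n)^†) S -> S^† ∘ S = q /\ q ∘ S = S.
  move=> Tp hS; split.
    apply: (osum_gramE Tp hS) => // [n|x hx]; first by rewrite -compA vq.
    apply: qsep => n; rewrite -ev i_comp -(vv (f n)) i_comp.
    by have := hx n; rewrite i_comp => ->; rewrite intw0.
  apply/esym/eqP; rewrite -subr_eq0 -{1}[S]comp1i -compBl; apply/eqP.
  by apply: (osum_0comp hS) => n; rewrite compBl comp1i compA qv subrr.
have ie : injective (fun n : nat => n.*2) by exact: double_inj.
have io : injective (fun n : nat => n.*2.+1) by move=> n m [] /double_inj.
have [S0 [h0 p0]] := shift _ ie; have [S1 [h1 p1]] := shift _ io.
have [g0 q0] := gram _ _ p0 h0; have [g1 q1] := gram _ _ p1 h1.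
have v0 := shiftv _ _ p0 h0; have v1 := shiftv _ _ p1 h1.
have S01 : S0^† ∘ S1 = 0.
  apply: (osum_0comp h1) => m; apply: adj_inj; rewrite adjM adjK adj0.
  apply: (osum_0comp h0) => n; rewrite adjM adjK -!compA (compA (v _)^† (v _)).
  rewrite vo ?comp0i ?compi0// => /(congr1 odd).
  by rewrite /= !odd_double.
have S10 : S1^† ∘ S0 = 0 by apply: adj_inj; rewrite !adjE.
exists q, S0, S1; split=> //; split=> //.
pose r := q - (S0 ∘ S0^† + S1 ∘ S1^†).
have rv n : r ∘ v n = 0.
  have S0v k : S0^† ∘ v k.*2 = v k by rewrite -v0 compA g0 qv.
  have S1v k : S1^† ∘ v k.*2.+1 = v k by rewrite -v1 compA g1 qv.
  have S0w k : S0^† ∘ v k.*2.+1 = 0 by rewrite -v1 compA S01 comp0i.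
  have S1w k : S1^† ∘ v k.*2 = 0 by rewrite -v0 compA S10 comp0i.
  rewrite /r compBl compDl qv -!compA -[n]odd_double_half.
  case: (odd n); rewrite ?add1n ?add0n.
    by rewrite S0w S1v v1 compi0 add0r subrr.
  by rewrite S0v S1w v0 compi0 addr0 subrr.
have r1 : r^† = r by rewrite /r !adjE qp.1.
have vr n : (v n)^† ∘ r = 0 by apply: adj_inj; rewrite adjM adjK r1 rv adj0.
have qr : q ∘ r = 0.
  by apply: intw_ext => x; rewrite i_comp i_zero; apply: qsep => n; exact: (i_at x (vr n)).
have : q ∘ r = r by rewrite /r compBr compDr !compA qp.2 q0 q1.
by rewrite qr => /esym/eqP; rewrite subr_eq0 => /eqP <-.
Qed.

Definition purely_infinite A := forall X, ~ is_trivial X -> usub X A -> ~ finite_obj X.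

Lemma purely_infinite_sub A X : purely_infinite A -> usub X A -> purely_infinite X.
Proof. by move=> h XA Y Y0 YX; apply: h => //; exact: usub_trans YX XA. Qed.

(** A maximal orthogonal family of projections that are their own doubles exhausts [A]: a
nonzero complement carries a non-unitary isometry, whose wandering subspace gives
infinitely many copies and hence, by [orth_copies_doubling], a further member. The
doublings of the members add up. *)
Lemma purely_infinite_doubling A : purely_infinite A ->
  exists S0 S1 : intw A A, doubling ione S0 S1.
Proof.
move=> pi; pose P (q : intw A A) := is_proj q /\ exists U, doubling q U.1 U.2.
have Pp q : P q -> is_proj q by case.
have [I [q [p [qP qo [pp pq] psep pmax]]]] := maximal_projs Pp.
have p1 : p = ione.
  apply/esym/eqP; rewrite -subr_eq0; apply/eqP; apply: contrapT => c0.
  have [X [V [hV Vp]]] := split_proj (projC pp).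
  have X0 := split_nontrivial hV Vp c0.
  have : ~ finite_obj X by apply: pi => //; apply/usubP; exists V.
  move=> /existsNP[W /not_implyP[hW W1]].
  have ep := projC (isom_coproj hW).
  have [e1 e2] := ep.
  have eW : (ione - W ∘ W^†)^† ∘ W = 0 by rewrite e1 compBl comp1i -compA hW compi1 subrr.
  have hw : (ione - W ∘ W^†)^† ∘ (ione - W ∘ W^†) = ione - W ∘ W^† by rewrite e1 e2.
  have [r [U0 [U1 [rp rv [u0 u1 u01 u2]]]]] :=
    orth_copies_doubling ep (orth_copies_iter hW hw eW).
  have r0 : r <> 0.
    move=> r0; apply: W1; apply/esym/eqP; rewrite -subr_eq0.
    by have := rv 0%N; rewrite /= r0 comp0i => <-.
  have conjM (G G' : intw X X) : (V ∘ G ∘ V^†) ∘ (V ∘ G' ∘ V^†) = V ∘ (G ∘ G') ∘ V^†.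
    by rewrite -!compA (compA V^†) hV comp1i.
  have conjA (G : intw X X) : (V ∘ G ∘ V^†)^† = V ∘ G^† ∘ V^†.
    by rewrite !adjM adjK compA.
  apply: r0; have : V ∘ r ∘ V^† = 0.
    apply: pmax.
      split; first by split; rewrite ?conjA ?conjM ?rp.1 ?rp.2.
      exists (V ∘ U0 ∘ V^†, V ∘ U1 ∘ V^†); split; rewrite /= !conjA ?conjM ?u0 ?u1 ?u01//.
        by rewrite compi0 comp0i.
      by rewrite -compDl -compDr u2.
    have -> : V^† = V^† ∘ (ione - p) by rewrite -Vp compA hV comp1i.
    by rewrite -!compA compBl comp1i pp.2 subrr !compi0.
  move=> /(congr1 (fun G => V^† ∘ G ∘ V)).
  by rewrite compi0 comp0i !compA hV comp1i -compA hV compi1.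
pose U i := projT1 (cid (qP i).2).
have UP i : doubling (q i) (U i).1 (U i).2 by exact: projT2 (cid (qP i).2).
have facts i : [/\ is_proj (q i), pisom (U i).1 & pisom (U i).2] /\
    [/\ (U i).1 ∘ q i = (U i).1, (U i).2 ∘ q i = (U i).2,
        q i ∘ (U i).1 = (U i).1 & q i ∘ (U i).2 = (U i).2].
  have [u0 u1 u01 u2] := UP i; have qi := Pp _ (qP i).
  have i0 : pisom (U i).1 by apply: gram_pisom; rewrite u0.
  have i1 : pisom (U i).2 by apply: gram_pisom; rewrite u1.
  have u10 : (U i).2^† ∘ (U i).1 = 0 by apply: adj_inj; rewrite !adjE.
  split; split=> //.
  - by rewrite -u0 compA i0.
  - by rewrite -u1 compA i1.
  - by rewrite -u2 compDl i0 -compA u10 compi0 addr0.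
  - by rewrite -u2 compDl i1 -compA u01 compi0 add0r.
(* operators living under distinct members are orthogonal *)
have cross i k : i <> k -> forall G H : intw A A, G ∘ q i = G -> q k ∘ H = H -> G ∘ H = 0.
  by move=> ik G H <- <-; rewrite -compA (compA (q i)) qo// comp0i compi0.
have adjr i G : G ∘ q i = G -> q i ∘ G^† = G^† by exact: adj_proj (Pp _ (qP i)).
have adjl i G : q i ∘ G = G -> G^† ∘ q i = G^† by exact: adj_projl (Pp _ (qP i)).
have T0p i : pisom (U i).1 by case: (facts i) => -[].
have T1p i : pisom (U i).2 by case: (facts i) => -[].
have T0o : pairwise_orth (fun i => (U i).1).
  move=> i k ik; have [_ [a b c d]] := facts i; have [_ [a' b' c' d']] := facts k.
  by split; apply: (cross i k) => //; [exact: adjr|exact: adjl].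
have T1o : pairwise_orth (fun i => (U i).2).
  move=> i k ik; have [_ [a b c d]] := facts i; have [_ [a' b' c' d']] := facts k.
  by split; apply: (cross i k) => //; [exact: adjr|exact: adjl].
have [S0 h0] := orth_sum T0p T0o; have [S1 h1] := orth_sum T1p T1o.
have sep x : (forall i, q i x = 0) -> x = 0.
  by move=> hx; have := psep x hx; rewrite p1.
have S0i : isom S0.
  apply: (osum_isom T0p h0) => x hx; apply: sep => i; have [<- _ _ _] := UP i.
  by rewrite i_comp hx intw0.
have S1i : isom S1.
  apply: (osum_isom T1p h1) => x hx; apply: sep => i; have [_ <- _ _] := UP i.
  by rewrite i_comp hx intw0.
have S01 : S0^† ∘ S1 = 0.
  apply: (osum_0comp h1) => k; apply: adj_inj; rewrite adjM adjK adj0.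
  apply: (osum_0comp h0) => i; apply: adj_inj; rewrite adjM adjK adj0.
  have [->|/eqP ik] := eqVneq i k; first by case: (UP k).
  have [_ [a b c d]] := facts i; have [_ [a' b' c' d']] := facts k.
  by apply: (cross i k) => //; exact: adjl.
have S10 : S1^† ∘ S0 = 0 by apply: adj_inj; rewrite !adjE.
exists S0, S1; split=> //.
apply/esym/eqP; rewrite -subr_eq0; apply/eqP; set r := ione - _.
have S0r : S0^† ∘ r = 0.
  by rewrite /r compBr compi1 compDr !compA S0i S01 comp1i comp0i addr0 subrr.
have S1r : S1^† ∘ r = 0.
  by rewrite /r compBr compi1 compDr !compA S1i S10 comp1i comp0i add0r subrr.
have U0r i : (U i).1^† ∘ r = 0.
  have := osum_adjr h0 i => h.
  have -> : (U i).1^† = q i ∘ S0^†.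
    have [<- _ _ _] := UP i; rewrite -compA h compA.
    by have := pisom_adj (T0p i); rewrite /pisom adjK => ->.
  by rewrite -compA S0r compi0.
have U1r i : (U i).2^† ∘ r = 0.
  have := osum_adjr h1 i => h.
  have -> : (U i).2^† = q i ∘ S1^†.
    have [_ <- _ _] := UP i; rewrite -compA h compA.
    by have := pisom_adj (T1p i); rewrite /pisom adjK => ->.
  by rewrite -compA S1r compi0.
apply: intw_ext => x; rewrite i_zero; apply: sep => i.
apply: (@i_at _ _ _ _ (q i ∘ r) 0 x).
by have [_ _ _ <-] := UP i; rewrite compDl -!compA U0r U1r !compi0 addr0.
Qed.

Lemma purely_infinite_idempotent A : purely_infinite A -> hereditary_idempotent A.
Proof.
move=> pi B BA; have [S0 [S1 [h0 h1 h01 hE]]] :=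
  purely_infinite_doubling (purely_infinite_sub pi BA).
have h10 : S1^† ∘ S0 = 0 by apply: adj_inj; rewrite !adjE.
pose V (k : 'I_2) := if k == ord0 then S0 else S1.
have [k|k l kl|W [hW _]] := @dsum_map R N 'I_2 (fun _ => B) B V.
- by rewrite /V; case: ifP.
- rewrite /V; case: (eqVneq k ord0) => [k0|k0]; case: (eqVneq l ord0) => [l0|l0] //.
    by case: kl; rewrite k0 l0.
  have max (m : 'I_2) : m != ord0 -> m = ord_max.
    move=> m0; have : (0 < m)%N by rewrite lt0n.
    by move=> m1; apply: val_inj => /=; have := ltn_ord m; case: (m : nat) m1 => [|[|]].
  by case: kl; rewrite (max _ k0) (max _ l0).
move=> hW'; apply/uequivP; exists W^†; rewrite adjK; split=> //.
apply: hW' => y hy; have y0 : S0^† y = 0 by exact: hy ord0.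
have y1 : S1^† y = 0 by exact: (hy ord_max).
by have := i_at y hE; rewrite i_add !i_comp y0 y1 !intw0 addr0.
Qed.

End PurelyInfinite.

(** * Minimality, and the unity meets every tuple *)

Section Unity.
Variables (R : realType) (N : nat).
Implicit Types A B C X Y Z M J : CDD R N.

(** That is, separating for the commutant of [A], or cyclic for its bicommutant. *)
Definition separating A (x : hspace A) :=
  forall q : intw A A, is_proj q -> q x = 0 -> q = 0.

(** The numbers |q_i x|^2 are positive, with sum at most |x|^2 by Bessel's inequality, so
only finitely many exceed 1 / (n + 1) for each n. *)
Lemma separating_countable A (x : hspace A) (I : choiceType) (q : I -> intw A A) :
  separating x -> (forall i, is_proj (q i) /\ q i <> 0) ->
  (forall i k, i <> k -> q i ∘ q k = 0) -> exists f : I -> nat, injective f.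
Proof.
move=> xsep qP qo; pose a i := nrm (q i x) ^+ 2.
have a0 i : 0 < a i.
  rewrite exprn_gt0// lt_neqAle nrm_ge0 andbT eq_sym; apply/eqP => h.
  by have [qp] := qP i; apply; apply: xsep => //; exact: nrm_eq0.
have qpi i : pisom (q i) by apply: proj_pisom; case: (qP i).
have qpo : pairwise_orth q.
  by move=> i k ik; rewrite (qP i).1.1 (qP k).1.1 qo.
pose D n := [set i | n.+1%:R^-1 < a i].
have DT : [set: I] = \bigcup_n D n.
  apply/esym; rewrite -subTset => i _.
  have [n hn] := ltr_add_invr (a0 i); rewrite add0r in hn.
  by exists n.
have Dfin n : finite_set (D n).
  apply: contrapT => /infinite_set_fset Dinf.
  pose K := nrm x ^+ 2; have K0 : 0 <= K by exact: sqr_ge0.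
  have [m hm] : exists m : nat, n.+1%:R * K < m%:R.
    by exists (Num.bound (n.+1%:R * K)); apply: archi_boundP; rewrite mulr_ge0.
  have [F FD Fm] := Dinf m.
  have h : n.+1%:R^-1 * m%:R <= K.
    apply: le_trans (bessel x F qpi qpo).
    apply: (@le_trans _ _ (n.+1%:R^-1 * #|` F|%:R)).
      by rewrite ler_wpM2l ?invr_ge0// ler_nat.
    rewrite -sum1_size natr_sum mulr_sumr /psum !big_seq; apply: ler_sum => i iF.
    by rewrite mulr1 ltW//; exact: FD.
  by move: h; rewrite mulrC ler_pdivrMr ?ltr0n// leNgt mulrC hm.
have : countable [set: I].
  rewrite DT; apply: bigcup_countable => [|n _]; first exact: countableP.
  exact: finite_set_countable.
by move=> /countable_injP[f fi]; exists f => i k; apply: fi; exact: mem_set.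
Qed.

(** Remove from [A] the supremum of all projections that kill [x]: the complement is the
reducing subspace generated by [x]. *)
Lemma separating_sub A (x : hspace A) : x <> 0 ->
  exists X (V : intw X A), [/\ ~ is_trivial X, isom V & separating (V^† x)].
Proof.
move=> x0; pose P (q : intw A A) := is_proj q /\ q x = 0.
have [|I [q [p [qP _ [pp pq] psep pmax]]]] := maximal_projs (P := P); first by move=> q [].
have px : p x = 0 by apply: psep => i; case: (qP i).
have [X [V [hV Vp]]] := split_proj (projC pp).
have Vx : V (V^† x) = x by rewrite -i_comp Vp i_sub px subr0.
exists X, V; split=> //.
  apply: (split_nontrivial hV Vp) => e0; apply: x0.
  by rewrite -Vx; have := i_at x Vp; rewrite i_comp e0 => ->.
move=> r [r1 r2] rx.
have : V ∘ r ∘ V^† = 0.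
  apply: pmax.
    split; last by rewrite !i_comp rx intw0.
    split; first by rewrite !adjM adjK r1 compA.
    by rewrite -!compA (compA V^† V) hV comp1i (compA r) r2.
  have -> : V^† = V^† ∘ (ione - p) by rewrite -Vp compA hV comp1i.
  by rewrite -!compA compBl comp1i pp.2 subrr !compi0.
move=> /(congr1 (fun G => V^† ∘ G ∘ V)).
by rewrite compi0 comp0i !compA hV comp1i -compA hV compi1.
Qed.

(** Let [X] be absorbed by [B], and let [W] be a maximal partial isometry to [B], with
initial projection [a]. The remainder b = 1 - a is disjoint from what is left of
[B], so it is covered by orthogonal projections equivalent to parts of [a]; by
[separating_countable] there are countably many. As [a] is purely infinite it has
infinitely many orthogonal copies of itself under [a]: one of them receives [a],
and the others receive the pieces of [b]. Composing with [W] embeds [X] in [B]. *)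
Lemma purely_infinite_minimal X (x : hspace X) : purely_infinite X ->
  separating x -> is_minimal X.
Proof.
move=> pi xsep B XB.
have [W [Wp _ Wmax]] := maximal_match B (proj1 X).
have ap := pisom_proj Wp; set a := W^† ∘ W in Wmax ap.
have Wa : W ∘ a = W by rewrite /a compA.
have aW : a ∘ W^† = W^† by exact: adj_proj.
have Ea : W^† ∘ W = a by []; clearbody a.
have bp := projC ap; set b := ione - a in Wmax bp.
have [a1 a2] := ap; have [b1 b2] := bp.
have ba : b ∘ a = 0 by rewrite /b compBl comp1i a2 subrr.
pose isP (V : intw X X) := pisom V /\ a ∘ V = V.
pose P (r : intw X X) := [/\ r <> 0, r ∘ b = r &
  exists V, isP V /\ V^† ∘ V = r].
have Pp r : P r -> is_proj r by move=> [_ _ [V [[Vp _] <-]]]; exact: pisom_proj.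
have [I [q [p [qP qo [pp pq] psep pmax]]]] := maximal_projs Pp.
have [p1 p2] := pp.
have pb : p ∘ b = p.
  apply/esym/eqP; rewrite -subr_eq0 -{1}[p]compi1 -compBr; apply/eqP.
  apply: intw_ext => y; rewrite i_comp i_zero; apply: psep => i.
  apply: (@i_at _ _ _ _ (q i ∘ (ione - b)) 0 y).
  by rewrite compBr compi1; case: (qP i) => _ -> _; rewrite subrr.
have bpp : b ∘ p = p by apply: adj_inj; rewrite adjM p1 b1.
have rp := projB bp pp bpp.
have r0 : b - p = 0.
  apply: contrapT => /(ull_neq0 XB)[T Tr].
  have br : b ∘ (b - p) = b - p by rewrite compBr b2 bpp.
  have WTr : W ∘ W^† ∘ T ∘ (b - p) = T ∘ (b - p).
    have := congr1 (fun G => G ∘ (b - p)) (Wmax T).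
    rewrite comp0i -!compA br compBl comp1i => /eqP; rewrite subr_eq0 => /eqP.
    by rewrite !compA.
  have [|V [Vp V0 Vd Vb]] := @polar _ _ _ _ (W^† ∘ T ∘ (b - p)).
    by move=> h; apply: Tr; rewrite -WTr -!compA in h *; rewrite h compi0.
  have aV : a ∘ V = V by apply: Vd; rewrite !compA aW.
  have Vr : V ∘ (b - p) = V by rewrite -{1}rp.1; apply: Vb; rewrite rp.1 -compA rp.2.
  apply: V0; apply: adj_comp0.
  have [//|V0] := pselect (V^† ∘ V = 0); apply: pmax.
    split=> //; last by exists V.
    by rewrite -compA -{2}Vr -(compA V) compBl b2 pb Vr.
  by rewrite -compA -Vr -(compA V) compBl bpp p2 subrr !compi0.
have bE : b = p by apply/eqP; rewrite -subr_eq0 r0.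
have [|f fi] := separating_countable xsep _ qo.
  by move=> i; split; [exact: Pp|case: (qP i)].
pose V i := projT1 (cid (let: And3 _ _ h := qP i in h)).
have VP i : isP (V i) /\ (V i)^† ∘ V i = q i.
  exact: projT2 (cid (let: And3 _ _ h := qP i in h)).
have Vq i : V i ∘ q i = V i by rewrite -(VP i).2 compA (VP i).1.1.
have qV i : q i ∘ (V i)^† = (V i)^† by apply: adj_proj; [exact: Pp|exact: Vq].
have Va i : V i ∘ a = 0.
  by rewrite -(Vq i); case: (qP i) => _ <- _; rewrite -!compA ba !compi0.
have aV' i : a ∘ (V i)^† = 0 by apply: adj_inj; rewrite !adjE a1 Va.
have [X1 [k [hk kp]]] := split_proj ap.
have pi1 : purely_infinite X1.
  by apply: purely_infinite_sub pi _; apply/usubP; exists k.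
have [S0 [S1 [s0 s1 s01 _]]] := purely_infinite_doubling pi1.
have [c1 c2] := orth_copies_iter s1 s0 s01.
pose G n := k ∘ iter n (icomp S1) S0 ∘ k^†.
have G1 n : (G n)^† ∘ G n = a.
  rewrite /G !adjM adjK -!compA (compA k^†) hk comp1i (compA (_^† : intw X1 X1)) c1.
  by rewrite comp1i kp.
have G2 n m : n <> m -> (G n)^† ∘ G m = 0.
  move=> nm; rewrite /G !adjM adjK -!compA (compA k^†) hk comp1i.
  by rewrite (compA (_^† : intw X1 X1)) c2// comp0i compi0.
have aG n : a ∘ G n = G n by rewrite /G -kp !compA -(compA k k^†) hk compi1.
(* Y None moves a itself, Y (Some i) moves the i-th piece of b; nu numbers them *)
pose Y (s : option I) : intw X X := if s is Some i then V i else a.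
pose nu (s : option I) : nat := if s is Some i then (f i).+1 else 0%N.
have nui s t : s <> t -> nu s <> nu t.
  by case: s t => [i|] [k'|] //= st [] /fi E; apply: st; rewrite E.
have Yp s : pisom (Y s) by case: s => [i|] /=; [case: (VP i) => -[]|exact: proj_pisom].
have aY s : a ∘ Y s = Y s by case: s => [i|] /=; [case: (VP i) => -[]|].
have Yo s t : s <> t -> Y s ∘ (Y t)^† = 0.
  case: s t => [i|] [l|] //= st; rewrite ?a1 ?Va ?aV'//.
  rewrite -(Vq i) -(qV l) -compA (compA (q i)) qo ?comp0i ?compi0//.
  by move=> E; apply: st; rewrite E.
have YN : Y None = a by []; have YS i : Y (Some i) = V i by [].
clearbody G Y; pose T s := W ∘ G (nu s) ∘ Y s.
have TT s t : (T s)^† ∘ T t = (Y s)^† ∘ ((G (nu s))^† ∘ G (nu t)) ∘ Y t.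
  by rewrite /T !adjM -!compA (compA W^†) Ea (compA a) aG.
have TTs s : (T s)^† ∘ T s = (Y s)^† ∘ Y s by rewrite TT G1 -compA aY.
have Tp s : pisom (T s) by apply: gram_pisom; rewrite TTs; exact: pisom_proj.
have To : pairwise_orth T.
  move=> s t st; split; last by rewrite TT G2 ?compi0 ?comp0i//; exact: nui.
  by rewrite /T !adjM -!compA (compA (Y s)) Yo// comp0i !compi0.
have [U TU] := orth_sum Tp To; apply/usubP; exists U.
apply: (osum_isom Tp TU) => y hy.
have Yy s : Y s y = 0.
  have h : (Y s)^† (Y s y) = 0.
    by rewrite -i_comp -TTs i_comp hy intw0.
  by rewrite -(Yp s) -compA !i_comp h intw0.
have ay : a y = 0 by rewrite -YN Yy.
have by0 : b y = 0.
  rewrite bE; apply: psep => i; rewrite -(VP i).2 i_comp.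
  by rewrite -YS Yy intw0.
by move: by0; rewrite /b i_sub ay subr0.
Qed.

(** If [B] has no multiplicity free and no finite part, it is purely infinite, and a part
generated by one vector is minimal. A finite part is semiminimal when no part of it
is multiplicity free. *)
Lemma typed_subobject B : ~ is_trivial B -> exists X, [/\ ~ is_trivial X, usub X B &
  [\/ multiplicity_free X, is_semiminimal X | is_minimal X /\ hereditary_idempotent X]].
Proof.
move=> B0.
have [[X [X0 XB Xmf]]|nomf] :=
  pselect (exists X, [/\ ~ is_trivial X, usub X B & multiplicity_free X]).
  by exists X; split=> //; constructor 1.
have [[X [X0 XB Xfin]]|nofin] :=
  pselect (exists X, [/\ ~ is_trivial X, usub X B & finite_obj X]).
  exists X; split=> //; constructor 2; apply: finite_semiminimal => // Y Y0 YX Ymf.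
  by apply: nomf; exists Y; split=> //; exact: usub_trans YX XB.
have pi : purely_infinite B by move=> X X0 XB Xfin; apply: nofin; exists X.
have /existsNP[x x0] := B0; have [X [V [X0 hV xsep]]] := separating_sub x0.
have XB : usub X B by apply/usubP; exists V.
have piX := purely_infinite_sub pi XB.
exists X; split=> //; constructor 3; split; first exact: purely_infinite_minimal piX xsep.
exact: purely_infinite_idempotent.
Qed.

Lemma usub_multiple A (I : choiceType) (i : I) : usub A (multiple I A).
Proof. by apply/usubP; exists (dpr (fun=> A) i)^†; exact: dpr_isom. Qed.

Lemma usub_summand (I : choiceType) (F : I -> CDD R N) A i : uequiv A (dsum F) ->
  usub (F i) A.
Proof.
move=> /uequivP[V [_ hV]]; apply/usubP; exists (V^† ∘ (dpr F i)^†).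
by apply: isom_comp => //; exact: dpr_isom.
Qed.

(** Each of the three kinds of parts lies below the corresponding greatest tuple; a
semiminimal one lies below its countable multiple. *)
Lemma unity_meets J B : is_unity J -> ~ is_trivial B ->
  exists X, [/\ ~ is_trivial X, usub X B & usub X J].
Proof.
move=> [J1 [J2 [J3 [[_ h1] [_ h2] [_ h3] [_ hJ]]]]] /typed_subobject[X [X0 XB Xt]].
exists X; split=> //.
have sub k := usub_summand k hJ.
case: Xt => [/h1 XJ|Xs|/h3 XJ].
- exact: usub_trans XJ (sub ord0).
- apply: (usub_trans (usub_multiple X 0%N)); apply: (usub_trans _ (sub (lift ord0 ord0))).
  apply: h2; exists X; split=> //; apply/uequivP; exists ione.
  by rewrite adj1; split; exact: isom1.
- exact: usub_trans XJ (sub ord_max).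
Qed.

(** By [ullP] it suffices to separate points. If all intertwiners to [J] killed some nonzero
[x], the part of [A] generated by [x] would share a nonzero part [Z] with [J], and
the projection of [x] to [Z] is nonzero. *)
Lemma ull_unity J A : is_unity J -> ull A J.
Proof.
move=> hJ; apply/ullP => x hx; apply: contrapT => /separating_sub[X [V [X0 hV xsep]]].
have [Z [Z0 /usubP[S hS] /usubP[T hT]]] := unity_meets hJ X0.
have SSx : (S ∘ S^†) (V^† x) = 0.
  have Sx : S^† (V^† x) = 0 by apply: (isom_inj hT); exact: (hx (T ∘ S^† ∘ V^†)).
  by rewrite i_comp Sx intw0.
apply/(isom_neq0 Z0 hS)/adj_inj; rewrite adj0; apply: adj_comp0; rewrite adjK.
exact: xsep (isom_coproj hS) SSx.
Qed.

End Unity.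

Theorem proposition9p8 (R : realType) (N : nat) (hN : (1 <= N)%N)
    (J : CDD R N) (hJ : is_unity J) (A : CDD R N) :
  ull A J.
Proof. exact: ull_unity. Qed.
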